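(* Let $\chi\le 0$ be a real number, let $X$ be a complete geodesic metric space and let $\Delta\subseteq X$ be a nonempty closed convex subset. Assume: (A) every geodesic triangle in $X$ with a vertex in $\Delta$ satisfies the CAT($\chi$) inequality; (B) for every $c\in\Delta$, local geodesics in the metric completion $\overline{T_cX}$ of the tangent space $T_cX$ are unique (any two points of $\overline{T_cX}$ are joined by at most one local geodesic, up to affine reparameterization); (C) there exists $\lambda>0$ such that for all $x\in X-\Delta$, the closed ball with center $x$ and radius $\lambda\cdot d(x,\Delta)$ is complete and CAT($\chi$). Then $X$ is CAT($\chi$).
   Context: Geodesics. In a metric space $(X,d)$ a path $\gamma:I\to X$ on a compact interval is a geodesic (of speed $\sigma\ge0$) if $d(\gamma(s),\gamma(t))=\sigma|s-t|$ for all $s,t\in I$, and a local geodesic (of speed $\sigma$) if this holds locally on $I$. Geodesics are thus parameterized proportionally to arclength. $X$ is a geodesic space if any two points are joined by a geodesic. A subset $C\subseteq X$ is convex if any two of its points may be joined by a geodesic in $X$ and every geodesic of $X$ joining them lies in $C$. CAT($\chi$), $\chi\le0$. Let $X_\chi$ be the complete connected simply connected surface of constant curvature $\chi$. A triangle with vertices $x,y,z$ is a choice of local geodesics (edges) joining them in pairs; it is a geodesic triangle if the edges are geodesics. A comparison triangle is a geodesic triangle in $X_\chi$ whose edges have the same lengths as those of the given triangle. A triangle having a comparison triangle satisfies the CAT($\chi$) inequality if for any two points $v',w'$ on edges of the comparison triangle, the corresponding points $v,w$ on the corresponding edges of the original triangle satisfy $d_X(v,w)\le d_{X_\chi}(v',w')$.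 A metric space is CAT($\chi$) if it is a geodesic space and every geodesic triangle in it satisfies the CAT($\chi$) inequality. Tangent space. For $x\in X$, a geodesic-germ at $x$ is an equivalence class of geodesics $[0,\epsilon]\to X$ ($\epsilon>0$) starting at $x$, two being equivalent if they agree near $0$ (the constant geodesic is allowed). Put $D(\gamma,\gamma')=\limsup_{t\to0}d(\gamma(t),\gamma'(t))/t$. The tangent space $T_xX$ is the set of geodesic-germs at $x$ with germs at $D$-distance $0$ identified, with metric $D$. *)

(* Defs.v *)
From HB Require Import structures.
From mathcomp Require Import all_boot all_order all_algebra.
From mathcomp Require Import all_classical all_reals all_analysis.
From mathcomp Require Import ring lra.

Set Implicit Arguments.
Unset Strict Implicit.
Unset Printing Implicit Defensive.

Import Order.TTheory GRing.Theory Num.Theory.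
Import numFieldNormedType.Exports.
Import metricType_numDomainType.

Local Open Scope classical_set_scope.
Local Open Scope ring_scope.

(* The condition of the library's [completeType], without its requirement that
   the space be pointed. *)
Definition complete_space (X : uniformType) : Prop :=
  forall F : set_system X, ProperFilter F -> cauchy F -> exists l : X, F --> l.

Definition dist_to_set (R : realType) (X : metricType R) (x : X) (A : set X) : R :=
  inf [set mdist x a | a in A].

(* In a general metric space this can be larger than the library's
   [closed_ball], which is the closure of the open ball. *)
Definition metric_closed_ball (R : realType) (X : metricType R) (x : X) (r : R) :
  set X := [set y | mdist x y <= r].

(* A subset [A], coerced to a type by the library, is a metric space for the
   restricted distance. *)
Section subset_metric.
Variables (R : realType) (X : metricType R) (A : set X).

Definition subset_dist (x y : A) : R := mdist (\val x) (\val y).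

Let subset_dist_ge0 (x y : A) : 0 <= subset_dist x y.
Proof. exact: mdist_ge0. Qed.

Let subset_dist_positivity (x y : A) : subset_dist x y = 0 -> x = y.
Proof. by move=> /mdist_positivity /val_inj. Qed.

Let subset_ballE (x : A) (d : R) : ball x d = [set y | subset_dist x y < d].
Proof.
by rewrite -[LHS]initial_ballE ballEmdist; apply/seteqP; split=> y.
Qed.

HB.instance Definition _ := @PseudoMetric_isMetric.Build R (A : Type)
  subset_dist subset_dist_ge0 subset_dist_positivity subset_ballE.

End subset_metric.

(* The metric space obtained from a pseudometric by identifying points at
   distance zero. *)
Record pseudo_distance (R : realType) (T : Type) := PseudoDistance {
  pdist :> T -> T -> R;
  pdist_refl : forall x, pdist x x = 0;
  pdist_sym : forall x y, pdist x y = pdist y x;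
  pdist_triangle : forall y x z, pdist x z <= pdist x y + pdist y z
}.

Section metric_quotient.
Local Open Scope quotient_scope.
Variables (R : realType) (T : Type) (d : pseudo_distance R T).

Definition at_dist0 : rel {classic T} := fun x y => d x y == 0.

Lemma pdist_ge0 x y : 0 <= d x y.
Proof.
have := pdist_triangle d y x x.
by rewrite pdist_refl (pdist_sym d y x) -mulr2n pmulrn_lge0.
Qed.

Let at_dist0_refl : reflexive at_dist0.
Proof. by move=> x; rewrite /at_dist0 pdist_refl. Qed.

Let at_dist0_sym : symmetric at_dist0.
Proof. by move=> x y; rewrite /at_dist0 pdist_sym. Qed.

Let at_dist0_trans : transitive at_dist0.
Proof.
move=> y x z /eqP xy /eqP yz; rewrite /at_dist0 eq_le pdist_ge0 andbT.
by have := pdist_triangle d y x z; rewrite xy yz addr0.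
Qed.

Canonical at_dist0_equiv :=
  EquivRel at_dist0 at_dist0_refl at_dist0_sym at_dist0_trans.

Definition metric_quotient : Type := {eq_quot at_dist0_equiv}.

HB.instance Definition _ := Choice.copy metric_quotient {eq_quot at_dist0_equiv}.

Definition quotient_class (x : T) : metric_quotient :=
  \pi_({eq_quot at_dist0_equiv}) (x : {classic T}).

Definition quotient_dist (p q : metric_quotient) : R :=
  d (repr (p : {eq_quot at_dist0_equiv})) (repr (q : {eq_quot at_dist0_equiv})).

Let quotient_distxx p : quotient_dist p p = 0.
Proof. exact: pdist_refl. Qed.

Let quotient_dist_sym p q : quotient_dist p q = quotient_dist q p.
Proof. exact: pdist_sym. Qed.

Let quotient_dist_triangle q p r :
  quotient_dist p r <= quotient_dist p q + quotient_dist q r.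
Proof. exact: pdist_triangle. Qed.

Let quotient_dist_positivity p q : quotient_dist p q = 0 -> p = q.
Proof.
move=> /eqP pq0; rewrite -(reprK (p : {eq_quot at_dist0_equiv})).
rewrite -[RHS](reprK (q : {eq_quot at_dist0_equiv})).
exact/eqmodP.
Qed.

HB.instance Definition _ := @isMetric.Build R metric_quotient quotient_dist
  quotient_distxx quotient_dist_positivity quotient_dist_sym
  quotient_dist_triangle.

Lemma quotient_classE x y : mdist (quotient_class x) (quotient_class y) = d x y.
Proof.
have repr0 (z : T) : d (repr (\pi_({eq_quot at_dist0_equiv}) (z : {classic T}))) z = 0.
  by apply/eqP; rewrite -[_ == 0]/(at_dist0_equiv _ _) -eqmodE reprK.
rewrite [LHS]/(d _ _); set x' := repr _; set y' := repr _.
have x'0 : d x' x = 0 by exact: repr0.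
have y'0 : d y' y = 0 by exact: repr0.
apply/eqP; rewrite eq_le; apply/andP; split.
  apply: (le_trans (pdist_triangle d x _ _)); rewrite x'0 add0r.
  by apply: (le_trans (pdist_triangle d y _ _)); rewrite (pdist_sym d y) y'0 addr0.
apply: (le_trans (pdist_triangle d x' _ _)); rewrite (pdist_sym d x) x'0 add0r.
by apply: (le_trans (pdist_triangle d y' _ _)); rewrite y'0 addr0.
Qed.

End metric_quotient.

(* Metric completion: Cauchy sequences, with the pseudometric
   [lim_n d (u n) (v n)], two sequences at distance zero being identified. *)
Section completion.
Variables (R : realType) (X : metricType R).

Record cauchy_sequence := CauchySequence {
  cauchy_terms :> nat -> X;
  cauchy_termsP : cauchy (cauchy_terms @ \oo)
}.

Definition cauchy_dist (u v : cauchy_sequence) : R :=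
  limn (fun n => mdist (u n) (v n)).

Lemma mdist_dist2 (x y x' y' : X) :
  `|mdist x y - mdist x' y'| <= mdist x x' + mdist y y'.
Proof.
rewrite ler_norml; apply/andP; split.
  have := metric_triangle x' x y'; have := metric_triangle x y y'.
  rewrite (metric_sym x' x); lra.
have := metric_triangle x x' y; have := metric_triangle x' y' y.
rewrite (metric_sym y' y); lra.
Qed.

Lemma cauchy_dist_cvg (u v : cauchy_sequence) :
  cvgn (fun n => mdist (u n) (v n)).
Proof.
apply/cauchy_cvgP/cauchy_ballP => e e0.
have e20 : 0 < e / 2 by rewrite divr_gt0.
have /cauchy_ballP/(_ _ e20)[[P P'] [/= uP uP'] PP'] := cauchy_termsP u.
have /cauchy_ballP/(_ _ e20)[[Q Q'] [/= vQ vQ'] QQ'] := cauchy_termsP v.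
pose D (A B : set X) :=
  [set mdist (u n) (v n) | n in [set n | A (u n) /\ B (v n)]].
exists (D P Q, D P' Q') => /=.
  split; rewrite nbhs_simpl/=; [near=> n|near=> n]; exists n => //; split.
  - by near: n; exact: uP.
  - by near: n; exact: vQ.
  - by near: n; exact: uP'.
  - by near: n; exact: vQ'.
move=> _ [/= [m [Pm Qm] <-] [n [Pn Qn] <-]].
rewrite /ball/=; apply: (le_lt_trans (mdist_dist2 _ _ _ _)).
have := PP' (u m, u n) (conj Pm Pn); have := QQ' (v m, v n) (conj Qm Qn).
by rewrite /= !ballEmdist/= => ? ?; rewrite [e]splitr ltrD.
Unshelve. all: by end_near. Qed.

Let cauchy_dist_refl u : cauchy_dist u u = 0.
Proof.
rewrite /cauchy_dist (_ : (fun n => _) = cst 0) ?lim_cst//.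
by apply/funext => n; rewrite mdistxx.
Qed.

Let cauchy_dist_sym u v : cauchy_dist u v = cauchy_dist v u.
Proof.
by congr (limn _); apply/funext => n; rewrite metric_sym.
Qed.

Let cauchy_dist_triangle v u w :
  cauchy_dist u w <= cauchy_dist u v + cauchy_dist v w.
Proof.
rewrite /cauchy_dist -limD; [|exact: cauchy_dist_cvg..].
apply: ler_lim; [exact: cauchy_dist_cvg|by apply: is_cvgD; exact: cauchy_dist_cvg|].
by near=> n; exact: metric_triangle.
Unshelve. all: by end_near. Qed.

Definition cauchy_pseudo_distance : pseudo_distance R cauchy_sequence :=
  PseudoDistance cauchy_dist_refl cauchy_dist_sym cauchy_dist_triangle.

Definition completion : metricType R := metric_quotient cauchy_pseudo_distance.

End completion.

(* A path on the compact interval [[cbegin, cend]]; the values of [cfun]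
   outside that interval are irrelevant. *)
Record curve (R : realType) (X : Type) := Curve {
  cbegin : R;
  cend : R;
  cfun :> R -> X;
  cbegin_le_cend : cbegin <= cend
}.

Section geodesics.
Variables (R : realType) (X : metricType R).
Implicit Types (g : curve R X) (x y : X).

Definition cdom g : set R := `[cbegin g, cend g]%classic.

Definition csource g : X := g (cbegin g).
Definition ctarget g : X := g (cend g).

(* The affine reparameterization of [g] by the unit interval. *)
Definition cpoint g (t : R) : X := g (line_path (cbegin g) (cend g) t).

Definition geodesic g : Prop :=
  exists2 s : R, 0 <= s &
    forall u v, cdom g u -> cdom g v -> mdist (g u) (g v) = s * `|u - v|.

Definition local_geodesic g : Prop :=
  exists2 s : R, 0 <= s &
    forall t, cdom g t -> exists2 e : R, 0 < e &
      forall u v, cdom g u -> cdom g v -> `|u - t| < e -> `|v - t| < e ->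
        mdist (g u) (g v) = s * `|u - v|.

Definition joins g x y : Prop := csource g = x /\ ctarget g = y.

Definition geodesic_space : Prop :=
  forall x y, exists2 g, geodesic g & joins g x y.

Definition geodesically_convex (C : set X) : Prop :=
  forall x y, C x -> C y ->
    (exists2 g, geodesic g & joins g x y) /\
    (forall g, geodesic g -> joins g x y -> forall t, cdom g t -> C (g t)).

Definition unique_local_geodesics : Prop :=
  forall x y g h, local_geodesic g -> joins g x y ->
    local_geodesic h -> joins h x y ->
    forall t, 0 <= t <= 1 -> cpoint g t = cpoint h t.

End geodesics.

Arguments geodesic_space {R} X.
Arguments unique_local_geodesics {R} X.

Definition arcosh (R : realType) (y : R) : R := ln (y + Num.sqrt (y ^+ 2 - 1)).

(* The model surface of curvature [chi <= 0]. For [chi = 0] it is the Euclidean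
   plane. For [chi < 0] it is the hyperboloid
     [z ^+ 2 = 1 + x ^+ 2 + y ^+ 2, 0 < z]
   in Minkowski space, in the coordinates [(x, y)]; the distance of curvature
   [-1] satisfies [cosh d = z * z' - x * x' - y * y'], and is divided by
   [sqrt (- chi)]. For [chi > 0] the definition is meaningless. *)
Definition model_surface (R : realType) (chi : R) : Type := (R * R)%type.

HB.instance Definition _ (R : realType) (chi : R) :=
  Choice.copy (model_surface chi) (R * R)%type.

Section model_surface.
Variables (R : realType) (chi : R).
Implicit Types p q r : R * R.

Definition height p : R := Num.sqrt (1 + p.1 ^+ 2 + p.2 ^+ 2).

Definition minkowski p q : R := height p * height q - p.1 * q.1 - p.2 * q.2.

Definition hyperbolic_dist p q : R := arcosh (minkowski p q) / Num.sqrt (- chi).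

Definition euclidean_dist p q : R :=
  Num.sqrt ((p.1 - q.1) ^+ 2 + (p.2 - q.2) ^+ 2).

Definition model_dist (p q : model_surface chi) : R :=
  if chi < 0 then hyperbolic_dist p q else euclidean_dist p q.

Let height_ge0 p : 0 <= height p.
Proof. exact: sqrtr_ge0. Qed.

Let height2 p : height p ^+ 2 = 1 + p.1 ^+ 2 + p.2 ^+ 2.
Proof. by rewrite sqr_sqrtr// !addr_ge0// sqr_ge0. Qed.

Let minkowski_sym p q : minkowski p q = minkowski q p.
Proof. by rewrite /minkowski; ring. Qed.

Let minkowskixx p : minkowski p p = 1.
Proof. by rewrite /minkowski -!expr2 height2; ring. Qed.

Let minkowski_excess p q :
  (height p * height q) ^+ 2 - (1 + p.1 * q.1 + p.2 * q.2) ^+ 2 =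
  (p.1 - q.1) ^+ 2 + (p.2 - q.2) ^+ 2 + (p.1 * q.2 - p.2 * q.1) ^+ 2.
Proof. by rewrite exprMn !height2; ring. Qed.

Let minkowski_ge1 p q : 1 <= minkowski p q.
Proof.
suff : 1 + p.1 * q.1 + p.2 * q.2 <= height p * height q.
  by rewrite /minkowski; lra.
apply: (le_trans (ler_norm _)).
rewrite -sqrtr_sqr -[leRHS]ger0_norm ?mulr_ge0// -sqrtr_sqr.
by rewrite ler_wsqrtr// -subr_ge0 minkowski_excess !addr_ge0// sqr_ge0.
Qed.

Let minkowski_eq1 p q : minkowski p q = 1 -> p = q.
Proof.
move=> pq1; have : height p * height q = 1 + p.1 * q.1 + p.2 * q.2.
  by rewrite -[in RHS]pq1 /minkowski; ring.
move=> /(congr1 (fun x => x ^+ 2)) /eqP; rewrite -subr_eq0 minkowski_excess.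
rewrite paddr_eq0 ?addr_ge0 ?sqr_ge0// paddr_eq0 ?sqr_ge0// !sqrf_eq0 !subr_eq0.
by case: p q {pq1} => [p1 p2] [q1 q2] /= /andP[/andP[/eqP -> /eqP ->] _].
Qed.

(* The Gram determinant of three vectors of Minkowski space is a square. *)
Let minkowski_gram p q r :
  (minkowski p r - minkowski p q * minkowski q r) ^+ 2 <=
  (minkowski p q ^+ 2 - 1) * (minkowski q r ^+ 2 - 1).
Proof.
pose D := height p * (q.1 * r.2 - q.2 * r.1)
        - p.1 * (height q * r.2 - q.2 * height r)
        + p.2 * (height q * r.1 - q.1 * height r).
pose n2 p := height p ^+ 2 - p.1 ^+ 2 - p.2 ^+ 2.
have n21 x : n2 x = 1 by rewrite /n2 height2; ring.
have gram : n2 p * n2 q * n2 r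
    + 2 * minkowski p q * minkowski q r * minkowski p r
    - n2 p * minkowski q r ^+ 2 - n2 q * minkowski p r ^+ 2
    - n2 r * minkowski p q ^+ 2 = D ^+ 2.
  by rewrite /n2 /minkowski /D; ring.
rewrite -subr_ge0 (_ : _ - _ = D ^+ 2) ?sqr_ge0// -gram !n21; ring.
Qed.

Let arcosh_le (a b : R) : 1 <= a -> a <= b -> arcosh a <= arcosh b.
Proof.
move=> a1 ab; have a2b2 : a ^+ 2 <= b ^+ 2 by nra.
have sa : 0 <= Num.sqrt (a ^+ 2 - 1) by exact: sqrtr_ge0.
have sb : 0 <= Num.sqrt (b ^+ 2 - 1) by exact: sqrtr_ge0.
rewrite ler_ln ?posrE; [|lra..].
by rewrite lerD// ler_wsqrtr// lerD2r.
Qed.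

Let arcosh1 : arcosh (1 : R) = 0.
Proof. by rewrite /arcosh expr1n subrr sqrtr0 addr0 ln1. Qed.

Let arcosh_eq0 (a : R) : 1 <= a -> arcosh a = 0 -> a = 1.
Proof.
move=> a1 /eqP; have sa : 0 <= Num.sqrt (a ^+ 2 - 1) by exact: sqrtr_ge0.
by rewrite ln_eq0; [move=> /eqP|]; lra.
Qed.

Let arcoshD (a b : R) : 1 <= a -> 1 <= b ->
  arcosh (a * b + Num.sqrt (a ^+ 2 - 1) * Num.sqrt (b ^+ 2 - 1)) =
  arcosh a + arcosh b.
Proof.
move=> a1 b1; rewrite /arcosh.
set s := Num.sqrt (a ^+ 2 - 1); set t := Num.sqrt (b ^+ 2 - 1).
have s0 : 0 <= s by exact: sqrtr_ge0.
have t0 : 0 <= t by exact: sqrtr_ge0.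
have s2 : s ^+ 2 = a ^+ 2 - 1 by rewrite sqr_sqrtr//; nra.
have t2 : t ^+ 2 = b ^+ 2 - 1 by rewrite sqr_sqrtr//; nra.
have -> : (a * b + s * t) ^+ 2 - 1 = (a * t + b * s) ^+ 2.
  by apply/eqP; rewrite -subr_eq0; apply/eqP; ring: s2 t2.
rewrite sqrtr_sqr ger0_norm ?addr_ge0// ?mulr_ge0//; [|lra..].
rewrite -lnM ?posrE; [|lra..].
by congr ln; ring.
Qed.

Let hyperbolic_dist_triangle q p r :
  hyperbolic_dist p r <= hyperbolic_dist p q + hyperbolic_dist q r.
Proof.
rewrite /hyperbolic_dist -mulrDl ler_wpM2r ?invr_ge0 ?sqrtr_ge0//.
rewrite -arcoshD//; apply: arcosh_le => //.
rewrite -lerBlDl -sqrtrM; last by have := minkowski_ge1 p q; nra.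
by apply: (le_trans (ler_norm _)); rewrite -sqrtr_sqr ler_wsqrtr.
Qed.

Let euclidean_dist_triangle q p r :
  euclidean_dist p r <= euclidean_dist p q + euclidean_dist q r.
Proof.
rewrite /euclidean_dist.
set a1 := p.1 - q.1; set a2 := p.2 - q.2.
set b1 := q.1 - r.1; set b2 := q.2 - r.2.
have -> : p.1 - r.1 = a1 + b1 by rewrite /a1 /b1; ring.
have -> : p.2 - r.2 = a2 + b2 by rewrite /a2 /b2; ring.
set s := Num.sqrt (a1 ^+ 2 + a2 ^+ 2); set t := Num.sqrt (b1 ^+ 2 + b2 ^+ 2).
have s0 : 0 <= s by exact: sqrtr_ge0.
have t0 : 0 <= t by exact: sqrtr_ge0.
have s2 : s ^+ 2 = a1 ^+ 2 + a2 ^+ 2 by rewrite sqr_sqrtr// addr_ge0 ?sqr_ge0.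
have t2 : t ^+ 2 = b1 ^+ 2 + b2 ^+ 2 by rewrite sqr_sqrtr// addr_ge0 ?sqr_ge0.
have st : a1 * b1 + a2 * b2 <= s * t.
  apply: (le_trans (ler_norm _)).
  rewrite -sqrtr_sqr -[leRHS]ger0_norm ?mulr_ge0// -sqrtr_sqr ler_wsqrtr//.
  rewrite exprMn s2 t2 -subr_ge0.
  by rewrite (_ : _ - _ = (a1 * b2 - a2 * b1) ^+ 2) ?sqr_ge0//; ring.
rewrite -[leRHS]ger0_norm ?addr_ge0// -sqrtr_sqr ler_wsqrtr//.
by rewrite (sqrrD s t) s2 t2; nra.
Qed.

Let model_distxx p : model_dist p p = 0.
Proof.
rewrite /model_dist /hyperbolic_dist /euclidean_dist minkowskixx arcosh1 mul0r.
by rewrite !subrr !expr0n addr0 sqrtr0 if_same.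
Qed.

Let model_dist_positivity p q : model_dist p q = 0 -> p = q.
Proof.
rewrite /model_dist; case: ifPn => [chi0|_] /eqP.
  rewrite mulf_eq0 invr_eq0 sqrtr_eq0 oppr_le0 leNgt chi0 orbF.
  by move=> /eqP/arcosh_eq0-/(_ (minkowski_ge1 _ _))/minkowski_eq1.
rewrite sqrtr_eq0 => pq.
have : (p.1 - q.1) ^+ 2 + (p.2 - q.2) ^+ 2 == 0.
  by rewrite eq_le pq addr_ge0 ?sqr_ge0.
rewrite paddr_eq0 ?sqr_ge0// !sqrf_eq0 !subr_eq0.
by case: p q {pq} => [p1 p2] [q1 q2] /= /andP[/eqP -> /eqP ->].
Qed.

Let model_dist_sym p q : model_dist p q = model_dist q p.
Proof.
rewrite /model_dist /hyperbolic_dist minkowski_sym /euclidean_dist.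
by rewrite -[p.1 - _]opprB -[p.2 - _]opprB !sqrrN.
Qed.

Let model_dist_triangle q p r :
  model_dist p r <= model_dist p q + model_dist q r.
Proof. by rewrite /model_dist; case: ifP. Qed.

HB.instance Definition _ := @isMetric.Build R (model_surface chi) model_dist
  model_distxx model_dist_positivity model_dist_sym model_dist_triangle.

End model_surface.

(* Edge [e i] joins vertex [v i] to the cyclically next vertex. *)
Definition geodesic_triangle (R : realType) (X : metricType R)
    (v : 'I_3 -> X) (e : 'I_3 -> curve R X) : Prop :=
  forall i, geodesic (e i) /\ joins (e i) (v i) (v (ordS i)).

(* The length of a geodesic is the distance between its endpoints. *)
Definition comparison_triangle (R : realType) (X : metricType R) (chi : R)
    (e : 'I_3 -> curve R X) (v' : 'I_3 -> model_surface chi)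
    (e' : 'I_3 -> curve R (model_surface chi)) : Prop :=
  geodesic_triangle v' e' /\
  forall i, mdist (csource (e' i)) (ctarget (e' i)) =
            mdist (csource (e i)) (ctarget (e i)).

(* Corresponding points on corresponding edges are those with equal affine
   parameter. *)
Definition CAT_inequality (R : realType) (X : metricType R) (chi : R)
    (e : 'I_3 -> curve R X) : Prop :=
  forall (v' : 'I_3 -> model_surface chi) (e' : 'I_3 -> curve R (model_surface chi)),
    comparison_triangle e v' e' ->
    forall i j s t, 0 <= s <= 1 -> 0 <= t <= 1 ->
      mdist (cpoint (e i) s) (cpoint (e j) t) <=
      mdist (cpoint (e' i) s) (cpoint (e' j) t).

Definition CAT (R : realType) (chi : R) (X : metricType R) : Prop :=
  geodesic_space X /\
  forall (v : 'I_3 -> X) (e : 'I_3 -> curve R X),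
    geodesic_triangle v e -> CAT_inequality chi e.

Section tangent_space.
Variables (R : realType) (X : metricType R) (x : X).

Record geodesic_from := GeodesicFrom {
  gcurve :> curve R X;
  gcurve_geodesic : geodesic gcurve;
  gcurve_begin : cbegin gcurve = 0;
  gcurve_end : 0 < cend gcurve;
  gcurve_source : gcurve 0 = x
}.

Implicit Types g h k : geodesic_from.

Definition germ_quot g h (t : R) : R := mdist (g t) (h t) / t.

Definition germ_dist g h : R :=
  fine (limf_esup (EFin \o germ_quot g h) 0^'+).

Let germ_quot_ge0 g h : \forall t \near 0^'+, 0 <= germ_quot g h t.
Proof.
by near=> t; rewrite divr_ge0// ?mdist_ge0.
Unshelve. all: by end_near. Qed.

Let germ_bounded g : exists M : R, \forall t \near 0^'+, mdist (g t) x / t <= M.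
Proof.
have [s s0 gs] := gcurve_geodesic g; exists s.
near=> t; have t0 : 0 < t by [].
rewrite ler_pdivrMr// -(gcurve_source g) gs.
- by rewrite subr0 gtr0_norm.
- rewrite /cdom/= in_itv/= gcurve_begin (ltW t0)/=.
  by near: t; apply: nbhs_right_le; exact: gcurve_end.
- by rewrite /cdom/= in_itv/= gcurve_begin lexx ltW// gcurve_end.
Unshelve. all: by end_near. Qed.

Let germ_quot_bounded g h : exists M : R, \forall t \near 0^'+, germ_quot g h t <= M.
Proof.
have [M gM] := germ_bounded g; have [N hN] := germ_bounded h.
exists (M + N); near=> t; have t0 : 0 < t by [].
apply: (@le_trans _ _ (mdist (g t) x / t + mdist (h t) x / t)); last first.
  by apply: lerD; near: t.
rewrite -mulrDl ler_wpM2r ?invr_ge0 ?(ltW t0)// (metric_sym (h t)).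
exact: metric_triangle.
Unshelve. all: by end_near. Qed.

Let esup_le g h (M : R) : (\forall t \near 0^'+, germ_quot g h t <= M) ->
  (limf_esup (EFin \o germ_quot g h) 0^'+ <= M%:E)%E.
Proof.
move=> ghM; apply: (@le_trans _ _ (ereal_sup
    ((EFin \o germ_quot g h) @` [set t | germ_quot g h t <= M]))).
  by apply: ereal_inf_lbound; exists [set t | germ_quot g h t <= M].
by apply: ge_ereal_sup => _ [t /= tM <-]; rewrite lee_fin.
Qed.

Let esup_ge0 g h : (0 <= limf_esup (EFin \o germ_quot g h) 0^'+)%E.
Proof.
apply: le_ereal_inf_tmp => _ [A A0 <-].
have [t [At t0]] := filter_ex (filterI A0 (germ_quot_ge0 g h)).
apply: (@le_trans _ _ (germ_quot g h t)%:E); first by rewrite lee_fin.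
by apply: ereal_sup_ubound; exists t.
Qed.

Let esup_fin g h : limf_esup (EFin \o germ_quot g h) 0^'+ \is a fin_num.
Proof.
have [M /esup_le ghM] := germ_quot_bounded g h.
by rewrite ge0_fin_numE// (le_lt_trans ghM)// ltry.
Qed.

Let germ_dist_le g h (M : R) : (\forall t \near 0^'+, germ_quot g h t <= M) ->
  germ_dist g h <= M.
Proof. by move=> /esup_le; rewrite -lee_fin fineK. Qed.

Let germ_dist_near g h (e : R) : 0 < e ->
  \forall t \near 0^'+, germ_quot g h t <= germ_dist g h + e.
Proof.
move=> e0; have : (limf_esup (EFin \o germ_quot g h) 0^'+ <
    (germ_dist g h + e)%:E)%E.
  by rewrite EFinD fineK// lteDl.
move=> /ereal_inf_lt[_ [A A0 <-] Ae]; near=> t.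
rewrite -lee_fin; apply: le_trans (ltW Ae); apply: ereal_sup_ubound.
by exists t => //; near: t.
Unshelve. all: by end_near. Qed.

Let germ_dist_refl g : germ_dist g g = 0.
Proof.
apply/eqP; rewrite eq_le fine_ge0// andbT; apply: germ_dist_le.
by near=> t; rewrite /germ_quot mdistxx mul0r.
Unshelve. all: by end_near. Qed.

Let germ_dist_sym g h : germ_dist g h = germ_dist h g.
Proof.
congr (fine (limf_esup _ _)); apply/funext => t.
by rewrite /= /germ_quot metric_sym.
Qed.

Let germ_dist_triangle h g k : germ_dist g k <= germ_dist g h + germ_dist h k.
Proof.
apply/ler_addgt0Pl => e e0; apply: germ_dist_le.
have e20 : 0 < e / 2 by rewrite divr_gt0.
near=> t; have t0 : 0 < t by [].
apply: (@le_trans _ _ (germ_quot g h t + germ_quot h k t)).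
  by rewrite /germ_quot -mulrDl ler_wpM2r ?invr_ge0 ?(ltW t0)// metric_triangle.
apply: (@le_trans _ _ ((germ_dist g h + e / 2) + (germ_dist h k + e / 2))).
  by apply: lerD; near: t; exact: germ_dist_near.
by rewrite addrACA -splitr addrC.
Unshelve. all: by end_near. Qed.

Definition germ_pseudo_distance : pseudo_distance R geodesic_from :=
  PseudoDistance germ_dist_refl germ_dist_sym germ_dist_triangle.

(* Geodesics with the same germ agree near [0], hence are at distance zero, so
   the passage to germs is subsumed in the quotient. *)
Definition tangent_space : metricType R := metric_quotient germ_pseudo_distance.

End tangent_space.

(* Main.v *)
From HB Require Import structures.
From mathcomp Require Import all_boot all_order all_algebra.
From mathcomp Require Import all_classical all_reals all_analysis.
From mathcomp Require Import ring lra.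
Require Import Defs.

Set Implicit Arguments.
Unset Strict Implicit.
Unset Printing Implicit Defensive.

Import Order.TTheory GRing.Theory Num.Theory.
Import numFieldNormedType.Exports.

Local Open Scope classical_set_scope.
Local Open Scope ring_scope.

(** Comparison is expressed by one inequality, [stewart], between a vertex and a
    point of the opposite side; in the model surface it is the theorem of Stewart
    ([model_stewart]), and its validity for all triangles amounts to the CAT
    condition ([stewart_CAT]). The inequality is local along the side: it follows
    from its infinitesimal form at the inner points [y] of the side
    ([kinks_stewart]), and the latter from comparison for the hinges at [y] with
    one short side and the other side on a geodesic from [y] to the vertex [z]
    ([stewart_hinges_kink]). So one has to compare narrow hinges along an
    arbitrary geodesic from [y] to [z].

    If the geodesic meets [Delta], it is divided by a point of [Delta], and
    triangles with a vertex in [Delta] suffice ([stewart_through]). Otherwise it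
    keeps a positive distance from [Delta] ([geodesic_clearance]), and a tube
    around it is covered by small balls in which comparison holds. There the
    classical patchwork applies: comparison for a long thin hinge is assembled
    from short ones by induction on the length ([tube_hinges]), with
    [stewart_glue] joining two comparison triangles along a common side. All this
    needs is that geodesics towards [z] depend continuously on their origin
    ([geodesic_perturbation]). A perturbed geodesic can be constructed as a local
    geodesic, so the crux is that local geodesics outside [Delta] are determined
    by their ends ([local_geo_unique]).

    Let two local geodesics outside [Delta] join [z] to [p]. Comparison with
    vertices in [Delta] shows that both are shorter than every detour through
    [Delta] ([local_geo_lt_detour]). Let [c] be the point of [Delta] with the
    shortest detour ([exists_nearest_detour]), and contract the two local
    geodesics towards [c] by a factor close to [1]. Contraction multiplies lengths
    by at most the factor, whereas the detours between the contracted ends remain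
    longer by the same proportion, so that the contracted path has a distance from
    [Delta] proportional to the scale ([level_far]); in balls of proportional
    radius comparison with the Euclidean plane holds, and the contracted path can
    be relaxed to a local geodesic ([level_step]). Iteration yields local geodesics
    at all small scales. Seen from [c] they converge to a local geodesic of the
    completed tangent space at [c] ([limit_point_local_geodesic]), with ends that
    only depend on [z] and [p]. By uniqueness in the tangent space the two
    families have the same limit ([limit_points_eq]). So they are close, relative
    to the scale, at late levels; there they coincide, because local geodesics
    that are close to each other coincide ([level_unique]). Consecutive levels
    being close as well, the coincidence propagates back to the first level, that
    is to the given local geodesics ([families_eq]).

    Local geodesics are handled through equidistant points, as chains in which
    each inner point is the midpoint of its neighbours. Such chains are the
    critical points of the energy, which is uniformly convex where Euclidean
    comparison holds; existence and uniqueness of nearby local geodesics become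
    statements about minima of the energy ([exists_discrete_geodesic],
    [energy_lower_bound]). *)

(** * Trigonometry of the model surfaces *)

Section hyperbolic_functions.
Variable R : realType.
Implicit Types x y a b : R.

Definition cosh x := (expR x + expR (- x)) / 2.
Definition sinh x := (expR x - expR (- x)) / 2.

Lemma cosh0 : cosh 0 = 1.
Proof. by rewrite /cosh oppr0 expR0; field. Qed.

Lemma sinh0 : sinh 0 = 0.
Proof. by rewrite /sinh oppr0 subrr mul0r. Qed.

Lemma coshN x : cosh (- x) = cosh x.
Proof. by rewrite /cosh opprK addrC. Qed.

Lemma sinhN x : sinh (- x) = - sinh x.
Proof. by rewrite /sinh opprK -mulNr opprB. Qed.

Lemma coshD a b : cosh (a + b) = cosh a * cosh b + sinh a * sinh b.
Proof. by rewrite /cosh /sinh opprD !expRD; field. Qed.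

Lemma sinhD a b : sinh (a + b) = sinh a * cosh b + cosh a * sinh b.
Proof. by rewrite /cosh /sinh opprD !expRD; field. Qed.

Lemma cosh2_sinh2 x : cosh x ^+ 2 = 1 + sinh x ^+ 2.
Proof.
by have := coshD x (- x); rewrite coshN sinhN subrr cosh0 => ->; ring.
Qed.

Lemma sinh_gt0 x : 0 < x -> 0 < sinh x.
Proof.
move=> x0; rewrite /sinh divr_gt0// subr_gt0 ltr_expR.
by rewrite gtrN.
Qed.

Lemma sinh_ge0 x : 0 <= x -> 0 <= sinh x.
Proof. by rewrite le_eqVlt => /predU1P[<-|/sinh_gt0/ltW//]; rewrite sinh0. Qed.

Lemma cosh_gt0 x : 0 < cosh x.
Proof. by rewrite divr_gt0// addr_gt0// expR_gt0. Qed.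

Lemma cosh_ge1 x : 1 <= cosh x.
Proof.
have := cosh2_sinh2 x; have := cosh_gt0 x; have := sqr_ge0 (sinh x); nra.
Qed.

Lemma is_derive_cosh x : is_derive x 1 cosh (sinh x).
Proof.
have -> : cosh = (fun y => 2^-1 *: (expR y + (expR \o -%R) y)).
  by apply/funext => y; rewrite /cosh mulrC.
apply: is_derive_eq.
by rewrite /sinh /GRing.scale /=; field.
Qed.

Lemma is_derive_sinh x : is_derive x 1 sinh (cosh x).
Proof.
have -> : sinh = (fun y => 2^-1 *: (expR y - (expR \o -%R) y)).
  by apply/funext => y; rewrite /sinh mulrC.
apply: is_derive_eq.
by rewrite /cosh /GRing.scale /=; field.
Qed.

#[local] Existing Instance is_derive_cosh.

Lemma cosh_continuous : continuous cosh.
Proof.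
by move=> x; apply/differentiable_continuous/derivable1_diffP; apply: ex_derive.
Qed.

Lemma sinh_continuous : continuous sinh.
Proof.
by move=> x; apply/differentiable_continuous/derivable1_diffP; apply: ex_derive.
Qed.

Lemma ler_cosh a b : 0 <= a -> a <= b -> cosh a <= cosh b.
Proof.
move=> a0 ab; rewrite -[b](subrKC a) coshD.
have := cosh_ge1 (b - a); have := cosh_gt0 a.
have := sinh_ge0 a0; have : 0 <= sinh (b - a) by rewrite sinh_ge0 ?subr_ge0.
nra.
Qed.

(** By convexity, the chords from the origin to the graph of [sinh] steepen. *)
Lemma sinh_chord_le s y : 0 < s -> s <= y -> y * sinh s <= s * sinh y.
Proof.
move=> s0 sy.
have [c /[!in_itv]/= /andP[c0 cs] Es] := MVT_segment (ltW s0)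
  (fun x _ => is_derive_sinh x) (continuous_subspaceT sinh_continuous).
have [c' /[!in_itv]/= /andP[sc' c'y] Ey] := MVT_segment sy
  (fun x _ => is_derive_sinh x) (continuous_subspaceT sinh_continuous).
have h1 := ler_cosh c0 cs; have h2 := ler_cosh (ltW s0) sc'.
rewrite sinh0 !subr0 in Es.
have ss : sinh s <= cosh s * s by rewrite Es ler_wpM2r// ltW.
have ssy : sinh s * (y - s) <= s * (cosh c' * (y - s)).
  rewrite mulrA ler_wpM2r ?subr_ge0//.
  by apply: (le_trans ss); rewrite mulrC ler_wpM2l// ltW.
rewrite -Ey in ssy; nra.
Qed.

(** As [sinh y / y] increases, the derivative on the right changes sign at
    [s] only. *)
Lemma cosh_sqr_MVT s a b : a <= b -> exists2 c, a <= c <= b &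
  s * cosh b - sinh s * b ^+ 2 / 2 - (s * cosh a - sinh s * a ^+ 2 / 2) =
  (s * sinh c - c * sinh s) * (b - a).
Proof.
move=> ab; pose G y := s *: cosh y - (sinh s / 2) *: (y ^+ 2).
have dG y : is_derive y 1 G (s * sinh y - y * sinh s).
  by apply: is_derive_eq; rewrite /GRing.scale /=; field.
have cG : continuous G.
  by move=> y; apply/differentiable_continuous/derivable1_diffP; apply: ex_derive.
have [c /[!in_itv]/= acb E] := MVT_segment ab (fun x _ => dG x)
  (continuous_subspaceT cG).
exists c => //; rewrite -E /G /GRing.scale /=; ring.
Qed.

(** On the half-line [x ^+ 2] is a concave function of [cosh x]: the function of
    the previous lemma decreases up to [s] and increases afterwards. *)
Lemma sqr_concave_cosh (u t s v : R) : 0 <= u -> u <= t -> t <= s -> s <= v ->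
  cosh s + cosh t = cosh v + cosh u -> u ^+ 2 + v ^+ 2 <= s ^+ 2 + t ^+ 2.
Proof.
move=> u0 ut ts sv E.
have [s0|s0] := leP s 0.
  have s00 : s = 0 by apply/eqP; rewrite eq_le s0 (le_trans u0)// (le_trans ut).
  have [t0 uu0] : t = 0 /\ u = 0 by split; lra.
  have [v0|v0] := leP v 0; first by nra.
  move: E; rewrite s00 t0 uu0 cosh0 => /addIr/esym E.
  have := cosh2_sinh2 v; have := sinh_gt0 v0; rewrite E; nra.
have [c /andP[sc cv] E1] := cosh_sqr_MVT s sv.
have [d /andP[ud dt] E2] := cosh_sqr_MVT s ut.
have h1 : 0 <= s * sinh c - c * sinh s by rewrite subr_ge0 sinh_chord_le.
have h2 : s * sinh d - d * sinh s <= 0.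
  rewrite subr_le0; have [d0|d0] := leP d 0.
    have -> : d = 0 by lra.
    by rewrite sinh0 mulr0 mul0r.
  by rewrite sinh_chord_le//; lra.
have ss := sinh_gt0 s0.
have : 0 <= (s * sinh c - c * sinh s) * (v - s) by rewrite mulr_ge0// subr_ge0.
have : (s * sinh d - d * sinh s) * (t - u) <= 0.
  by rewrite mulr_le0_ge0// subr_ge0.
rewrite -E1 -E2 => G1 G2.
have {E} : s * (cosh s + cosh t) = s * (cosh v + cosh u) by rewrite E.
move=> E; have : 0 <= sinh s * (s ^+ 2 + t ^+ 2 - (u ^+ 2 + v ^+ 2)) by lra.
by rewrite pmulr_rge0// subr_ge0.
Qed.

End hyperbolic_functions.

Section generalized_trigonometry.
Variables (R : realType) (chi : R).
Implicit Types a b c x y : R.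

Definition curv : R := Num.sqrt (- chi).

(** The solutions of [f'' = - chi * f] with initial data [(0, 1)] and [(1, 0)],
    and the primitive of the first one. The latter serves as a modified
    distance: in terms of it the law of cosines and the theorem of Stewart are
    polynomial, and the same in all curvatures. *)
Definition sn x : R := if chi < 0 then sinh (curv * x) / curv else x.
Definition md x : R :=
  if chi < 0 then (cosh (curv * x) - 1) / curv ^+ 2 else x ^+ 2 / 2.
Definition cs x : R := 1 - chi * md x.

Lemma curv_gt0 : chi < 0 -> 0 < curv.
Proof. by move=> h; rewrite sqrtr_gt0 oppr_gt0. Qed.

Lemma curv2 : chi < 0 -> curv ^+ 2 = - chi.
Proof. by move=> h; rewrite sqr_sqrtr// oppr_ge0 ltW. Qed.

Lemma sn0 : sn 0 = 0.
Proof. by rewrite /sn mulr0 sinh0 mul0r if_same. Qed.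

Lemma md0 : md 0 = 0.
Proof. by rewrite /md mulr0 cosh0 subrr mul0r expr0n mul0r if_same. Qed.

Lemma snN x : sn (- x) = - sn x.
Proof. by rewrite /sn mulrN sinhN mulNr; case: ifP. Qed.

Lemma mdN x : md (- x) = md x.
Proof. by rewrite /md mulrN coshN sqrrN. Qed.

Lemma md_norm x : md `|x| = md x.
Proof. by case: (ger0P x) => // _; rewrite mdN. Qed.

Lemma md_continuous : continuous md.
Proof.
rewrite /md; case: (chi < 0) => x; last first.
  apply: (@cvgMr_tmp _ _ _ _ (fun y : R => y ^+ 2)); exact: exprn_continuous.
apply: (@cvgMr_tmp _ _ _ _ (fun y : R => cosh (curv * y) - 1)).
apply: cvgB; last exact: cvg_cst.
apply: (@continuous_comp _ _ _ (fun y => curv * y) (@cosh R)).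
  exact: mulrl_continuous.
exact: cosh_continuous.
Qed.

Lemma sn_continuous : continuous sn.
Proof.
rewrite /sn; case: (chi < 0) => x; last exact: cvg_id.
apply: (@cvgMr_tmp _ _ _ _ (fun y : R => sinh (curv * y))).
apply: (@continuous_comp _ _ _ (fun y => curv * y) (@sinh R)).
  exact: mulrl_continuous.
exact: sinh_continuous.
Qed.

Lemma sn_gt0 x : 0 < x -> 0 < sn x.
Proof.
rewrite /sn; case: ifP => // h x0.
by rewrite divr_gt0 ?curv_gt0// sinh_gt0// mulr_gt0 ?curv_gt0.
Qed.

Lemma sn_ge0 x : 0 <= x -> 0 <= sn x.
Proof. by rewrite le_eqVlt => /predU1P[<-|/sn_gt0/ltW//]; rewrite sn0. Qed.

Lemma md_ge0 x : 0 <= md x.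
Proof.
rewrite /md; case: ifP => h; last by rewrite divr_ge0// sqr_ge0.
by rewrite divr_ge0 ?sqr_ge0// subr_ge0 cosh_ge1.
Qed.

Hypothesis chi_le0 : chi <= 0.

Lemma chi_eq0 : (chi < 0) = false -> chi = 0.
Proof. by move=> h; apply/eqP; rewrite eq_le chi_le0 leNgt h. Qed.

Lemma cs_ge1 x : 1 <= cs x.
Proof. by rewrite /cs lerDl oppr_ge0 mulr_le0_ge0 ?md_ge0. Qed.

Lemma snD a b : sn (a + b) = sn a * cs b + cs a * sn b.
Proof.
rewrite /cs /sn /md; case: ifP => [h|/chi_eq0 ->]; last by ring.
have := curv_gt0 h; have /eqP := curv2 h; rewrite -eqr_oppLR => /eqP <- k0.
by rewrite mulrDr sinhD; field; rewrite gt_eqF.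
Qed.

Lemma mdD a b : md (a + b) = md a + md b - chi * md a * md b + sn a * sn b.
Proof.
rewrite /sn /md; case: ifP => [h|/chi_eq0 ->]; last by field.
have := curv_gt0 h; have /eqP := curv2 h; rewrite -eqr_oppLR => /eqP <- k0.
by rewrite mulrDr coshD; field; rewrite gt_eqF.
Qed.

Lemma sn2 a : sn a ^+ 2 = 2 * md a - chi * md a ^+ 2.
Proof.
have := mdD a (- a); rewrite subrr md0 mdN snN => h.
apply/eqP; rewrite -subr_eq0; apply/eqP; lra.
Qed.

Lemma snB a b : sn (a - b) = sn a * cs b - cs a * sn b.
Proof. by rewrite snD snN /cs mdN mulrN. Qed.

Lemma mdB a b : md (a - b) = md a + md b - chi * md a * md b - sn a * sn b.
Proof. by rewrite mdD snN mdN mulrN. Qed.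

Lemma ltr_md a b : 0 <= a -> a < b -> md a < md b.
Proof.
move=> a0 ab; rewrite -[b](subrKC a) mdD.
have ba : 0 < b - a by rewrite subr_gt0.
have := md_ge0 a; have := md_ge0 (b - a); have := sn_ge0 a0; have := sn_gt0 ba.
have : 0 < md (b - a).
  have := sn2 (b - a); have := sn_gt0 ba; have := md_ge0 (b - a).
  rewrite le_eqVlt => /predU1P[<-|//]; rewrite expr0n /=; nra.
move: (md a) (md (b - a)) (sn a) (sn (b - a)) => u v s t v0 t0 s0 v1 u1.
have : chi * u * v <= 0 by rewrite -mulrA mulr_le0_ge0// mulr_ge0// ltW.
have : 0 <= s * t by rewrite mulr_ge0// ltW.
lra.
Qed.

Lemma ler_md a b : 0 <= a -> a <= b -> md a <= md b.
Proof.
move=> a0; rewrite le_eqVlt => /predU1P[->//|ab]; exact/ltW/ltr_md.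
Qed.

Lemma ler_md_inv a b : 0 <= b -> md a <= md b -> a <= b.
Proof.
by move=> b0 h; rewrite leNgt; apply/negP => /(ltr_md b0); rewrite ltNge h.
Qed.

Lemma md_inj a b : 0 <= a -> 0 <= b -> md a = md b -> a = b.
Proof.
move=> a0 b0 h; apply/eqP; rewrite eq_le.
by apply/andP; split; apply: ler_md_inv => //; rewrite h.
Qed.

Lemma ler_sn a b : 0 <= a -> a <= b -> sn a <= sn b.
Proof.
move=> a0 ab; rewrite -[b](subrKC a) snD.
have := cs_ge1 (b - a); have := cs_ge1 a; have := sn_ge0 a0.
have : 0 <= sn (b - a) by rewrite sn_ge0 ?subr_ge0.
nra.
Qed.

End generalized_trigonometry.

Lemma sn_flat (R : realType) (x : R) : sn 0 x = x.
Proof. by rewrite /sn ltxx. Qed.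

Lemma md_flat (R : realType) (x : R) : md 0 x = x ^+ 2 / 2.
Proof. by rewrite /md ltxx. Qed.

Lemma cs_flat (R : realType) (x : R) : cs 0 x = 1.
Proof. by rewrite /cs mul0r subr0. Qed.

Section maximum_principle.
Variables (R : realType) (chi : R).
Hypothesis chi_le0 : chi <= 0.
Local Notation sn := (sn chi).
Local Notation md := (md chi).
Local Notation cs := (cs chi).

(** The curvature term of the theorem of Stewart, for a side cut into pieces of
    lengths [a] and [b]. *)
Definition stewart_defect (a b : R) : R := sn a * md b + sn b * md a.
Local Notation K := stewart_defect.

Lemma stewart_defect_symm a b h :
  K (a + h) (b - h) + K (a - h) (b + h) =
  2 * (cs h * K a b - md h * sn (a + b)).
Proof.
rewrite /K !snB// !mdB// !snD// !mdD// /cs.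
have := sn2 chi_le0 h; have := sn2 chi_le0 a; have := sn2 chi_le0 b.
move: (sn h) (sn a) (sn b) (md h) (md a) (md b) => sh sa sb mh ma mb eb ea eh.
by ring: eb ea eh.
Qed.

(** If at each interior point [f] satisfies, for small [h], the inequality that
    the modified distance to a point satisfies along a geodesic of the model
    surface with equality, then [f] lies below the solution with the same
    boundary values: adding [eta * t ^+ 2] to the difference makes an interior
    maximum contradictory. *)
Lemma stewart_maximum_principle (f : R -> R) (L : R) : 0 < L ->
  {within `[0, L], continuous f} ->
  (forall t, 0 < t < L -> exists2 h0, 0 < h0 & forall h, 0 < h < h0 ->
     2 * (cs h * f t + md h) <= f (t + h) + f (t - h)) ->
  forall t, 0 <= t <= L ->
    sn L * f t + K t (L - t) <= sn (L - t) * f 0 + sn t * f L.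
Proof.
move=> L0 fc fh t1 t1L.
have sL := sn_gt0 chi L0.
pose S t := sn (L - t) * f 0 + sn t * f L - K t (L - t).
have Ssymm t h : S (t + h) + S (t - h) = 2 * (cs h * S t + md h * sn L).
  have := stewart_defect_symm t (L - t) h; rewrite (subrKC t) /S.
  have -> : L - (t + h) = L - t - h by ring.
  have -> : L - (t - h) = L - t + h by ring.
  rewrite (snB chi_le0 (L - t) h) (snD chi_le0 (L - t) h).
  rewrite (snB chi_le0 t h) (snD chi_le0 t h) => h1; lra.
have S0 : S 0 = sn L * f 0.
  by rewrite /S /K subr0 sn0 md0; ring.
have SL : S L = sn L * f L.
  by rewrite /S /K subrr sn0 md0; ring.
have Sc : continuous S.
  have snc := @sn_continuous R chi; have mdc := @md_continuous R chi.
  have Lc : continuous (fun t => L - t).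
    by move=> t; apply: cvgB; [exact: cvg_cst|exact: cvg_id].
  have snLc : continuous (fun t => sn (L - t)).
    by move=> t; apply: (@continuous_comp _ _ _ (fun t => L - t) sn); [exact: Lc|exact: snc].
  have mdLc : continuous (fun t => md (L - t)).
    by move=> t; apply: (@continuous_comp _ _ _ (fun t => L - t) md); [exact: Lc|exact: mdc].
  move=> t; apply: cvgB; [apply: cvgD|apply: cvgD].
  - exact: (cvgMr_tmp (snLc t)).
  - exact: (cvgMr_tmp (snc t)).
  - exact: (cvgM (snc t) (mdLc t)).
  - exact: (cvgM (snLc t) (mdc t)).
pose v t := sn L * f t - S t.
suff : v t1 <= 0 by rewrite /v /S; lra.
rewrite leNgt; apply/negP => vt1.
pose eta := v t1 / (2 * L ^+ 2).
have eta0 : 0 < eta by rewrite divr_gt0// mulr_gt0// exprn_gt0.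
have etaL : eta * L ^+ 2 = v t1 / 2 by rewrite /eta; field; rewrite gt_eqF.
pose w t := v t + eta * t ^+ 2.
have wc : {within `[0, L], continuous w}.
  have Sw : {within `[0, L], continuous S} by exact: continuous_subspaceT.
  have qw : {within `[0, L], continuous (fun t => eta * t ^+ 2)}.
    apply: continuous_subspaceT => t.
    by apply: (@cvgMl_tmp _ _ _ _ (fun t => t ^+ 2)); exact: exprn_continuous.
  move=> t; apply: cvgD; last exact: qw.
  apply: cvgB; last exact: Sw.
  exact: (cvgMl_tmp (fc t)).
have [c /[!in_itv]/= /andP[c0 cL] cmax] := EVT_max (ltW L0) wc.
have wt1 : w t1 <= w c by apply: cmax; rewrite in_itv.
have t1w : v t1 <= w t1 by rewrite /w lerDl mulr_ge0 ?sqr_ge0// ltW.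
have w0 : w 0 = 0 by rewrite /w /v S0 expr0n /= mulr0 subrr addr0.
have wL : w L = v t1 / 2 by rewrite /w /v SL etaL subrr add0r.
have c0' : 0 < c.
  rewrite lt_neqAle c0 andbT; apply/eqP => c00.
  by move: wt1; rewrite -c00 w0; lra.
have cL' : c < L.
  rewrite lt_neqAle cL andbT; apply/eqP => c00.
  by move: wt1; rewrite c00 wL; lra.
have vc : 0 < v c.
  have : eta * c ^+ 2 <= eta * L ^+ 2.
    by rewrite ler_wpM2l ?(ltW eta0)// lerXn2r// nnegrE ltW.
  by have := le_trans t1w wt1; rewrite /w etaL; lra.
have [h0 h00 hc] := fh c (introT andP (conj c0' cL')).
pose h := Num.min (h0 / 2) (Num.min c (L - c)).
have hgt0 : 0 < h by rewrite !lt_min c0' subr_gt0 cL' divr_gt0.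
have [hh0 hcc hLc] : [/\ h < h0, h <= c & h <= L - c].
  split; rewrite /h ?ge_min ?lexx ?orbT//.
  by rewrite gt_min ltr_pdivrMr// ltr_pMr// ltr1n.
have := hc h (introT andP (conj hgt0 hh0)).
have := Ssymm c h.
have w1 : w (c + h) <= w c by apply: cmax; rewrite in_itv /=; lra.
have w2 : w (c - h) <= w c by apply: cmax; rewrite in_itv /=; lra.
move: w1 w2; rewrite /w /v => w1 w2 Sh fhc.
have csh := cs_ge1 chi_le0 h.
have : sn L * (2 * (cs h * f c + md h)) <= sn L * (f (c + h) + f (c - h)).
  by rewrite ler_pM2l.
have : v c <= cs h * v c by rewrite ler_peMl// ltW.
have : 0 < eta * h ^+ 2 by rewrite mulr_gt0// exprn_gt0.
rewrite /v; lra.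
Qed.

End maximum_principle.

Lemma le_of_right_limit (R : realType) (f : R -> R) (C : R) : continuous f ->
  (exists2 s0, 0 < s0 & forall s, 0 < s -> s < s0 -> f s <= C) -> f 0 <= C.
Proof.
move=> fc [s0 s00 fC]; rewrite leNgt; apply/negP => Cf.
have [e /= e0 eC] : nbhs (0 : R) [set s | C < f s].
  exact: (@cvgr_gt _ _ _ _ f _ (fc 0)).
pose s := Num.min s0 e / 2.
have [ss0 se] : s < s0 /\ s < e.
  by split; rewrite ltr_pdivrMr// gt_min; apply/orP; [left|right]; lra.
have s_gt0 : 0 < s by rewrite divr_gt0// lt_min s00.
have := eC s; rewrite /= sub0r normrN gtr0_norm// => /(_ se).
by rewrite ltNge fC.
Qed.

Section stewart_arithmetic.
Variables (R : realType) (chi : R).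
Hypothesis chi_le0 : chi <= 0.
Local Notation sn := (sn chi).
Local Notation md := (md chi).
Local Notation cs := (cs chi).
Local Notation K := (stewart_defect chi).
Implicit Types a b c : R.

Lemma stewart_defectC a b : K a b = K b a.
Proof. by rewrite /stewart_defect addrC. Qed.

Lemma snDE a b : sn (a + b) = sn a + sn b - chi * K a b.
Proof. by rewrite snD// /K /cs; ring. Qed.

Lemma sn_mulD a b c :
  sn (a + b) * sn (b + c) = sn b * sn (a + b + c) + sn a * sn c.
Proof.
rewrite !snD// /cs !mdD//; have := sn2 chi_le0 b.
move: (sn a) (sn b) (sn c) (md a) (md b) (md c) => sa sb sc ma mb mc eb.
by ring: eb.
Qed.

Lemma sn_defectA a b c :
  sn (b + c) * K a b + sn a * K b c = sn b * K a (b + c).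
Proof.
rewrite /K !snD// /cs !mdD//; have := sn2 chi_le0 b.
move: (sn a) (sn b) (sn c) (md a) (md b) (md c) => sa sb sc ma mb mc eb.
by ring: eb.
Qed.

Lemma sn_defectDA a b c :
  sn (a + b + c) * K a b + sn a * K (a + b) c = sn (a + b) * K a (b + c).
Proof.
rewrite /K !snD// /cs !mdD//.
have := sn2 chi_le0 b; have := sn2 chi_le0 a.
move: (sn a) (sn b) (sn c) (md a) (md b) (md c) => sa sb sc ma mb mc ea eb.
by ring: ea eb.
Qed.

(** Two overlapping inequalities of Stewart, at the inner points of the arcs
    [0, a + b] and [a, a + b + c], give the one at [a] for the whole arc. *)
Lemma stewart_overlap a b c (F0 Fa Fb Fc : R) : 0 <= a -> 0 < b -> 0 <= c ->
  sn (a + b) * Fa + K a b <= sn b * F0 + sn a * Fb ->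
  sn (b + c) * Fb + K b c <= sn c * Fa + sn b * Fc ->
  sn (a + b + c) * Fa + K a (b + c) <= sn (b + c) * F0 + sn a * Fc.
Proof.
move=> a0 b0 c0 h1 h2; have sb := sn_gt0 chi b0.
rewrite -(ler_pM2l sb).
have sbc : 0 <= sn (b + c) by rewrite sn_ge0// addr_ge0// ltW.
have {}h1 := ler_wpM2l sbc h1; have {}h2 := ler_wpM2l (sn_ge0 chi a0) h2.
have e1 := sn_mulD a b c; have e2 := sn_defectA a b c.
have : (sn (a + b) * sn (b + c)) * Fa =
  (sn b * sn (a + b + c) + sn a * sn c) * Fa by rewrite e1.
by lra.
Qed.

Lemma stewart_nested a b c (F0 Fa Fb Fc : R) : 0 <= a -> 0 < b -> 0 <= c ->
  sn (a + b) * Fa + K a b <= sn b * F0 + sn a * Fb ->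
  sn (a + b + c) * Fb + K (a + b) c <= sn c * F0 + sn (a + b) * Fc ->
  sn (a + b + c) * Fa + K a (b + c) <= sn (b + c) * F0 + sn a * Fc.
Proof.
move=> a0 b0 c0 h1 h2; have sab : 0 < sn (a + b) by rewrite sn_gt0// ltr_wpDl.
rewrite -(ler_pM2l sab).
have sabc : 0 <= sn (a + b + c) by rewrite sn_ge0// !addr_ge0// ltW.
have {}h1 := ler_wpM2l sabc h1; have {}h2 := ler_wpM2l (sn_ge0 chi a0) h2.
have e1 := sn_mulD a b c; have e2 := sn_defectDA a b c.
have : (sn (a + b) * sn (b + c)) * F0 =
  (sn b * sn (a + b + c) + sn a * sn c) * F0 by rewrite e1.
by lra.
Qed.

End stewart_arithmetic.

Section stewart_inequality.
Variables (R : realType) (chi : R).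
Hypothesis chi_le0 : chi <= 0.
Variable X : metricType R.
Implicit Types p q r x y z : X.
Local Notation sn := (sn chi).
Local Notation md := (md chi).
Local Notation cs := (cs chi).
Local Notation K := (stewart_defect chi).

(** The point [m] lies on a geodesic from [p] to [q], when [X] is geodesic. *)
Definition btw p m q : Prop := mdist p m + mdist m q = mdist p q.

(** The comparison inequality between a vertex [x] and the point [m] of the
    opposite side [p, q], which is an equality in the model surface. *)
Definition stewart x p m q : Prop :=
  sn (mdist p m + mdist m q) * md (mdist x m) + K (mdist p m) (mdist m q) <=
  sn (mdist m q) * md (mdist x p) + sn (mdist p m) * md (mdist x q).

Lemma btw_sym p m q : btw p m q -> btw q m p.
Proof. by rewrite /btw ![mdist q _]metric_sym [mdist m p]metric_sym addrC. Qed.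

Lemma stewart_sym x p m q : stewart x p m q -> stewart x q m p.
Proof.
move=> h; rewrite /stewart (metric_sym q m) (metric_sym m p) stewart_defectC.
by rewrite (addrC (mdist m q)) [leRHS]addrC.
Qed.


(** A point where a geodesic from [y] issues is an interior point of the side
    [x1, x2]. If [x1] and [x2] satisfy the comparison inequality with the
    initial part of that geodesic, then the distance to its other end [z]
    satisfies the comparison inequality at [y]: letting [q] tend to [y], one
    only uses that [mdist x1 q + mdist x2 q >= mdist x1 x2]. In terms of
    angles, comparison at [y] bounds the two angles from above, and their sum
    is at least the straight angle. *)
Lemma stewart_hinges_kink x1 y x2 z (h s0 : R) :
  mdist x1 y = h -> mdist y x2 = h -> mdist x1 x2 = 2 * h ->
  0 < mdist y z -> 0 < s0 ->
  (forall s, 0 < s < s0 -> exists q,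
    [/\ btw y q z, mdist y q = s, stewart x1 y q z & stewart x2 y q z]) ->
  2 * (cs h * md (mdist z y) + md h) <= md (mdist z x1) + md (mdist z x2).
Proof.
move=> x1y yx2 x12 c0 s00 H; set c := mdist y z in c0 *.
have h0 : 0 <= h by rewrite -x1y mdist_ge0.
have -> : mdist z y = c by rewrite metric_sym.
pose M := md (mdist z x1) + md (mdist z x2).
have key s : 0 < s -> s < s0 -> s < c -> 2 * (cs (c - s) * md h + md (c - s)) <= M.
  move=> s_gt0 ss0 sc.
  have [q [yqz yq]] := H s (introT andP (conj s_gt0 ss0)).
  have qz : mdist q z = c - s by rewrite /c -yqz yq; ring.
  rewrite /stewart yq qz subrKC (metric_sym x1 z) (metric_sym x2 z) x1y.
  rewrite (metric_sym x2 y) yx2 => S1 S2.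
  have tri : 2 * h <= mdist x1 q + mdist x2 q.
    by rewrite -x12 (metric_sym x2); exact: metric_triangle.
  have mds : 2 * md h <= md (mdist x1 q) + md (mdist x2 q).
    set u := mdist x1 q in tri *; set v := mdist x2 q in tri *.
    have : md h <= md ((u + v) / 2) by apply: ler_md => //; lra.
    have -> : md u = md ((u + v) / 2 + (u - v) / 2) by congr md; field.
    have -> : md v = md ((u + v) / 2 - (u - v) / 2) by congr md; field.
    rewrite (mdD chi_le0 ((u + v) / 2)) mdB//.
    have := md_ge0 chi ((u - v) / 2); have := md_ge0 chi ((u + v) / 2).
    set m1 := md ((u + v) / 2); set m2 := md ((u - v) / 2) => m10 m20 hm.
    have : chi * m1 * m2 <= 0 by rewrite -mulrA mulr_le0_ge0// mulr_ge0.
    by lra.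
  have sns := sn_gt0 chi s_gt0; have snc := sn_gt0 chi c0.
  have snE : sn c = sn (c - s) * cs s + cs (c - s) * sn s.
    by rewrite -snD// subrK.
  rewrite -(ler_pM2l sns).
  have := ler_wpM2l (ltW snc) mds.
  have : sn (c - s) * md h <= sn (c - s) * cs s * md h.
    by rewrite ler_wpM2r ?md_ge0// ler_peMr ?cs_ge1// sn_ge0// subr_ge0 ltW.
  have : 0 <= sn (c - s) * md s.
    by rewrite mulr_ge0 ?md_ge0// sn_ge0// subr_ge0 ltW.
  move: S1 S2; rewrite /K /M.
  have : sn c * md h = sn (c - s) * cs s * md h + cs (c - s) * sn s * md h.
    by rewrite snE; ring.
  by lra.
rewrite -/M.
have -> : 2 * (cs h * md c + md h) = 2 * (cs (c - 0) * md h + md (c - 0)).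
  by rewrite subr0 /cs; ring.
apply: (@le_of_right_limit _
  (fun s => 2 * (cs (c - s) * md h + md (c - s)))); last first.
  exists (Num.min s0 c); first by rewrite lt_min s00.
  by move=> s s_gt0; rewrite lt_min => /andP[]; exact: key.
have cont : continuous (fun s : R => md (c - s)).
  move=> s; apply: (@continuous_comp _ _ _ (fun s => c - s) md); last exact: md_continuous.
  by apply: cvgB; [exact: cvg_cst|exact: cvg_id].
move=> s; apply: (@cvgMl_tmp _ _ _ _ (fun s => cs (c - s) * md h + md (c - s))).
apply: cvgD; last exact: cont.
apply: (@cvgMr_tmp _ _ _ _ (fun s => cs (c - s))).
apply: cvgB; first exact: cvg_cst.
exact: (cvgMl_tmp (cont s)).
Qed.

End stewart_inequality.

(** * The model surfaces *)

Section model_geometry.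
Variables (R : realType) (chi : R).
Hypothesis chi_le0 : chi <= 0.
Local Notation sn := (sn chi).
Local Notation md := (md chi).
Local Notation cs := (cs chi).
Local Notation K := (stewart_defect chi).
Local Notation M := (model_surface chi).
Local Notation k := (curv chi).
Implicit Types (p q r m : M) (a b t : R).

Lemma height_sqr (p : R * R) : height p ^+ 2 = 1 + p.1 ^+ 2 + p.2 ^+ 2.
Proof. by rewrite sqr_sqrtr// !addr_ge0// sqr_ge0. Qed.

Lemma height_gt0 (p : R * R) : 0 < height p.
Proof. by rewrite sqrtr_gt0 -addrA ltr_wpDr// addr_ge0// sqr_ge0. Qed.

Lemma minkowski_ge1 (p q : R * R) : 1 <= minkowski p q.
Proof.
have hp := height_sqr p; have hq := height_sqr q.
have h0 : 0 < height p * height q by rewrite mulr_gt0// height_gt0.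
suff : 1 + p.1 * q.1 + p.2 * q.2 <= height p * height q.
  by rewrite /minkowski; lra.
rewrite leNgt; apply/negP => h.
have : (height p * height q) ^+ 2 < (1 + p.1 * q.1 + p.2 * q.2) ^+ 2.
  by rewrite ltr_pXn2r// nnegrE ltW// (lt_trans h0).
rewrite exprMn hp hq; apply/negP; rewrite -leNgt.
have := sqr_ge0 (p.1 - q.1); have := sqr_ge0 (p.2 - q.2).
have := sqr_ge0 (p.1 * q.2 - p.2 * q.1); lra.
Qed.

Lemma cosh_arcosh (y : R) : 1 <= y -> cosh (arcosh y) = y.
Proof.
move=> y1; rewrite /cosh /arcosh; set s := Num.sqrt _.
have s0 : 0 <= s by exact: sqrtr_ge0.
have s2 : s ^+ 2 = y ^+ 2 - 1 by rewrite sqr_sqrtr//; nra.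
have ys : 0 < y + s by lra.
rewrite expRN lnK ?posrE//.
have -> : (y + s)^-1 = y - s.
  by apply: (mulfI (lt0r_neq0 ys)); rewrite divff ?lt0r_neq0//; lra.
by field.
Qed.

Lemma md_mdist p q : md (mdist p q) =
  if chi < 0 then (minkowski p q - 1) / k ^+ 2
  else ((p.1 - q.1) ^+ 2 + (p.2 - q.2) ^+ 2) / 2.
Proof.
rewrite -[mdist p q]/(model_dist p q) /md /model_dist; case h: (chi < 0).
  rewrite /hyperbolic_dist mulrCA divff ?gt_eqF ?curv_gt0// mulr1.
  by rewrite cosh_arcosh// minkowski_ge1.
by rewrite /euclidean_dist sqr_sqrtr// addr_ge0// sqr_ge0.
Qed.

(** In the hyperboloid this is a combination of the vectors [p] and [q], in the
    plane an affine combination; it is the point at distance [t] from [p] on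
    the geodesic from [p] to [q]. *)
Definition model_line p q t : M :=
  let l := mdist p q in
  ((sn (l - t) * p.1 + sn t * q.1) / sn l,
   (sn (l - t) * p.2 + sn t * q.2) / sn l).

Lemma sn_cosine_law a b :
  sn a ^+ 2 + sn b ^+ 2 + 2 * sn a * sn b * cs (a + b) = sn (a + b) ^+ 2.
Proof.
rewrite snD// /cs mdD//; have := sn2 chi_le0 b; have := sn2 chi_le0 a.
move: (sn a) (sn b) (md a) (md b) => sa sb ma mb ea eb.
by ring: ea eb.
Qed.

Lemma model_line_stewart p q r t : p != q -> 0 <= t <= mdist p q ->
  sn (mdist p q) * md (mdist r (model_line p q t)) + K t (mdist p q - t) =
  sn (mdist p q - t) * md (mdist r p) + sn t * md (mdist r q).
Proof.
move=> pq /andP[t0 tl]; have := md_mdist p q; set l := mdist p q in tl *.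
have l0 : 0 < l by rewrite mdist_gt0.
have sl := sn_gt0 chi l0; have sl0 := lt0r_neq0 sl.
have snt := sn_ge0 chi t0.
have snlt : 0 <= sn (l - t) by rewrite sn_ge0// subr_ge0.
move=> El; rewrite !md_mdist /model_line -/l.
case h: (chi < 0) El => El; last first.
  have chi0 := chi_eq0 chi_le0 h.
  move: El; rewrite /K /sn /md h /= => El.
  have {}El : l ^+ 2 = (p.1 - q.1) ^+ 2 + (p.2 - q.2) ^+ 2 by lra.
  have l1 := lt0r_neq0 l0.
  pose u := t / l; have -> : t = l * u by rewrite /u mulrC divfK.
  have -> : (l - l * u) = l * (1 - u) by ring.
  have lin x y : (l * (1 - u) * x + l * u * y) / l = (1 - u) * x + u * y by field.
  rewrite !lin; ring: El.
have k0 := curv_gt0 h; have k2 := curv2 h; have k1 := lt0r_neq0 k0.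
have kk0 : k ^+ 2 != 0 by rewrite expf_neq0.
have mE : minkowski p q = cs l.
  rewrite /cs El; apply: (mulIf kk0).
  rewrite [RHS](_ : _ = k ^+ 2 - chi * (minkowski p q - 1)); last by field.
  by rewrite k2; ring.
set m := (_, _) : R * R.
have hm : height m = (sn (l - t) * height p + sn t * height q) / sn l.
  have num : 0 <= sn (l - t) * height p + sn t * height q.
    by rewrite addr_ge0// mulr_ge0// ltW// height_gt0.
  apply/eqP; rewrite -(@eqrXn2 _ 2)// ?(ltW (height_gt0 _))//; last first.
    by rewrite divr_ge0// ltW.
  rewrite height_sqr /m /=; apply/eqP.
  have := sn_cosine_law (l - t) t; rewrite subrK -mE /minkowski => /esym law.
  have hp := height_sqr p; have hq := height_sqr q.
  rewrite !expr_div_n; apply: (mulIf (expf_neq0 2 sl0)).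
  by rewrite !mulrDl !mulfVK ?expf_neq0//; ring: law hp hq.
have mr : minkowski r m =
    (sn (l - t) * minkowski r p + sn t * minkowski r q) / sn l.
  by rewrite /minkowski hm /m /=; field.
have -> : K t (l - t) = (sn l - sn t - sn (l - t)) / k ^+ 2.
  have := snDE chi_le0 t (l - t); rewrite subrKC k2 => {1}->.
  by field; rewrite lt_eqF.
by rewrite mr; field; rewrite k1.
Qed.

Lemma stewart_identity a b u :
  sn (a + b) * md u + K a b = sn b * md (a + u) + sn a * md (b - u).
Proof.
rewrite /K mdB// !mdD// snD// /cs.
have := sn2 chi_le0 b; have := sn2 chi_le0 a; have := sn2 chi_le0 u.
move: (sn a) (sn b) (sn u) (md a) (md b) (md u) => sa sb su ma mb mu eu ea eb.
by ring: ea eb.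
Qed.

Lemma mdist_model_line p q s t : p != q ->
  0 <= s <= mdist p q -> 0 <= t <= mdist p q ->
  mdist (model_line p q s) (model_line p q t) = `|s - t|.
Proof.
move=> pq sl tl; have l0 : 0 < mdist p q by rewrite mdist_gt0.
have sl0 := lt0r_neq0 (sn_gt0 chi l0).
have sE (r : M) (v : R) : md (mdist r p) = md v ->
    md (mdist r q) = md (mdist p q - v) ->
    forall w, 0 <= w <= mdist p q -> mdist r (model_line p q w) = `|v - w|.
  move=> rp rq w wl; apply: (md_inj chi_le0) => //; first exact: mdist_ge0.
  rewrite md_norm; apply: (mulfI sl0).
  apply: (addIr (K w (mdist p q - w))); rewrite model_line_stewart// rp rq.
  have := stewart_identity w (mdist p q - w) (v - w).
  by rewrite !subrKC => ->; congr (_ + _ * md _); ring.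
apply: (sE _ s) => //; rewrite metric_sym.
  rewrite (sE p 0) ?mdistxx ?md0 ?subr0// sub0r normrN ger0_norm//.
  by case/andP: sl.
rewrite (sE q (mdist p q)) ?mdistxx ?subrr ?md0 ?md_norm//.
by rewrite metric_sym.
Qed.

Lemma model_line0 p q : p != q -> model_line p q 0 = p.
Proof.
move=> pq; have l0 : 0 < mdist p q by rewrite mdist_gt0.
have sl0 := lt0r_neq0 (sn_gt0 chi l0).
rewrite /model_line subr0 sn0 !mul0r !addr0.
by rewrite [RHS]surjective_pairing; congr (_, _); rewrite mulrAC divff ?mul1r.
Qed.

Lemma model_line1 p q : p != q -> model_line p q (mdist p q) = q.
Proof.
move=> pq; have l0 : 0 < mdist p q by rewrite mdist_gt0.
have sl0 := lt0r_neq0 (sn_gt0 chi l0).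
rewrite /model_line subrr sn0 !mul0r !add0r.
by rewrite [RHS]surjective_pairing; congr (_, _); rewrite mulrAC divff ?mul1r.
Qed.

(** In terms of the ambient vector space the modified distance to [r] is an affine
    function, and [m] is a combination of [p] and [q]. *)
Lemma model_stewart p m q r : btw p m q ->
  sn (mdist p m + mdist m q) * md (mdist r m) + K (mdist p m) (mdist m q) =
  sn (mdist m q) * md (mdist r p) + sn (mdist p m) * md (mdist r q).
Proof.
move=> pmq; have [pq|pq] := eqVneq p q.
  have [-> ->] : mdist p m = 0 /\ mdist m q = 0.
    have := mdist_ge0 p m; have := mdist_ge0 m q.
    by move: pmq; rewrite /btw pq mdistxx; split; lra.
  by rewrite /K addr0 sn0 md0; ring.
have mpq : 0 <= mdist p m <= mdist p q.
  by rewrite mdist_ge0 -pmq lerDl mdist_ge0.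
have l0 : 0 < mdist p q by rewrite mdist_gt0.
have sl := sn_gt0 chi l0.
have mqE : mdist p q - mdist p m = mdist m q by rewrite -pmq; ring.
have mE : m = model_line p q (mdist p m).
  apply: mdist_positivity; apply: (md_inj chi_le0) => //; first exact: mdist_ge0.
  rewrite md0; apply: (mulfI (lt0r_neq0 sl)); rewrite mulr0.
  apply: (addIr (K (mdist p m) (mdist p q - mdist p m))).
  rewrite model_line_stewart// add0r mqE.
  by rewrite /K (metric_sym m p) addrC.
by have := model_line_stewart r pq mpq; rewrite -mE mqE pmq.
Qed.

(** The point with polar coordinates [a] and [(u, v)] around the origin. *)
Definition polar a (u v : R) : M :=
  let s := (if chi < 0 then k else 1) * sn a in (s * u, s * v).

Lemma mdist_polar a b (u v u' v' : R) : 0 <= a -> 0 <= b ->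
  u ^+ 2 + v ^+ 2 = 1 -> u' ^+ 2 + v' ^+ 2 = 1 ->
  md (mdist (polar a u v) (polar b u' v')) =
  md a + md b - chi * md a * md b - sn a * sn b * (u * u' + v * v').
Proof.
move=> a0 b0 uv uv'; rewrite md_mdist /polar; case h: (chi < 0); last first.
  rewrite /sn /md h (chi_eq0 chi_le0 h) /=.
  rewrite [X in X / 2](_ : _ = a ^+ 2 + b ^+ 2 - 2 * (a * b * (u * u' + v * v'))).
    by field.
  have uE : u ^+ 2 = 1 - v ^+ 2 by rewrite -uv addrK.
  have uE' : u' ^+ 2 = 1 - v' ^+ 2 by rewrite -uv' addrK.
  by ring: uE uE'.
have k0 := curv_gt0 h; have k2 := curv2 h; have k1 := lt0r_neq0 k0.
have hp c (x y : R) : 0 <= c -> x ^+ 2 + y ^+ 2 = 1 ->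
    height (k * sn c * x, k * sn c * y) = cs c.
  move=> c0 xy; have c1 := cs_ge1 chi_le0 c.
  apply/eqP; rewrite -(@eqrXn2 _ 2)// ?(ltW (height_gt0 _))//; last first.
    by rewrite (le_trans ler01).
  apply/eqP; rewrite height_sqr /= !exprMn k2 /cs; have := sn2 chi_le0 c => sc.
  have xE : x ^+ 2 = 1 - y ^+ 2 by rewrite -xy addrK.
  by ring: sc xE.
rewrite /minkowski !hp//= /cs.
apply: (mulIf (expf_neq0 2 k1)); rewrite divfK ?expf_neq0//.
by ring: k2.
Qed.

End model_geometry.

(** * Geodesics and the comparison inequality in terms of points *)

Section geodesic_points.
Variables (R : realType) (X : metricType R).
Implicit Types (p q m x y z : X) (s t : R).

Definition geo01 (g : R -> X) p q : Prop :=
  [/\ g 0 = p, g 1 = q & forall s t, 0 <= s <= 1 -> 0 <= t <= 1 ->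
    mdist (g s) (g t) = mdist p q * `|s - t|].

Lemma cdom_line_path (g : curve R X) t : 0 <= t <= 1 ->
  cdom g (line_path (cbegin g) (cend g) t).
Proof.
move=> /andP[t0 t1]; have gg := cbegin_le_cend g.
rewrite /cdom /= in_itv /= /line_path; apply/andP; split; nra.
Qed.

Lemma geodesic_geo01 (g : curve R X) p q : geodesic g -> joins g p q ->
  geo01 (cpoint g) p q.
Proof.
move=> [s s0 gs] [gp gq].
have E0 : line_path (cbegin g) (cend g) 0 = cbegin g by rewrite /line_path; ring.
have E1 : line_path (cbegin g) (cend g) 1 = cend g by rewrite /line_path; ring.
have d0 : cdom g (cbegin g) by rewrite -[cbegin g]E0; apply: cdom_line_path; lra.
have d1 : cdom g (cend g) by rewrite -[cend g]E1; apply: cdom_line_path; lra.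
have gg := cbegin_le_cend g.
split; rewrite /cpoint ?E0 ?E1// => u v u01 v01.
rewrite gs; [|exact: cdom_line_path..].
rewrite -gp -gq gs// (distrC (cbegin g)) -mulrA -normrM; congr (_ * `| _ |).
by rewrite /line_path; ring.
Qed.

Definition curve01 (g : R -> X) : curve R X :=
  @Curve R X 0 1 g ler01.

Lemma cpoint_curve01 (g : R -> X) t : cpoint (curve01 g) t = g t.
Proof. by rewrite /cpoint /line_path /= mulr0 add0r mulr1. Qed.

Lemma geo01_geodesic (g : R -> X) p q : geo01 g p q ->
  geodesic (curve01 g) /\ joins (curve01 g) p q.
Proof.
move=> [g0 g1 gE]; split=> //; exists (mdist p q); first exact: mdist_ge0.
by move=> u v; rewrite /cdom /= !in_itv /=; exact: gE.
Qed.

Lemma geo01_rev (g : R -> X) p q : geo01 g p q -> geo01 (fun t => g (1 - t)) q p.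
Proof.
move=> [g0 g1 gE]; split; rewrite ?subr0 ?subrr// => s t s01 t01.
rewrite gE; [|lra..].
by rewrite metric_sym -normrN; congr (_ * `| _ |); ring.
Qed.

Lemma geo01_dist0 (g : R -> X) p q t : geo01 g p q -> 0 <= t <= 1 ->
  mdist p (g t) = t * mdist p q.
Proof.
move=> [g0 g1 gE] t01; rewrite -{1}g0 gE//; last lra.
by rewrite sub0r normrN ger0_norm 1?mulrC//; case/andP: t01.
Qed.

Lemma geo01_dist1 (g : R -> X) p q t : geo01 g p q -> 0 <= t <= 1 ->
  mdist (g t) q = (1 - t) * mdist p q.
Proof.
move=> [g0 g1 gE] t01; rewrite -{1}g1 gE//; last lra.
by rewrite distrC ger0_norm 1?mulrC// subr_ge0; case/andP: t01.
Qed.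

Lemma geo01_btw (g : R -> X) p q t : geo01 g p q -> 0 <= t <= 1 ->
  btw p (g t) q.
Proof.
move=> gpq t01; rewrite /btw (geo01_dist0 gpq)// (geo01_dist1 gpq)//; ring.
Qed.

Lemma btw_concat p m q (g1 g2 : R -> X) : btw p m q ->
  geo01 g1 p m -> geo01 g2 m q -> exists2 g, geo01 g p q &
    exists2 t, 0 <= t <= 1 & t * mdist p q = mdist p m /\ g t = m.
Proof.
move=> pmq G1 G2; have [pq|pq] := eqVneq (mdist p q) 0.
  have [pm mq] : mdist p m = 0 /\ mdist m q = 0.
    by have := mdist_ge0 p m; have := mdist_ge0 m q; move: pmq;
      rewrite /btw; split; lra.
  exists (fun=> p); last first.
    by exists 0; rewrite ?lexx ?ler01// mul0r pm; split=> //; exact: mdist_positivity.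
  split=> //; first exact: mdist_positivity.
  by move=> s t _ _; rewrite pq mdistxx mul0r.
set l := mdist p q in pq *.
set a := mdist p m; set b := mdist m q.
have abl : a + b = l by exact: pmq.
have a0 : 0 <= a := mdist_ge0 _ _; have b0 : 0 <= b := mdist_ge0 _ _.
have l0 : 0 < l by rewrite lt_neqAle eq_sym pq -abl addr_ge0.
pose g t := if t * l <= a then g1 (t * l / a) else g2 ((t * l - a) / b).
have r1 t : 0 <= t -> t * l <= a -> 0 <= t * l / a <= 1 /\ t * l / a * a = t * l.
  move=> t0 tla; have [a00|a_gt0] := eqVneq a 0.
    have -> : t * l = 0.
      by apply/eqP; move: tla; rewrite a00 eq_le => ->; rewrite mulr_ge0// ltW.
    by rewrite mul0r lexx ler01 mul0r.
  have a1 : 0 < a by rewrite lt_neqAle eq_sym a_gt0.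
  by rewrite divfK// ler_pdivrMr// mul1r tla divr_ge0// mulr_ge0// ltW.
have r2 t : t <= 1 -> a < t * l ->
    0 <= (t * l - a) / b <= 1 /\ (t * l - a) / b * b = t * l - a.
  move=> t1 tla; have tl : t * l <= l by rewrite ler_piMl// ltW.
  have b1 : 0 < b by lra.
  split; last by rewrite divfK// gt_eqF.
  by rewrite ler_pdivrMr// mul1r divr_ge0 ?(ltW b1) ?subr_ge0 ?(ltW tla)//; lra.
have gp t : 0 <= t <= 1 -> mdist p (g t) = t * l.
  move=> /andP[t0 t1]; rewrite /g; case: ifPn => [tla|].
    by have [h1 h2] := r1 t t0 tla; rewrite (geo01_dist0 G1).
  rewrite -ltNge => tla; have [h1 h2] := r2 t t1 tla.
  have := geo01_dist0 G2 h1; have := geo01_dist1 G2 h1; rewrite [(1 - _) * _]mulrBl mul1r h2 -/b.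
  move=> e1 e2; apply/eqP; rewrite eq_le; apply/andP; split.
    by apply: (le_trans (metric_triangle _ m _)); rewrite e2 -/a; lra.
  have := metric_triangle p (g2 ((t * l - a) / b)) q; rewrite e1 -/l; lra.
have gq t : 0 <= t <= 1 -> mdist (g t) q = (1 - t) * l.
  move=> /andP[t0 t1]; rewrite /g; case: ifPn => [tla|]; last first.
    rewrite -ltNge => tla; have [h1 h2] := r2 t t1 tla.
    by rewrite (geo01_dist1 G2)// [(1 - _) * _]mulrBl mul1r h2 -/b; lra.
  have [h1 h2] := r1 t t0 tla.
  have := geo01_dist0 G1 h1; have := geo01_dist1 G1 h1; rewrite [(1 - _) * _]mulrBl mul1r h2 -/a.
  move=> e1 e2; apply/eqP; rewrite eq_le; apply/andP; split.
    by apply: (le_trans (metric_triangle _ m _)); rewrite e1 -/b; lra.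
  have := metric_triangle p (g1 (t * l / a)) q; rewrite e2 -/l; lra.
have gst s t : 0 <= s -> s <= t -> t <= 1 -> mdist (g s) (g t) = l * (t - s).
  move=> s0 st t1; apply/eqP; rewrite eq_le; apply/andP; split; last first.
    have := metric_triangle p (g s) q; have := metric_triangle (g s) (g t) q.
    by rewrite gp ?gq -/l; lra.
  have [h1 h2] : 0 <= t <= 1 /\ 0 <= s <= 1 by split; lra.
  have sl : s * l <= t * l by rewrite ler_wpM2r// ltW.
  have := gp t h1; have := gp s h2; have := gq t h1; have := gq s h2.
  rewrite /g; case: ifPn => [sa|]; case: ifPn => [ta|].
  - have [i1 j1] := r1 s s0 sa; have [i2 j2] := r1 t (le_trans s0 st) ta.
    have [_ _ ->//] := G1; move=> _ _ _ _; rewrite -/a distrC ger0_norm.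
      by rewrite mulrBr ![a * _]mulrC j1 j2; lra.
    by rewrite -mulrBl divr_ge0// subr_ge0.
  - rewrite -ltNge => ta _ _ _ _; apply: (le_trans (metric_triangle _ m _)).
    have [i1 j1] := r1 s s0 sa; have [i2 j2] := r2 t t1 ta.
    rewrite (geo01_dist1 G1)// (geo01_dist0 G2)// [(1 - _) * _]mulrBl mul1r -/a j1 -/b j2; lra.
  - by rewrite -ltNge => sa; have := le_lt_trans ta sa; lra.
  - rewrite -!ltNge => ta sa _ _ _ _.
    have [i1 j1] := r2 s (le_trans st t1) sa; have [i2 j2] := r2 t t1 ta.
    have [_ _ ->//] := G2; rewrite -/b distrC ger0_norm.
      by rewrite mulrBr ![b * _]mulrC j1 j2; lra.
    by rewrite -mulrBl divr_ge0//; lra.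
exists g.
  split=> [||s t /andP[s0 s1] /andP[t0 t1]].
  - by apply/esym/mdist_positivity; rewrite gp ?mul0r// lexx ler01.
  - by apply/mdist_positivity; rewrite gq ?subrr ?mul0r// lexx ler01.
  - have [st|/ltW ts] := leP s t; first by rewrite gst// distrC ger0_norm// subr_ge0.
    by rewrite metric_sym gst// ger0_norm// subr_ge0.
exists (a / l).
  by rewrite ler_pdivrMr// mul1r divr_ge0 ?(ltW l0)// -abl lerDl.
rewrite /g divfK// lexx; split=> //.
have [aE|aE] := eqVneq a 0.
  rewrite aE mul0r; have [-> _ _] := G1; exact: mdist_positivity.
by rewrite divff//; have [] := G1.
Qed.

Hypothesis Xgeo : geodesic_space X.

Lemma geo01_exists p q : exists g, geo01 g p q.
Proof.
have [g gg gpq] := Xgeo p q; exists (cpoint g); exact: geodesic_geo01.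
Qed.

Lemma btw_geo01 p m q : btw p m q -> exists2 g, geo01 g p q &
    exists2 t, 0 <= t <= 1 & t * mdist p q = mdist p m /\ g t = m.
Proof.
move=> pmq; have [g1 G1] := geo01_exists p m; have [g2 G2] := geo01_exists m q.
exact: (btw_concat pmq G1 G2).
Qed.

End geodesic_points.

Section comparison_triangles.
Variables (R : realType) (chi : R).
Hypothesis chi_le0 : chi <= 0.
Local Notation sn := (sn chi).
Local Notation md := (md chi).
Local Notation cs := (cs chi).
Local Notation K := (stewart_defect chi).
Local Notation M := (model_surface chi).

Lemma comparison_points (a b c : R) : 0 <= a -> 0 <= b -> 0 <= c ->
  a <= b + c -> b <= a + c -> c <= a + b ->
  exists p q r : M, [/\ mdist p q = a, mdist q r = b & mdist r p = c].
Proof.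
move=> a0 b0 c0 abc bac cab.
have on_circle (u : R) : u ^+ 2 <= 1 -> u ^+ 2 + Num.sqrt (1 - u ^+ 2) ^+ 2 = 1.
  by move=> u1; rewrite sqr_sqrtr ?subr_ge0// subrKC.
have e1 : (1 : R) ^+ 2 + 0 ^+ 2 = 1 by rewrite expr1n expr0n addr0.
have rad x u v : 0 <= x -> u ^+ 2 + v ^+ 2 = 1 ->
    mdist (polar chi x u v) (polar chi 0 1 0) = x.
  move=> x0 uv; apply: (md_inj chi_le0) => //; first exact: mdist_ge0.
  by rewrite mdist_polar// sn0 md0; ring.
have [a00|a_neq0] := eqVneq a 0.
  exists (polar chi 0 1 0), (polar chi 0 1 0), (polar chi b 1 0).
  by rewrite mdistxx metric_sym !rad//; split=> //; lra.
have [c00|c_neq0] := eqVneq c 0.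
  exists (polar chi 0 1 0), (polar chi a 1 0), (polar chi 0 1 0).
  by rewrite mdistxx metric_sym !rad//; split=> //; lra.
have sa : 0 < sn a by rewrite sn_gt0// lt_neqAle eq_sym a_neq0.
have sc : 0 < sn c by rewrite sn_gt0// lt_neqAle eq_sym c_neq0.
pose u := (md a + md c - chi * md a * md c - md b) / (sn a * sn c).
have uE : sn a * sn c * u = md a + md c - chi * md a * md c - md b.
  by rewrite /u mulrC divfK// gt_eqF// mulr_gt0.
have u1 : u ^+ 2 <= 1.
  have h1 : md b <= md (a + c) by apply: ler_md.
  have h2 : md (a - c) <= md b.
    rewrite -md_norm; apply: ler_md => //.
    by rewrite ler_norml; lra.
  rewrite mdB// mdD// in h1 h2.
  have sac : 0 < sn a * sn c by rewrite mulr_gt0.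
  have uu1 : u <= 1 by rewrite -(ler_pM2l sac) uE; lra.
  have u1 : - 1 <= u by rewrite -(ler_pM2l sac) uE; lra.
  by nra.
exists (polar chi 0 1 0), (polar chi a 1 0),
  (polar chi c u (Num.sqrt (1 - u ^+ 2))).
rewrite (metric_sym (polar chi 0 1 0)) !rad ?on_circle//; split=> //.
apply: (md_inj chi_le0) => //; first exact: mdist_ge0.
rewrite mdist_polar// ?on_circle// mul1r mul0r addr0 uE; ring.
Qed.

Lemma model_geo01 (p q : M) : exists g, geo01 g p q.
Proof.
have [->|pq] := eqVneq p q.
  by exists (fun=> q); split=> // s t _ _; rewrite !mdistxx mul0r.
have l0 : 0 < mdist p q by rewrite mdist_gt0.
exists (fun t => model_line p q (t * mdist p q)); split.
- by rewrite mul0r model_line0.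
- by rewrite mul1r model_line1.
- move=> s t s01 t01; rewrite mdist_model_line//; last 2 first.
  + by rewrite mulr_ge0 ?(ltW l0) 1?ger_pMl//; lra.
  + by rewrite mulr_ge0 ?(ltW l0) 1?ger_pMl//; lra.
  by rewrite -mulrBl normrM (gtr0_norm l0) mulrC.
Qed.

(** The comparison inequality between a vertex and the opposite side is an
    upper bound by the corresponding distance in a comparison triangle, and
    that distance increases with the two sides at the vertex. *)
Lemma stewart_le_model (X : metricType R) (x p m q : X) (x' p' m' q' : M) :
  btw p' m' q' -> mdist p' m' = mdist p m -> mdist m' q' = mdist m q ->
  mdist x p <= mdist x' p' -> mdist x q <= mdist x' q' ->
  stewart chi x p m q -> mdist x m <= mdist x' m'.
Proof.
move=> pmq' pm mq xp xq; have := model_stewart chi_le0 x' pmq'.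
rewrite /stewart pm mq.
have [pq0|pq0] := eqVneq (mdist p m + mdist m q) 0.
  have pm0 : mdist p m = 0 by have := mdist_ge0 p m; have := mdist_ge0 m q; lra.
  rewrite -(mdist_positivity _ _ pm0); rewrite -pm in pm0.
  by rewrite -(mdist_positivity _ _ pm0).
have pq1 : 0 < mdist p m + mdist m q by rewrite lt_neqAle eq_sym pq0 addr_ge0// mdist_ge0.
move=> e h; apply: (ler_md_inv chi_le0); first exact: mdist_ge0.
rewrite -(ler_pM2l (sn_gt0 chi pq1)) -(lerD2r (K (mdist p m) (mdist m q))) e.
by apply: (le_trans h); rewrite lerD// ler_wpM2l ?sn_ge0 ?mdist_ge0// ler_md ?mdist_ge0.
Qed.

Lemma model_le_stewart (X : metricType R) (x p m q : X) (x' p' m' q' : M) :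
  btw p' m' q' -> mdist p' m' = mdist p m -> mdist m' q' = mdist m q ->
  mdist x' p' = mdist x p -> mdist x' q' = mdist x q ->
  mdist x m <= mdist x' m' -> stewart chi x p m q.
Proof.
move=> pmq' pm mq xp xq xm; have := model_stewart chi_le0 x' pmq'.
rewrite /stewart pm mq xp xq => <-.
by rewrite lerD2r ler_wpM2l ?sn_ge0 ?addr_ge0 ?mdist_ge0// ler_md ?mdist_ge0.
Qed.

Definition vertices (T : Type) (p q x : T) (i : 'I_3) : T :=
  nth x [:: p; q; x] i.

Lemma forall_ord3 (P : 'I_3 -> Prop) :
  P ord0 -> P (ordS ord0) -> P (ordS (ordS ord0)) -> forall i, P i.
Proof.
move=> P0 P1 P2 [[|[|[|//]]] i3]; [move: P0|move: P1|move: P2];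
  by congr (P _); apply: val_inj.
Qed.

(** The vertex [x] and the point [m] of the opposite side, which may be chosen
    to pass through [m], are two points on the edges of a triangle. *)
Lemma CAT_inequality_stewart (X : metricType R) (C : ('I_3 -> X) -> Prop) :
  geodesic_space X ->
  (forall v e, geodesic_triangle v e -> C v -> CAT_inequality chi e) ->
  forall x p m q : X, btw p m q -> C (vertices p q x) -> stewart chi x p m q.
Proof.
move=> Xgeo Xcat x p m q pmq Cv.
have [g0 G0 [t t01 [tl g0t]]] := btw_geo01 Xgeo pmq.
have [g1 G1] := geo01_exists Xgeo q x; have [g2 G2] := geo01_exists Xgeo x p.
have [p' [q' [x' [pq qx xp]]]] : exists p' q' x' : M, [/\ mdist p' q' = mdist p q,
    mdist q' x' = mdist q x & mdist x' p' = mdist x p].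
  apply: comparison_points; rewrite ?mdist_ge0//.
  - by rewrite (metric_sym x p) addrC (metric_sym q); exact: metric_triangle.
  - by rewrite (metric_sym p q) (metric_sym x p); exact: metric_triangle.
  - by rewrite (metric_sym p q) (metric_sym q x) (metric_sym x p)
      (metric_sym p x) addrC; exact: metric_triangle.
have [h0 H0] := model_geo01 p' q'; have [h1 H1] := model_geo01 q' x'.
have [h2 H2] := model_geo01 x' p'.
pose e := vertices (curve01 g0) (curve01 g1) (curve01 g2).
pose e' := vertices (curve01 h0) (curve01 h1) (curve01 h2).
have tri : geodesic_triangle (vertices p q x) e.
  by apply: forall_ord3; apply: geo01_geodesic.
have tri' : geodesic_triangle (vertices p' q' x') e'.
  by apply: forall_ord3; apply: geo01_geodesic.
have cmp : comparison_triangle e (vertices p' q' x') e'.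
  split=> //; move: tri tri' => tri tri'.
  move=> i; have [_ [-> ->]] := tri i; have [_ [-> ->]] := tri' i.
  by move: i; apply: forall_ord3.
have := Xcat _ _ tri Cv _ _ cmp (ordS ord0) ord0 1 t.
rewrite lexx ler01 => /(_ isT t01).
rewrite /cpoint -!/(cpoint _ _) !cpoint_curve01 g0t.
have [_ -> _] := G1; have [_ -> _] := H1 => xm.
have e1 : mdist p' (h0 t) = mdist p m by rewrite (geo01_dist0 H0)// pq tl.
have e2 : mdist (h0 t) q' = mdist m q.
  by rewrite (geo01_dist1 H0)// pq mulrBl mul1r tl -pmq; ring.
have e3 : mdist x' q' = mdist x q by rewrite metric_sym qx metric_sym.
exact: (model_le_stewart (geo01_btw H0 t01) e1 e2 xp e3).
Qed.

(** Two points on adjacent edges: apply the comparison inequality first with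
    the vertex opposite to one of the edges, then with the point found on that
    edge as a vertex. *)
Lemma stewart_CAT (X : metricType R) : geodesic_space X ->
  (forall x p m q : X, btw p m q -> stewart chi x p m q) -> CAT chi X.
Proof.
move=> Xgeo Xst; split=> // v e tri v' e' [tri' len'].
have G i : geo01 (cpoint (e i)) (v i) (v (ordS i)).
  by have [] := tri i; exact: geodesic_geo01.
have G' i : geo01 (cpoint (e' i)) (v' i) (v' (ordS i)).
  by have [] := tri' i; exact: geodesic_geo01.
have len i : mdist (v' i) (v' (ordS i)) = mdist (v i) (v (ordS i)).
  have [_ [ei0 ei1]] := tri i; have [_ [ei0' ei1']] := tri' i.
  by rewrite -ei0 -ei1 -ei0' -ei1' len'.
have S3 i : ordS (ordS (ordS i)) = i :> 'I_3.
  by move: i; apply: forall_ord3; apply: val_inj.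
have adj i s t : 0 <= s <= 1 -> 0 <= t <= 1 ->
    mdist (cpoint (e i) s) (cpoint (e (ordS i)) t) <=
    mdist (cpoint (e' i) s) (cpoint (e' (ordS i)) t).
  move=> s01 t01; have iS := G i; have iS' := G' i.
  have jS := G (ordS i); have jS' := G' (ordS i).
  have CA : mdist (v (ordS (ordS i))) (v i) = mdist (v' (ordS (ordS i))) (v' i).
    by have := len (ordS (ordS i)); rewrite S3.
  have CB : mdist (v (ordS (ordS i))) (v (ordS i)) =
            mdist (v' (ordS (ordS i))) (v' (ordS i)).
    by rewrite metric_sym -len metric_sym.
  have PB : mdist (cpoint (e i) s) (v (ordS i)) =
            mdist (cpoint (e' i) s) (v' (ordS i)).
    by rewrite (geo01_dist1 iS)// (geo01_dist1 iS')// len.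
  have PC : mdist (cpoint (e i) s) (v (ordS (ordS i))) <=
            mdist (cpoint (e' i) s) (v' (ordS (ordS i))).
    rewrite metric_sym [leRHS]metric_sym.
    apply: (stewart_le_model (geo01_btw iS' s01)); last 1 first.
    - exact/Xst/(geo01_btw iS).
    - by rewrite (geo01_dist0 iS)// (geo01_dist0 iS')// len.
    - by rewrite (geo01_dist1 iS)// (geo01_dist1 iS')// len.
    - by rewrite CA.
    - by rewrite CB.
  apply: (stewart_le_model (geo01_btw jS' t01)); last 1 first.
  - exact/Xst/(geo01_btw jS).
  - by rewrite (geo01_dist0 jS)// (geo01_dist0 jS')// len.
  - by rewrite (geo01_dist1 jS)// (geo01_dist1 jS')// len.
  - by rewrite PB.
  - exact: PC.
move=> i j s t s01 t01.
have [->|ij] := eqVneq j i.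
  have [_ _ ->//] := G i; have [_ _ ->//] := G' i; rewrite len//.
have [->|ji] := eqVneq j (ordS i); first exact: adj.
have -> : i = ordS j.
  apply/eqP; move: ij ji; case: i j => [[|[|[|//]]] ?] [[|[|[|//]]] ?] //.
by rewrite metric_sym [leRHS]metric_sym; exact: adj.
Qed.

End comparison_triangles.

Lemma lipschitz_within_continuous (R : realType) (f : R -> R) (L C : R) : 0 <= C ->
  (forall s t, 0 <= s <= L -> 0 <= t <= L -> `|f s - f t| <= C * `|s - t|) ->
  {within `[0, L], continuous f}.
Proof.
move=> C0 fC; apply/subspace_continuousP => s.
rewrite /= in_itv /= => s0L; apply/cvgrPdist_lt => e e0.
have d0 : 0 < e / (C + 1) by rewrite divr_gt0// ltr_wpDl.
rewrite near_withinE; near=> t => /=; rewrite in_itv /= => t0L.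
apply: (le_lt_trans (fC _ _ s0L t0L)).
have st : `|s - t| < e / (C + 1).
  by near: t; exact: nbhsx_ballx.
have C1 : 0 < C + 1 by rewrite ltr_wpDl.
rewrite ltr_pdivlMr// in st; apply: le_lt_trans st.
by rewrite mulrC ler_wpM2l// lerDl.
Unshelve. all: by end_near. Qed.

Lemma mdist_lipschitz (R : realType) (X : metricType R) (z x y : X) :
  `|mdist z x - mdist z y| <= mdist x y.
Proof.
rewrite ler_norml; have := metric_triangle z y x; have := metric_triangle z x y.
by rewrite (metric_sym y x); lra.
Qed.

Section kinks.
Variables (R : realType) (chi : R).
Hypothesis chi_le0 : chi <= 0.
Local Notation sn := (sn chi).
Local Notation md := (md chi).
Local Notation cs := (cs chi).
Local Notation K := (stewart_defect chi).
Local Notation M := (model_surface chi).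

Lemma geo01_within_continuous (X : metricType R) (g : R -> X) (p q z : X) (L : R) :
  geo01 g p q -> mdist p q = L -> 0 < L ->
  {within `[0, L], continuous (fun s => mdist z (g (s / L)))}.
Proof.
move=> [g0 g1 gE] pqL L0; apply: (@lipschitz_within_continuous _ _ _ 1) => // s t sL tL.
apply: (le_trans (mdist_lipschitz _ _ _)).
rewrite gE; last 2 first.
- by rewrite divr_ge0 ?(ltW L0) ?ler_pdivrMr//; lra.
- by rewrite divr_ge0 ?(ltW L0) ?ler_pdivrMr//; lra.
by rewrite -mulrBl normrM [`|L^-1|]gtr0_norm ?invr_gt0// pqL mulrCA divff ?gt_eqF// mulr1 mul1r.
Qed.

(** The maximum principle along the side: the kinks make the modified distance a
    subsolution, and the model gives the solution with the same values at the
    ends. *)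
Lemma kinks_stewart (X : metricType R) (g : R -> X) (p q z : X) (t : R) :
  geo01 g p q ->
  (forall t, 0 < t < 1 -> exists2 h0, 0 < h0 & forall h, 0 < h < h0 ->
    0 <= t - h -> t + h <= 1 ->
    2 * (cs (h * mdist p q) * md (mdist z (g t)) + md (h * mdist p q)) <=
    md (mdist z (g (t + h))) + md (mdist z (g (t - h)))) ->
  0 <= t <= 1 -> stewart chi z p (g t) q.
Proof.
move=> G kink t01; have [pq|pq] := eqVneq (mdist p q) 0.
  have pg : mdist p (g t) = 0 by rewrite (geo01_dist0 G)// pq mulr0.
  have gq : mdist (g t) q = 0 by rewrite (geo01_dist1 G)// pq mulr0.
  by rewrite /stewart pg gq /K addr0 sn0 md0; lra.
set l := mdist p q in pq kink *.
have l0 : 0 < l by rewrite lt_neqAle eq_sym pq mdist_ge0.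
pose f s := md (mdist z (g (s / l))).
have fc : {within `[0, l], continuous f}.
  move=> x; have := @geo01_within_continuous X g p q z l G erefl l0 x.
  move=> h; apply: (cvg_comp _ _ h); exact: md_continuous.
have := stewart_maximum_principle chi_le0 l0 fc.
have -> : f 0 = md (mdist z p) by rewrite /f mul0r; have [-> _ _] := G.
have -> : f l = md (mdist z q) by rewrite /f divff//; have [_ -> _] := G.
rewrite /stewart (geo01_dist0 G)// (geo01_dist1 G)// -/l => mp.
have := mp _ (t * l); rewrite /f mulfK//.
have -> : l - t * l = (1 - t) * l by ring.
have -> : t * l + (1 - t) * l = l by ring.
apply; last first.
  by rewrite mulr_ge0 ?(ltW l0) 1?ger_pMl//; lra.
move=> s /andP[s0 sl]; have tl : 0 < s / l < 1.
  by rewrite divr_gt0// ltr_pdivrMr// mul1r.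
have [h0 h00 hk] := kink _ tl.
exists (Num.min (h0 * l) (Num.min s (l - s))).
  by rewrite !lt_min s0 subr_gt0 sl mulr_gt0.
move=> h /andP[h_gt0]; rewrite !lt_min => /and3P[hh0 hs hl].
have := hk (h / l); rewrite divfK// divr_gt0//= ltr_pdivrMr// => /(_ hh0).
rewrite -mulrBl -mulrDl; apply; first by rewrite divr_ge0// ?(ltW l0)//; lra.
by rewrite ler_pdivrMr// mul1r; lra.
Qed.

End kinks.

Section euclidean_comparison.
Variables (R : realType) (chi : R).
Hypothesis chi_le0 : chi <= 0.
Local Notation sn := (sn chi).
Local Notation md := (md chi).
Local Notation cs := (cs chi).
Local Notation K := (stewart_defect chi).
Local Notation M := (model_surface chi).

Lemma sqr_concave_md (u t s v : R) : 0 <= u -> u <= t -> t <= s -> s <= v ->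
  md s + md t = md v + md u -> u ^+ 2 + v ^+ 2 <= s ^+ 2 + t ^+ 2.
Proof.
move=> u0 ut ts sv; rewrite /md; case: ifP => h E; last by lra.
have k0 := curv_gt0 h; have k2 : 0 < curv chi ^+ 2 by rewrite exprn_gt0.
rewrite -(ler_pM2l k2) !mulrDr -!exprMn; apply: sqr_concave_cosh.
- by rewrite mulr_ge0// ltW.
- by rewrite ler_pM2l.
- by rewrite ler_pM2l.
- by rewrite ler_pM2l.
rewrite -!mulrDl in E; have {E} := mulIf (invr_neq0 (lt0r_neq0 k2)) E; lra.
Qed.

(** Comparison with the Euclidean plane, without denominators. *)
Definition stewart0 (X : metricType R) (x p m q : X) : Prop :=
  (mdist p m + mdist m q) * mdist x m ^+ 2 +
    mdist p m * mdist m q * (mdist p m + mdist m q) <=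
  mdist m q * mdist x p ^+ 2 + mdist p m * mdist x q ^+ 2.

Lemma stewart0P (X : metricType R) (x p m q : X) :
  stewart0 x p m q <-> stewart 0 x p m q.
Proof.
rewrite /stewart0 /stewart /stewart_defect !sn_flat !md_flat.
by split; lra.
Qed.

(** The model surface itself is CAT(0): at the middle of a short segment, the
    hyperbolic parallelogram identity prescribes the sum of the modified
    distances to the ends, and their squares are concave functions of the
    modified distances, hence have the least sum when the ends are aligned with
    the given point. *)
Lemma model_stewart0 (x p m q : M) : btw p m q -> stewart0 x p m q.
Proof.
have Mgeo : geodesic_space M.
  move=> a b; have [g] := model_geo01 chi_le0 a b.
  by move=> /geo01_geodesic[? ?]; exists (curve01 g).
move=> pmq; have [g G [t t01 [_ <-]]] := btw_geo01 Mgeo pmq; apply/stewart0P.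
apply: (@kinks_stewart R 0 (lexx 0) _ g p q x t G) => // {m pmq t01} => s /andP[s0 s1].
exists 1 => // h /andP[h0 h1] sh0 sh1; set l := mdist p q.
have [s01 sp01 sm01] : [/\ 0 <= s <= 1, 0 <= s + h <= 1 & 0 <= s - h <= 1].
  by split; lra.
have [_ _ gE] := G.
have dp : mdist (g s) (g (s + h)) = h * l.
  by rewrite gE// opprD addNKr normrN gtr0_norm// mulrC.
have dm : mdist (g (s - h)) (g s) = h * l.
  by rewrite gE// addrAC subrr add0r normrN gtr0_norm// mulrC.
have dpm : mdist (g (s - h)) (g (s + h)) = 2 * (h * l).
  by rewrite gE// [X in `|X|](_ : _ = - (2 * h)); [
    rewrite normrN gtr0_norm ?mulr_gt0// -/l; ring | ring].
have hl0 : 0 <= h * l by rewrite mulr_ge0 ?mdist_ge0// ltW.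
set a := mdist x (g s); set b := mdist x (g (s + h)); set c := mdist x (g (s - h)).
have tri1 := metric_triangle x (g (s - h)) (g s).
have tri2 := metric_triangle x (g s) (g (s - h)).
have tri3 := metric_triangle x (g (s + h)) (g s).
have tri4 := metric_triangle x (g s) (g (s + h)).
have tri5 := metric_triangle (g s) x (g (s + h)).
have tri6 := metric_triangle (g (s - h)) x (g s).
rewrite (metric_sym (g s) (g (s - h))) (metric_sym (g (s + h)) (g s))
  (metric_sym (g s) x) (metric_sym (g (s - h)) x) ?dm ?dp -/a -/b -/c
  in tri1 tri2 tri3 tri4 tri5 tri6.
suff : 2 * a ^+ 2 + 2 * (h * l) ^+ 2 <= b ^+ 2 + c ^+ 2.
  by rewrite !cs_flat !md_flat -/a -/b -/c; lra.
have [hl1|hl1] := eqVneq (h * l) 0.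
  have -> : b = a by lra.
  have -> : c = a by lra.
  by rewrite hl1; lra.
have hl2 : 0 < h * l by rewrite lt_neqAle eq_sym hl1.
have E : md b + md c = md (a + h * l) + md `|a - h * l|.
  have btwg : btw (g (s - h)) (g s) (g (s + h)) by rewrite /btw dm dp dpm; ring.
  have := model_stewart chi_le0 x btwg; rewrite dm dp -/a -/b -/c /K.
  rewrite md_norm mdD// mdB// snD// => e.
  apply: (mulfI (lt0r_neq0 (sn_gt0 chi hl2))); move: e; rewrite /cs; lra.
have [u0 u1] : `|a - h * l| <= b /\ `|a - h * l| <= c.
  by rewrite !ler_norml; split; lra.
have v0 : (a + h * l) ^+ 2 + `|a - h * l| ^+ 2 = 2 * a ^+ 2 + 2 * (h * l) ^+ 2.
  by rewrite real_normK ?num_real//; ring.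
rewrite -v0 addrC; have [bc|/ltW cb] := leP b c.
  by rewrite [leRHS]addrC; apply: sqr_concave_md => //; lra.
by apply: sqr_concave_md => //; lra.
Qed.

Lemma stewart_stewart0 (X : metricType R) (x p m q : X) : btw p m q ->
  stewart chi x p m q -> stewart0 x p m q.
Proof.
move=> pmq st.
have [p' [q' [x' [pq qx xp]]]] : exists p' q' x' : M, [/\ mdist p' q' = mdist p q,
    mdist q' x' = mdist q x & mdist x' p' = mdist x p].
  apply: comparison_points; rewrite ?mdist_ge0//.
  - by rewrite (metric_sym x p) addrC (metric_sym q); exact: metric_triangle.
  - by rewrite (metric_sym p q) (metric_sym x p); exact: metric_triangle.
  - by rewrite (metric_sym p q) (metric_sym q x) (metric_sym x p)
      (metric_sym p x) addrC; exact: metric_triangle.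
have [h0 H0] := model_geo01 chi_le0 p' q'.
have [t t01 [tp tq]] : exists2 t, 0 <= t <= 1 &
    mdist p m = t * mdist p q /\ mdist m q = (1 - t) * mdist p q.
  have pm0 := mdist_ge0 p m; have mq0 := mdist_ge0 m q.
  have [e|e] := eqVneq (mdist p q) 0.
    by exists 0; rewrite ?lexx ?ler01// e !mulr0; move: pmq; rewrite /btw; split; lra.
  have e0 : 0 < mdist p q by rewrite lt_neqAle eq_sym e mdist_ge0.
  exists (mdist p m / mdist p q).
    by rewrite divr_ge0 ?(ltW e0)// ler_pdivrMr// mul1r -pmq lerDl.
  by rewrite mulrBl mul1r divfK// -pmq; split; ring.
have B := geo01_btw H0 t01.
have e1 : mdist p' (h0 t) = mdist p m by rewrite (geo01_dist0 H0)// pq.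
have e2 : mdist (h0 t) q' = mdist m q by rewrite (geo01_dist1 H0)// pq.
have e3 : mdist x' q' = mdist x q by rewrite metric_sym qx metric_sym.
have xm : mdist x m <= mdist x' (h0 t).
  by apply: (stewart_le_model chi_le0 B e1 e2) st; rewrite ?xp ?e3.
have := model_stewart0 x' B; rewrite /stewart0 e1 e2 xp e3; apply: le_trans.
by rewrite lerD2r ler_wpM2l ?addr_ge0 ?mdist_ge0// lerXn2r ?nnegrE ?mdist_ge0.
Qed.

End euclidean_comparison.

(** * The hypotheses in terms of points *)

Section point_hypotheses.
Variables (R : realType) (chi : R) (X : metricType R) (Delta : set X).
Hypothesis chi_le0 : chi <= 0.

Definition far (r : R) (x : X) : Prop := forall v, Delta v -> r <= mdist x v.

Lemma far_lipschitz r x y : far r x -> far (r - mdist x y) y.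
Proof.
move=> rx v Dv; have := rx v Dv; have := metric_triangle x y v; lra.
Qed.

Lemma far_le r s x : s <= r -> far r x -> far s x.
Proof. by move=> sr rx v Dv; exact: le_trans (rx v Dv). Qed.

Lemma far_notin r x : 0 < r -> far r x -> ~ Delta x.
Proof. by move=> r0 rx Dx; have := rx x Dx; rewrite mdistxx leNgt r0. Qed.

Lemma far_dist_to_set r x : Delta !=set0 -> far r x -> r <= dist_to_set x Delta.
Proof.
move=> [a Da] rx; apply: lb_le_inf; first by exists (mdist x a); exists a.
by move=> _ [v Dv <-]; exact: rx.
Qed.

Lemma closed_far x : closed Delta -> ~ Delta x -> exists2 r, 0 < r & far r x.
Proof.
move=> cD Dx; have : nbhs x (~` Delta).
  by apply: open_nbhs_nbhs; split=> //; exact: closed_openC.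
rewrite nbhs_ballP => -[r /= r0 rD]; exists r => // v Dv.
rewrite leNgt; apply/negP => xv; apply: (rD v _ Dv).
by rewrite ballEmdist.
Qed.

Definition cauchy_seq (T : metricType R) (u : nat -> T) : Prop :=
  forall e, 0 < e -> exists N, forall m n, (N <= m)%N -> (N <= n)%N ->
    mdist (u m) (u n) < e.

Definition converges (T : metricType R) (u : nat -> T) (l : T) : Prop :=
  forall e, 0 < e -> exists N, forall n, (N <= n)%N -> mdist (u n) l < e.

Lemma cauchy_seq_cauchy (T : metricType R) (u : nat -> T) :
  cauchy_seq u -> cauchy (u @ \oo).
Proof.
move=> uc; apply/cauchy_ballP => e e0; have [N uN] := uc e e0.
exists (u @` [set n | (N <= n)%N], u @` [set n | (N <= n)%N]) => /=.
  by split; exists N => // n /= Nn; exists n.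
by move=> [x y] /= [[m Nm <-] [n Nn <-]]; rewrite ballEmdist; exact: uN.
Qed.

Lemma complete_cauchy_seq (u : nat -> X) : complete_space X ->
  cauchy_seq u -> exists l, converges u l.
Proof.
move=> Xc uc; have [|l ul] := Xc (u @ \oo); first exact: cauchy_seq_cauchy.
exists l => e e0; have /ul [N _ uN] : nbhs l (ball l e) by exact: nbhsx_ballx.
exists N => n Nn; have := uN n Nn; rewrite /= ballEmdist /=.
by rewrite metric_sym.
Qed.

Lemma converges_mdist (T : metricType R) (u v : nat -> T) (x y : T) (C : R) :
  converges u x -> converges v y ->
  (exists N, forall n, (N <= n)%N -> mdist (u n) (v n) <= C) -> mdist x y <= C.
Proof.
move=> ux vy [N uvC]; apply/ler_addgt0Pl => e e0.
have e2 : 0 < e / 2 by rewrite divr_gt0.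
have [N1 h1] := ux _ e2; have [N2 h2] := vy _ e2.
pose n := maxn N (maxn N1 N2).
have := h1 n; have := h2 n; have := uvC n.
rewrite /n leq_maxl !leq_max !leqnn !orbT => /(_ isT) + /(_ isT) + /(_ isT).
have := metric_triangle x (u n) y; have := metric_triangle (u n) (v n) y.
by rewrite (metric_sym x (u n)) -/n; lra.
Qed.

Lemma hinge_hypothesis_stewart :
  geodesic_space X ->
  (forall (v : 'I_3 -> X) (e : 'I_3 -> curve R X),
    geodesic_triangle v e -> (exists i : 'I_3, Delta (v i)) ->
    CAT_inequality chi e) ->
  forall x p m q, btw p m q -> Delta x \/ Delta p \/ Delta q ->
    stewart chi x p m q.
Proof.
move=> Xgeo hA x p m q pmq D.
apply: (CAT_inequality_stewart chi_le0 Xgeo hA pmq).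
by case: D => [D|[D|D]]; [exists (ordS (ordS ord0))|exists ord0|exists (ordS ord0)].
Qed.

Lemma ball_hypothesis_stewart (lambda : R) : 0 < lambda -> Delta !=set0 ->
  (forall x : X, ~ Delta x ->
    CAT chi (metric_closed_ball x (lambda * dist_to_set x Delta))) ->
  forall w r, 0 < r -> far r w -> forall x p m q,
    mdist w x <= lambda * r -> mdist w p <= lambda * r ->
    mdist w m <= lambda * r -> mdist w q <= lambda * r ->
    btw p m q -> stewart chi x p m q.
Proof.
move=> l0 D0 hC w r r0 rw x p m q wx wp wm wq pmq.
have [Bgeo Bcat] := hC w (far_notin r0 rw).
set B := metric_closed_ball _ _ in Bgeo Bcat.
have inB y : mdist w y <= lambda * r -> y \in B.
  move=> wy; rewrite inE /B /metric_closed_ball /=; apply: (le_trans wy).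
  by rewrite ler_pM2l//; exact: far_dist_to_set.
pose sub y wy : B := SigSub (inB y wy).
have := @CAT_inequality_stewart R chi chi_le0 B (fun=> True) Bgeo
  (fun v e t _ => Bcat v e t) (sub x wx) (sub p wp) (sub m wm) (sub q wq).
by apply.
Qed.

End point_hypotheses.

(** * Euclidean comparison in small balls *)

Section euclidean_lemmas.
Variables (R : realType) (X : metricType R).
Implicit Types (x y p q m w A B C D : X) (t r : R).
Local Notation d := mdist.

Lemma stewart0_geo01 (g : R -> X) x p q t : geo01 g p q -> 0 <= t <= 1 ->
  stewart0 x p (g t) q ->
  d x (g t) ^+ 2 <=
    (1 - t) * d x p ^+ 2 + t * d x q ^+ 2 - t * (1 - t) * d p q ^+ 2.
Proof.
move=> G t01; have [pq|pq] := eqVneq (d p q) 0.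
  have e1 : d p (g t) = 0 by rewrite (geo01_dist0 G)// pq mulr0.
  move=> _; rewrite pq -(mdist_positivity _ _ e1) -(mdist_positivity _ _ pq); lra.
have l0 : 0 < d p q by rewrite lt_neqAle eq_sym pq mdist_ge0.
rewrite /stewart0 (geo01_dist0 G)// (geo01_dist1 G)// => st.
by rewrite -(ler_pM2l l0); lra.
Qed.

Lemma geo01_contraction (g h : R -> X) c x y t : geo01 g c x -> geo01 h c y ->
  0 <= t <= 1 -> stewart0 y c (g t) x -> stewart0 (g t) c (h t) y ->
  d (g t) (h t) <= t * d x y.
Proof.
move=> G H t01 /(stewart0_geo01 G t01) s1 /(stewart0_geo01 H t01) s2.
have /andP[t0 t1] := t01.
rewrite (metric_sym (g t) c) (geo01_dist0 G)// in s2.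
rewrite (metric_sym y c) (metric_sym y x) in s1.
rewrite (metric_sym (g t) y) in s2.
rewrite -ler_sqr ?nnegrE ?mdist_ge0 ?mulr_ge0 ?mdist_ge0//.
apply: (le_trans s2); have := ler_wpM2l t0 s1; lra.
Qed.

Lemma btw_ball w A m C r : d w A <= r -> d w C <= r -> btw A m C -> d w m <= 2 * r.
Proof.
move=> wA wC AmC; have := metric_triangle w A m; have := metric_triangle w C m.
have := metric_triangle A w C; rewrite -AmC (metric_sym A w) (metric_sym C m); lra.
Qed.

Definition cat0_ball w r : Prop := forall x p m q, d w x <= r -> d w p <= r ->
  d w m <= r -> d w q <= r -> btw p m q -> stewart0 x p m q.

Hypothesis Xgeo : geodesic_space X.

Definition pt p q : R -> X := projT1 (cid (geo01_exists Xgeo p q)).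

Lemma pt_geo01 p q : geo01 (pt p q) p q.
Proof. exact: (projT2 (cid (geo01_exists Xgeo p q))). Qed.

Variables (w : X) (r : R).
Hypothesis wr : cat0_ball w (2 * r).

Lemma cat0_ball_sqr (g : R -> X) x p q t : geo01 g p q -> 0 <= t <= 1 ->
  d w x <= 2 * r -> d w p <= r -> d w q <= r ->
  d x (g t) ^+ 2 <=
    (1 - t) * d x p ^+ 2 + t * d x q ^+ 2 - t * (1 - t) * d p q ^+ 2.
Proof.
move=> G t01 wx wp wq; apply: (stewart0_geo01 G t01); have r0 := mdist_ge0 w p.
apply: wr => //; [lra| |lra|exact: (geo01_btw G)].
exact: (btw_ball wp wq (geo01_btw G t01)).
Qed.

(** In a quadrilateral [A], [B], [C], [D] the diagonals are estimated through
    the point that divides [A, C] in the ratio of [A, D] to [B, C]. *)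
Lemma cat0_quadrilateral A B C D : d w A <= r -> d w B <= r -> d w C <= r ->
  d w D <= r ->
  d A C ^+ 2 + d B D ^+ 2 <= d A B ^+ 2 + d C D ^+ 2 + 2 * d A D * d B C.
Proof.
move=> wA wB wC wD; have r0 : 0 <= r := le_trans (mdist_ge0 w A) wA.
have AD0 := mdist_ge0 A D; have BC0 := mdist_ge0 B C.
have [AD|AD] := eqVneq (d A D) 0.
  have <- := mdist_positivity _ _ AD.
  by rewrite mdistxx (metric_sym B A) (metric_sym C A); lra.
have [BC|BC] := eqVneq (d B C) 0.
  have <- := mdist_positivity _ _ BC; rewrite mdistxx; lra.
set a := d A D in AD AD0 *; set b := d B C in BC BC0 *.
have a0 : 0 < a by rewrite lt_neqAle eq_sym AD.
have b0 : 0 < b by rewrite lt_neqAle eq_sym BC.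
pose t := a / (a + b).
have t01 : 0 <= t <= 1.
  by rewrite divr_ge0 ?ler_pdivrMr ?addr_gt0// ?addr_ge0// mul1r lerDl.
have G := pt_geo01 A C; set P := pt A C t.
have hB := cat0_ball_sqr G t01 (_ : d w B <= 2 * r) wA wC.
have hD := cat0_ball_sqr G t01 (_ : d w D <= 2 * r) wA wC.
have {}hB := hB ltac:(lra); have {}hD := hD ltac:(lra).
rewrite -/P in hB hD.
have BD := metric_triangle B P D.
have ab : a + b != 0 by rewrite gt_eqF// addr_gt0.
have tE : t * (a + b) = a by rewrite /t divfK.
have t1E : (1 - t) * (a + b) = b by rewrite mulrBl tE mul1r; ring.
rewrite (metric_sym P D) in BD.
(* [BD ^+ 2 <= (x + y) ^+ 2 <= x ^+ 2 / (1 - t) + y ^+ 2 / t], cleared of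
   denominators. *)
have BD2 : a * b * d B D ^+ 2 <= (a + b) * (a * d B P ^+ 2 + b * d D P ^+ 2).
  have x0 := mdist_ge0 B P; have y0 := mdist_ge0 D P; have z0 := mdist_ge0 B D.
  have : d B D ^+ 2 <= (d B P + d D P) ^+ 2 by rewrite ler_sqr ?nnegrE ?addr_ge0.
  have ab0 : 0 <= a * b by rewrite mulr_ge0.
  move=> /(ler_wpM2l ab0); have := sqr_ge0 (a * d B P - b * d D P); lra.
have scale u v : (a + b) * ((1 - t) * u + t * v - t * (1 - t) * d A C ^+ 2) =
    b * u + a * v - a * (1 - t) * d A C ^+ 2.
  transitivity ((1 - t) * (a + b) * u + t * (a + b) * v -
    t * (a + b) * (1 - t) * d A C ^+ 2); first by ring.
  by rewrite tE t1E.
have ab0 : 0 <= a + b by rewrite addr_ge0.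
have h1 := ler_wpM2l AD0 (ler_wpM2l ab0 hB).
have h2 := ler_wpM2l BC0 (ler_wpM2l ab0 hD).
rewrite scale (metric_sym B A) in h1; rewrite scale (metric_sym D A) in h2.
rewrite (metric_sym D C) -/a -/b in h2; rewrite -/b in h1.
have e : (a + b) * (a * (1 - t) * d A C ^+ 2) = a * b * d A C ^+ 2.
  transitivity (a * ((1 - t) * (a + b)) * d A C ^+ 2); first by ring.
  by rewrite t1E.
have ab1 : 0 < a * b by rewrite mulr_gt0.
by rewrite -(ler_pM2l ab1); lra.
Qed.

Lemma cat0_midpoints A B C D : d w A <= r -> d w B <= r -> d w C <= r ->
  d w D <= r ->
  d (pt A D (1 / 2)) (pt B C (1 / 2)) ^+ 2 <=
    d A B ^+ 2 / 2 + d D C ^+ 2 / 2 - (d A D - d B C) ^+ 2 / 4.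
Proof.
move=> wA wB wC wD; have r0 : 0 <= r := le_trans (mdist_ge0 w A) wA.
have h01 : 0 <= (1 / 2 : R) <= 1 by lra.
have G := pt_geo01 A D; have H := pt_geo01 B C.
have wM : d w (pt B C (1 / 2)) <= 2 * r by apply: (btw_ball wB wC); exact: geo01_btw H h01.
have r2 x : d w x <= r -> d w x <= 2 * r by lra.
have := cat0_ball_sqr G h01 wM wA wD.
have := cat0_ball_sqr H h01 (r2 _ wA) wB wC.
have := cat0_ball_sqr H h01 (r2 _ wD) wB wC.
have := cat0_quadrilateral wA wB wC wD.
set M := pt B C _; set M' := pt A D _.
rewrite (metric_sym M M') (metric_sym M A) (metric_sym M D).
by rewrite (metric_sym D B) (metric_sym D C); lra.
Qed.

Lemma cat0_fellow (g h : R -> X) A B C D t : geo01 g A D -> geo01 h B C ->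
  0 <= t <= 1 -> d w A <= r -> d w B <= r -> d w C <= r -> d w D <= r ->
  d (g t) (h t) <= (1 - t) * d A B + t * d D C.
Proof.
move=> G H t01 wA wB wC wD; have r0 : 0 <= r := le_trans (mdist_ge0 w A) wA.
have F := pt_geo01 A C; set f := pt A C in F.
have wg := btw_ball wA wD (geo01_btw G t01).
have wf := btw_ball wA wC (geo01_btw F t01).
have wh := btw_ball wB wC (geo01_btw H t01).
have r2 x : d w x <= r -> d w x <= 2 * r by lra.
have gf : d (g t) (f t) <= t * d D C.
  by apply: (geo01_contraction G F t01);
    [apply: wr (geo01_btw G t01)|apply: wr (geo01_btw F t01)] => //; exact: r2.
have t01' : 0 <= 1 - t <= 1 by lra.
have F' := geo01_rev F; have H' := geo01_rev H.
have e : 1 - (1 - t) = t by ring.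
have fh : d (f t) (h t) <= (1 - t) * d A B.
  have bF := geo01_btw F' t01'; have bH := geo01_btw H' t01'.
  have := geo01_contraction F' H' t01'; rewrite e in bF bH *.
  by apply; [apply: wr bF|apply: wr bH] => //; exact: r2.
by have := metric_triangle (g t) (f t) (h t); lra.
Qed.

End euclidean_lemmas.

(** * Discrete geodesics *)

Section chains.
Variables (R : realType) (X : metricType R).
Hypothesis Xgeo : geodesic_space X.
Hypothesis Xcomplete : forall u : nat -> X, cauchy_seq u -> exists l, converges u l.
Implicit Types (u v w : nat -> X) (N i j n : nat) (l r : R).
Local Notation d := mdist.

Definition energy N u : R := \sum_(0 <= i < N) d (u i) (u i.+1) ^+ 2.

(** A local geodesic, known through equidistant points: each interior point is
    the midpoint of its neighbours. *)
Definition discrete_geodesic N l w : Prop :=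
  (forall i, (i < N)%N -> d (w i) (w i.+1) = l) /\
  (forall i, (i.+1 < N)%N -> d (w i) (w i.+2) = 2 * l).

Lemma energyS N u : energy N.+1 u = energy N u + d (u N) (u N.+1) ^+ 2.
Proof. by rewrite /energy big_nat_recr. Qed.

Lemma energy_discrete_geodesic N l w :
  discrete_geodesic N l w -> energy N w = N%:R * l ^+ 2.
Proof.
move=> [wl _]; rewrite /energy (eq_big_nat _ _ (F2 := fun=> l ^+ 2)).
  by rewrite sumr_const_nat subn0 mulr_natl.
by move=> i /andP[_ iN]; rewrite wl.
Qed.

(** Discrete geodesics minimize the energy strictly among the neighbouring
    chains with the same ends. Each quadrilateral [w i], [w (i + 1)],
    [u (i + 1)], [u i] bounds the edge of [u] by the two diagonals; the two
    diagonals that end at the same [u i] are bounded through the triangle with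
    base [w (i - 1)], [w (i + 1)] and midpoint [w i]. The displacement of the
    ends is paid by the last term. *)
Lemma energy_lower_bound N l r u w : (0 < N)%N -> discrete_geodesic N l w ->
  (forall i, (i <= N)%N -> cat0_ball (w i) (2 * r)) -> 2 * l <= r ->
  (forall i, (i <= N)%N -> d (u i) (w i) + l <= r) ->
  N%:R * l ^+ 2 + \sum_(0 <= i < N) (d (u i) (w i) - d (u i.+1) (w i.+1)) ^+ 2 <=
  energy N u + 2 * l * (d (u 0%N) (w 0%N) + d (u N) (w N)).
Proof.
move=> N0 [wl wl2] wr lr ur; pose rho i := d (u i) (w i).
have rho0 i : 0 <= rho i by exact: mdist_ge0.
have l0 : 0 <= l by rewrite -(wl 0%N)// mdist_ge0.
have r0 : 0 <= r by lra.
pose a i := d (w i) (u i.+1) ^+ 2; pose b i := d (w i.+1) (u i) ^+ 2.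
have edge i : (i < N)%N ->
    a i + b i - l ^+ 2 - 2 * rho i * rho i.+1 <= d (u i) (u i.+1) ^+ 2.
  move=> iN; have urS := ur i.+1 iN; have uri := ur i (ltnW iN).
  have h0 := rho0 i; have h1 := rho0 i.+1; have wli := wl i iN.
  have := @cat0_quadrilateral R X Xgeo (w i) r (wr i (ltnW iN))
    (w i) (w i.+1) (u i.+1) (u i).
  rewrite mdistxx wli; have -> : d (w i) (u i) = rho i by rewrite metric_sym.
  have -> : d (w i.+1) (u i.+1) = rho i.+1 by rewrite metric_sym.
  move=> /(_ r0) H; have {}H := H ltac:(lra).
  have wu : d (w i) (u i.+1) <= r.
    have := metric_triangle (w i) (w i.+1) (u i.+1).
    by rewrite wli (metric_sym (w i.+1)); lra.
  have {}H := H wu ltac:(rewrite /rho; lra).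
  by move: H; rewrite (metric_sym (u i.+1) (u i)) -/(a i) -/(b i); lra.
have apex i : (i.+1 < N)%N -> 2 * rho i.+1 ^+ 2 + 2 * l ^+ 2 <= a i + b i.+1.
  move=> iN; have urS := ur i.+1 (ltnW iN); have h1 := rho0 i.+1.
  have w1 := wl i (ltnW iN); have w2 := wl i.+1 iN.
  have B : btw (w i) (w i.+1) (w i.+2) by rewrite /btw wl2// w1 w2; ring.
  have [l00|l_gt0] := eqVneq l 0.
    rewrite l00 in w1 w2; rewrite /a /b /rho l00.
    rewrite (mdist_positivity _ _ w1) -(mdist_positivity _ _ w2).
    by rewrite (metric_sym (w i.+1)); lra.
  have l1 : 0 < l by rewrite lt_neqAle eq_sym l_gt0.
  have := wr i.+1 (ltnW iN) (u i.+1) (w i) (w i.+1) (w i.+2).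
  rewrite mdistxx w2 (metric_sym (w i.+1) (w i)) w1 (metric_sym _ (u i.+1)).
  have h2 : l <= 2 * r by lra.
  have h3 : d (u i.+1) (w i.+1) <= 2 * r by lra.
  have h4 : 0 <= 2 * r by lra.
  move=> /(_ h3 h2 h4 h2 B); rewrite /stewart0 w1 w2 -/(rho i.+1).
  rewrite (metric_sym _ (w i)) (metric_sym _ (w i.+2)) -/(a i) -/(b i.+1).
  by move=> h; rewrite -(ler_pM2l l1); lra.
have ends : l ^+ 2 - 2 * l * rho 0%N + rho 0%N ^+ 2 <= b 0%N.
  have := mdist_lipschitz (w 0%N) (w 1%N) (u 0%N).
  rewrite ler_norml wl// (metric_sym (w 0%N)) -/(rho 0%N) => /andP[h1 h2].
  by rewrite /b; set z := d _ _ in h1 h2 *; nra.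
have ends' : l ^+ 2 - 2 * l * rho N + rho N ^+ 2 <= a N.-1.
  have := mdist_lipschitz (w N) (w N.-1) (u N).
  have wN := wl N.-1; rewrite prednK// in wN.
  rewrite ler_norml (metric_sym (w N) (w N.-1)) wN// (metric_sym (w N) (u N)) -/(rho N).
  move=> /andP[h1 h2].
  by rewrite /a prednK//; set z := d _ _ in h1 h2 *; nra.
have main n : (n < N)%N ->
    n.+1%:R * l ^+ 2 + \sum_(0 <= i < n.+1) (rho i - rho i.+1) ^+ 2 <=
    energy n.+1 u + 2 * l * rho 0%N + l ^+ 2 + rho n.+1 ^+ 2 - a n.
  elim: n => [|n IH] nN.
    by have := edge 0%N nN; rewrite /energy !big_nat1; lra.
  have := IH (ltnW nN); rewrite (energyS n.+1) (big_nat_recr n.+1)//= -/(rho _).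
  have := edge n.+1 nN; have := apex n nN.
  rewrite -[in n.+2%:R]addn1 natrD; lra.
have := main N.-1; rewrite prednK// => /(_ (leqnn _)).
by rewrite -/(rho 0%N) -/(rho N); lra.
Qed.

Lemma sqr_sum_bound (x : nat -> R) n :
  (x n - x 0%N) ^+ 2 <= n%:R * \sum_(0 <= i < n) (x i - x i.+1) ^+ 2.
Proof.
elim: n => [|n IH]; first by rewrite subrr expr0n mul0r.
rewrite big_nat_recr//=; set S := \sum_(0 <= i < n) _ in IH *.
have S0 : 0 <= S by apply: sumr_ge0 => i _; exact: sqr_ge0.
have -> : x n.+1 - x 0%N = (x n - x 0%N) - (x n - x n.+1) by ring.
set y := x n - x 0%N in IH *; set e := x n - x n.+1.
have n0 : 0 <= n%:R :> R by [].
rewrite -[in n.+1%:R]addn1 natrD; have [nE|n1] := eqVneq (n%:R : R) 0.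
  have y0 : y = 0 by apply/eqP; rewrite -sqrf_eq0 eq_le sqr_ge0 andbT (le_trans IH)// nE mul0r.
  by rewrite y0 nE; nra.
have n2 : 0 < n%:R :> R by rewrite lt_neqAle eq_sym n1.
rewrite -(ler_pM2l n2); have := ler_wpM2l n0 IH; have := sqr_ge0 (y + n%:R * e).
have := mulr_ge0 n0 (mulr_ge0 n0 S0); nra.
Qed.

Lemma sqr_sum_bound_le (x : nat -> R) i N : (i <= N)%N ->
  (x i - x 0%N) ^+ 2 <= N%:R * \sum_(0 <= i < N) (x i - x i.+1) ^+ 2.
Proof.
move=> iN; apply: (le_trans (sqr_sum_bound x i)).
rewrite (big_cat_nat (leq0n i) iN) /=.
have s0 m k : 0 <= \sum_(m <= i < k) (x i - x i.+1) ^+ 2.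
  by apply: sumr_ge0 => j _; exact: sqr_ge0.
have : i%:R <= N%:R :> R by rewrite ler_nat.
by have := s0 0%N i; have := s0 i N; have : 0 <= N%:R :> R by []; nra.
Qed.

Lemma finite_uniform (P : nat -> nat -> Prop) N :
  (forall i, (i <= N)%N -> exists M, forall n, (M <= n)%N -> P i n) ->
  exists M, forall n, (M <= n)%N -> forall i, (i <= N)%N -> P i n.
Proof.
elim: N => [|N IH] H.
  have [M HM] := H 0%N (leqnn _); exists M => n Mn i.
  by rewrite leqn0 => /eqP ->; exact: HM.
have [M1 HM1] := IH (fun i iN => H i (leqW iN)); have [M2 HM2] := H N.+1 (leqnn _).
exists (maxn M1 M2) => n; rewrite geq_max => /andP[n1 n2] i.
by rewrite leq_eqVlt => /predU1P[->|]; [exact: HM2|exact: HM1].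
Qed.

(** Pointwise midpoints of two chains lower the energy, as in a uniformly convex
    space. *)
Lemma energy_midpoints N l r e w u v : discrete_geodesic N l w ->
  (forall i, (i <= N)%N -> cat0_ball (w i) (2 * r)) -> e + l <= r ->
  (forall i, (i <= N)%N -> d (u i) (w i) <= e) ->
  (forall i, (i <= N)%N -> d (v i) (w i) <= e) ->
  energy N (fun i => pt Xgeo (u i) (v i) (1 / 2)) <=
  energy N u / 2 + energy N v / 2 -
    (\sum_(0 <= i < N) (d (u i) (v i) - d (u i.+1) (v i.+1)) ^+ 2) / 4.
Proof.
move=> [wl _] wr elr ue ve; rewrite /energy !mulr_suml -big_split -sumrB /=.
apply: ler_sum_nat => i /andP[_ iN]; have l0 : 0 <= l by rewrite -(wl i iN) mdist_ge0.
have bnd (z : nat -> X) : (forall i, (i <= N)%N -> d (z i) (w i) <= e) ->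
    d (w i) (z i) <= r /\ d (w i) (z i.+1) <= r.
  move=> ze; have := ze i (ltnW iN); have := ze i.+1 iN.
  rewrite (metric_sym (w i) (z i)); have := metric_triangle (w i) (w i.+1) (z i.+1).
  by rewrite wl// (metric_sym (w i.+1)); split; lra.
have [u1 u2] := bnd u ue; have [v1 v2] := bnd v ve.
by apply: (cat0_midpoints Xgeo (wr i (ltnW iN))).
Qed.

Lemma exists_energy_minimizer N l r e w u : (0 < N)%N -> discrete_geodesic N l w -> 0 < e ->
  (forall i, (i <= N)%N -> cat0_ball (w i) (2 * r)) -> e + l <= r ->
  (forall i, (i <= N)%N -> d (u i) (w i) <= e) ->
  exists w', [/\ w' 0%N = u 0%N, w' N = u N,
    forall i, (i <= N)%N -> d (w' i) (w i) <= e &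
    forall v, v 0%N = u 0%N -> v N = u N ->
      (forall i, (i <= N)%N -> d (v i) (w i) <= e) -> energy N w' <= energy N v].
Proof.
move=> N0 wg e0 wr elr ue; have [wl wl2] := wg.
have l0 : 0 <= l by rewrite -(wl 0%N N0) mdist_ge0.
pose U v := [/\ v 0%N = u 0%N, v N = u N &
  forall i, (i <= N)%N -> d (v i) (w i) <= e].
have E0 v : 0 <= energy N v by apply: sumr_ge0 => i _; exact: sqr_ge0.
pose I := inf [set energy N v | v in U].
have Ilb v : U v -> I <= energy N v.
  by move=> Uv; apply: ge_inf; [exists 0 => _ [z _ <-]; exact: E0|exists v].
have hI : has_inf [set energy N v | v in U].
  by split; [exists (energy N u); exists u|exists 0 => _ [z _ <-]; exact: E0].
have minseq n : exists v, U v /\ energy N v < I + n.+1%:R^-1.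
  have n0 : 0 < n.+1%:R^-1 :> R by [].
  by have [_ [v Uv <-] vI] := inf_adherent n0 hI; exists v.
pose V n := projT1 (cid (minseq n)).
have UV n : U (V n) := (projT2 (cid (minseq n))).1.
have EV n : energy N (V n) < I + n.+1%:R^-1 := (projT2 (cid (minseq n))).2.
have Umid v v' : U v -> U v' -> U (fun i => pt Xgeo (v i) (v' i) (1 / 2)).
  move=> [v0 vN ve] [v0' vN' ve'].
  have h01 : 0 <= (1 / 2 : R) <= 1 by lra.
  have idp x : pt Xgeo x x (1 / 2) = x.
    apply: mdist_positivity; rewrite metric_sym (geo01_dist0 (pt_geo01 Xgeo x x) h01).
    by rewrite mdistxx mulr0.
  split; [by rewrite v0 v0' idp|by rewrite vN vN' idp|move=> i iN].
  have G := pt_geo01 Xgeo (v i) (v' i).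
  have := ve i iN; have := ve' i iN.
  rewrite (metric_sym (v i)) (metric_sym (v' i)) => he' he.
  have wm := btw_ball he he' (geo01_btw G h01).
  have st : stewart0 (w i) (v i) (pt Xgeo (v i) (v' i) (1 / 2)) (v' i).
    by apply: (wr i iN) (geo01_btw G h01); rewrite ?mdistxx; lra.
  have := stewart0_geo01 G h01 st; rewrite (metric_sym (w i) (pt _ _ _ _)).
  have := mdist_ge0 (w i) (v i); have := mdist_ge0 (w i) (v' i).
  have := sqr_ge0 (d (v i) (v' i)).
  set x := d (w i) (v i) in he *; set y := d (w i) (v' i) in he' *.
  set z := d _ (w i) => h1 h2 h3 h4; rewrite leNgt; apply/negP => ez.
  have : e ^+ 2 < z ^+ 2 by rewrite ltr_pXn2r// ?nnegrE ?mdist_ge0// ltW.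
  have : x ^+ 2 <= e ^+ 2 by rewrite lerXn2r// nnegrE ltW.
  have : y ^+ 2 <= e ^+ 2 by rewrite lerXn2r// nnegrE ltW.
  by lra.
have NR0 : 0 <= N%:R :> R by [].
have gap n m i : (i <= N)%N ->
    d (V n i) (V m i) ^+ 2 <= N%:R * (2 * (n.+1%:R^-1 + m.+1%:R^-1)).
  move=> iN; have [vn0 vnN vne] := UV n; have [vm0 vmN vme] := UV m.
  have := energy_midpoints wg wr elr vne vme.
  have := Ilb _ (Umid _ _ (UV n) (UV m)); have := EV n; have := EV m.
  have := sqr_sum_bound_le (fun i => d (V n i) (V m i)) iN.
  rewrite /= vn0 vm0 mdistxx subr0; set S := \sum_(_ <= _ < _) _.
  move=> h1 h2 h3 h4 h5; apply: (le_trans h1); rewrite ler_wpM2l//.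
  by move: h2 h3 {h1}; move: (n.+1%:R^-1) (m.+1%:R^-1) => x y; lra.
have lim_ex i : exists x, (i <= N)%N -> converges (fun n => V n i) x.
  have [iN|_] := boolP (i <= N)%N; last by exists (w 0%N).
  have [|x ux] := Xcomplete (u := fun n => V n i); last by exists x.
  move=> a a0; have a2 : 0 < a ^+ 2 / (4 * N%:R + 1).
    by rewrite divr_gt0 ?exprn_gt0// ltr_wpDl// mulr_ge0.
  have [M _ HM] := near_infty_natSinv_lt (PosNum a2).
  exists M => m n Mm Mn; have := gap m n i iN; have := HM m Mm; have := HM n Mn.
  rewrite /= !ltr_pdivlMr ?ltr_wpDl// ?mulr_ge0//.
  have : 0 <= n.+1%:R^-1 :> R by []; have : 0 <= m.+1%:R^-1 :> R by [].
  set x := n.+1%:R^-1; set y := m.+1%:R^-1 => x0 y0 h1 h2 h3.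
  rewrite ltNge; apply/negP => h4.
  have : a ^+ 2 <= d (V m i) (V n i) ^+ 2 by rewrite lerXn2r// ?nnegrE ?mdist_ge0// ltW.
  by nra.
pose w' i := projT1 (cid (lim_ex i)).
have w'lim i : (i <= N)%N -> converges (fun n => V n i) (w' i) :=
  projT2 (cid (lim_ex i)).
have lim_cst (x : X) : converges (fun=> x) x.
  by move=> a a0; exists 0%N => n _; rewrite mdistxx.
exists w'; split.
- apply: mdist_positivity; apply/eqP; rewrite eq_le mdist_ge0 andbT.
  apply: (converges_mdist (w'lim _ (leq0n N)) (lim_cst (u 0%N))).
  by exists 0%N => n _; have [-> _ _] := UV n; rewrite mdistxx.
- apply: mdist_positivity; apply/eqP; rewrite eq_le mdist_ge0 andbT.
  apply: (converges_mdist (w'lim _ (leqnn N)) (lim_cst (u N))).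
  by exists 0%N => n _; have [_ -> _] := UV n; rewrite mdistxx.
- move=> i iN; apply: (converges_mdist (w'lim _ iN) (lim_cst (w i))).
  by exists 0%N => n _; have [_ _] := UV n; apply.
move=> v v0 vN ve; apply: (@le_trans _ _ I); last exact: Ilb.
apply/ler_addgt0Pl => a a0.
pose D := l + 2 * e.
have D0 : 0 < D by rewrite /D; lra.
pose c := Num.min 1 (a / 2 / (N%:R * (4 * D + 4) + 1)).
have c0 : 0 < c.
  by rewrite lt_min ltr01 !divr_gt0// ltr_wpDl// mulr_ge0//; lra.
have cE : N%:R * (4 * c * D + 4 * c ^+ 2) <= a / 2.
  have c1 : c <= 1 by rewrite ge_min lexx.
  have : c <= a / 2 / (N%:R * (4 * D + 4) + 1) by rewrite ge_min lexx orbT.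
  have den : 0 < N%:R * (4 * D + 4) + 1 by rewrite ltr_wpDl// mulr_ge0//; lra.
  rewrite ler_pdivlMr// => h; apply: le_trans h.
  have : 4 * c * D + 4 * c ^+ 2 <= c * (4 * D + 4) by nra.
  by move=> /(ler_wpM2l NR0) h; apply: (le_trans h); nra.
have [M1 HM1] := finite_uniform (fun i iN => w'lim i iN c c0).
have a2 : 0 < a / 2 by lra.
have [M2 _ HM2] := near_infty_natSinv_lt (PosNum a2).
pose n := maxn M1 M2; have {}HM1 := HM1 n (leq_maxl _ _).
have na : n.+1%:R^-1 < a / 2 := HM2 n (leq_maxr _ _).
have [_ _ Vne] := UV n.
suff : energy N w' <= energy N (V n) + N%:R * (4 * c * D + 4 * c ^+ 2).
  by have := EV n; move: na; move: (n.+1%:R^-1) => x; lra.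
rewrite mulr_natl -[X in _ + _ *+ X](subn0 N) -sumr_const_nat -big_split /=.
apply: ler_sum_nat => i /andP[_ iN].
have h1 := HM1 i (ltnW iN); have h2 := HM1 i.+1 iN.
have h3 := metric_triangle (w' i) (V n i) (w' i.+1).
have h4 := metric_triangle (V n i) (V n i.+1) (w' i.+1).
have h5 := metric_triangle (V n i) (w i) (V n i.+1).
have h6 := metric_triangle (w i) (w i.+1) (V n i.+1).
have h7 := Vne i (ltnW iN); have h8 := Vne i.+1 iN.
rewrite wl// (metric_sym (w i.+1)) in h6.
rewrite (metric_sym (w' i) (V n i)) in h3.
have : d (w' i) (w' i.+1) <= d (V n i) (V n i.+1) + 2 * c by lra.
have : d (V n i) (V n i.+1) <= D by rewrite /D; lra.
have := mdist_ge0 (w' i) (w' i.+1); have := mdist_ge0 (V n i) (V n i.+1).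
set x := d (V n i) _; set y := d (w' i) _ => x0 y0 xD yx.
by nra.
Qed.

Lemma energy_update N i u m : (i.+1 < N)%N ->
  energy N (fun j => if j == i.+1 then m else u j) =
  energy N u - d (u i) (u i.+1) ^+ 2 - d (u i.+1) (u i.+2) ^+ 2 +
    d (u i) m ^+ 2 + d m (u i.+2) ^+ 2.
Proof.
move=> iN; rewrite /energy.
rewrite !(@big_cat_nat _ _ _ i.+2 0%N N)//= !(big_nat_recr i.+1)// !(big_nat_recr i)//=.
rewrite eqxx (ltn_eqF (ltnSn i)) (gtn_eqF (ltnSn i.+1)).
rewrite [in LHS](eq_big_nat _ _ (F2 := fun j => d (u j) (u j.+1) ^+ 2)); last first.
  move=> j /andP[_ ji]; rewrite !ltn_eqF// ltnW//.
rewrite [X in _ + X = _](eq_big_nat _ _ (F2 := fun j => d (u j) (u j.+1) ^+ 2)).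
  ring.
by move=> j /andP[ij _]; rewrite !gtn_eqF// ltnW.
Qed.

(** Solves the Dirichlet problem near a given discrete geodesic [w]: a chain [u]
    with the required ends and almost the energy of [w] forces the minimizer
    into the interior of the region where energies are compared, and an
    interior minimizer is a discrete geodesic. *)
Lemma exists_discrete_geodesic N l e s eta w u : (0 < N)%N ->
  discrete_geodesic N l w -> 0 < e ->
  (forall i, (i <= N)%N -> cat0_ball (w i) (2 * (2 * e))) -> 8 * l <= e ->
  (forall i, (i <= N)%N -> d (u i) (w i) <= e) ->
  d (u 0%N) (w 0%N) <= s -> d (u N) (w N) <= s -> s <= e / 8 ->
  energy N u <= N%:R * l ^+ 2 + eta ->
  N%:R * (eta + 4 * l * s) <= (e / 8) ^+ 2 ->
  exists w' l', [/\ discrete_geodesic N l' w', w' 0%N = u 0%N, w' N = u N,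
    forall i, (i <= N)%N -> d (w' i) (w i) <= e / 4 &
    N%:R * l' ^+ 2 <= energy N u].
Proof.
move=> N0 wg e0 wr le ue u0 uN se ueta Neta.
have [wl wl2] := wg; have l0 : 0 <= l by rewrite -(wl 0%N N0) mdist_ge0.
have [|w' [w'0 w'N w'e w'min]] := exists_energy_minimizer N0 wg e0 wr _ ue; first lra.
have Eu := w'min u erefl erefl ue.
have close i : (i <= N)%N -> d (w' i) (w i) <= e / 4.
  move=> iN; have l2 : 2 * l <= 2 * e by lra.
  have w'l j : (j <= N)%N -> d (w' j) (w j) + l <= 2 * e.
    by move=> jN; have := w'e j jN; lra.
  have LB := energy_lower_bound N0 wg wr l2 w'l.
  have := sqr_sum_bound_le (fun i => d (w' i) (w i)) iN.
  rewrite /= w'0; rewrite w'0 w'N in LB.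
  set S := \sum_(_ <= _ < _) _ in LB * => h.
  have NR0 : 0 <= N%:R :> R by [].
  have SE : S <= eta + 4 * l * s.
    have : l * (d (u 0%N) (w 0%N) + d (u N) (w N)) <= l * (2 * s).
      by rewrite ler_wpM2l//; lra.
    by lra.
  have {h} : (d (w' i) (w i) - d (u 0%N) (w 0%N)) ^+ 2 <= (e / 8) ^+ 2.
    by apply: (le_trans h); apply: le_trans Neta; rewrite ler_wpM2l.
  move=> h; have : d (w' i) (w i) - d (u 0%N) (w 0%N) <= e / 8; last by lra.
  rewrite leNgt; apply/negP => h1; move: h; rewrite leNgt => /negP; apply.
  by rewrite ltr_pXn2r// nnegrE; lra.
have mid i : (i.+1 < N)%N ->
    d (w' i) (w' i.+1) = d (w' i.+1) (w' i.+2) /\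
    d (w' i) (w' i.+2) = 2 * d (w' i) (w' i.+1).
  move=> iN; set m := pt Xgeo (w' i) (w' i.+2) (1 / 2).
  have h01 : 0 <= (1 / 2 : R) <= 1 by lra.
  have G := pt_geo01 Xgeo (w' i) (w' i.+2).
  have am := geo01_dist0 G h01; have mb := geo01_dist1 G h01.
  rewrite -/m in am mb.
  have c0 := close i (ltnW (ltnW iN)); have c1 := close i.+1 (ltnW iN).
  have c2 := close i.+2 iN.
  have t1 := metric_triangle (w' i) (w' i.+1) (w' i.+2).
  have t2 := metric_triangle (w' i) (w i) (w' i.+1).
  have t3 := metric_triangle (w i) (w i.+1) (w' i.+1).
  have t4 := metric_triangle (w' i.+1) (w i.+1) (w' i.+2).
  have t5 := metric_triangle (w i.+1) (w i.+2) (w' i.+2).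
  have t6 := metric_triangle m (w' i) (w i.+1).
  have t7 := metric_triangle (w' i) (w i) (w i.+1).
  rewrite !(metric_sym (w _) (w' _)) !wl ?(ltnW iN)// (metric_sym m (w' i)) in t2 t3 t4 t5 t6 t7.
  have := w'min (fun j => if j == i.+1 then m else w' j).
  have -> : (0%N == i.+1) = false by [].
  have -> : (N == i.+1) = false by rewrite gtn_eqF.
  move=> /(_ w'0 w'N); rewrite energy_update// am mb => H.
  have {}H : d (w' i) (w' i.+1) ^+ 2 + d (w' i.+1) (w' i.+2) ^+ 2 <=
      d (w' i) (w' i.+2) ^+ 2 / 2.
    suff : forall j, (j <= N)%N -> d (if j == i.+1 then m else w' j) (w j) <= e.
      by move=> /H; lra.
    move=> j jN; case: eqP => [->|_]; last exact: w'e.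
    lra.
  move: H t1; set x := d (w' i) (w' i.+1); set y := d (w' i.+1) _.
  set z := d (w' i) (w' i.+2) => H t1.
  have x0 : 0 <= x by exact: mdist_ge0.
  have y0 : 0 <= y by exact: mdist_ge0.
  have z0 : 0 <= z by exact: mdist_ge0.
  have zz : z ^+ 2 <= (x + y) ^+ 2 by rewrite lerXn2r// nnegrE addr_ge0.
  have xy : (x - y) ^+ 2 = 0 by apply/eqP; rewrite eq_le sqr_ge0 andbT; lra.
  have {}xy : x = y by apply/eqP; rewrite -subr_eq0 -sqrf_eq0 xy.
  split=> //; rewrite -xy in H t1 *.
  have : (2 * x) ^+ 2 <= z ^+ 2 by lra.
  by rewrite ler_sqr ?nnegrE ?mulr_ge0//; lra.
have eq_edge i : (i < N)%N -> d (w' i) (w' i.+1) = d (w' 0%N) (w' 1%N).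
  elim: i => // i IH iN; have [<- _] := mid i iN; exact/IH/ltnW.
have w'g : discrete_geodesic N (d (w' 0%N) (w' 1%N)) w'.
  split=> // i iN; have [_ ->] := mid i iN.
  by rewrite eq_edge// ltnW.
exists w', (d (w' 0%N) (w' 1%N)); split=> //.
by rewrite -(energy_discrete_geodesic w'g).
Qed.

End chains.

(** * Local geodesics that avoid the convex set *)

(** The Euclidean consequences of the hypotheses suffice for the uniqueness of
    local geodesics: at small scales, where uniqueness is decided, the curvature
    of the model surface is invisible. *)
Record relative_cat0 (R : realType) (X : metricType R) (Delta : set X)
    (lambda : R) : Prop := RelativeCat0 {
  rc_geodesic : geodesic_space X;
  rc_complete : forall u : nat -> X, cauchy_seq u -> exists l, converges u l;
  rc_nonempty : exists c, Delta c;
  rc_closed : forall x, ~ Delta x -> exists2 r, 0 < r & far Delta r x;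
  rc_convex : forall x m y, Delta x -> Delta y -> btw x m y -> Delta m;
  rc_vertex : forall x p m q, btw p m q -> Delta x \/ Delta p \/ Delta q ->
    stewart0 x p m q;
  rc_lambda : 0 < lambda;
  rc_ball : forall w r, 0 < r -> far Delta r w -> cat0_ball w (lambda * r)
}.

Section convex_set.
Variables (R : realType) (X : metricType R) (Delta : set X) (lambda : R).
Hypothesis rc : relative_cat0 Delta lambda.
Let Xgeo := rc_geodesic rc.
Let Xcomplete := rc_complete rc.
Let Delta_nonempty := rc_nonempty rc.
Let Delta_closed := rc_closed rc.
Let Delta_convex := rc_convex rc.
Let Delta_stewart0 := rc_vertex rc.
Implicit Types (x y z p q m c v : X) (s t r : R).
Local Notation d := mdist.
Local Notation pt := (pt Xgeo).

Lemma contraction_le c x y t : Delta c -> 0 <= t <= 1 ->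
  d (pt c x t) (pt c y t) <= t * d x y.
Proof.
move=> Dc t01; have G := pt_geo01 Xgeo c x; have H := pt_geo01 Xgeo c y.
by apply: (geo01_contraction G H t01); apply: Delta_stewart0;
  [exact: geo01_btw G t01|auto|exact: geo01_btw H t01|auto].
Qed.

Lemma unique_geodesic_from c m m' x : Delta c -> btw c m x -> btw c m' x ->
  d c m = d c m' -> m = m'.
Proof.
move=> Dc B B' e; have mx : d m' x = d m x by move: B B'; rewrite /btw e; lra.
have := Delta_stewart0 (x := m) B' (or_intror (or_introl Dc)).
rewrite /stewart0 mx -e (metric_sym m c) => st.
have a0 := mdist_ge0 c m; have b0 := mdist_ge0 m x.
have [ab|ab] := eqVneq (d c m + d m x) 0.
  have c1 : d c m = 0 by lra.
  by rewrite -(mdist_positivity _ _ c1); rewrite e in c1; exact: mdist_positivity.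
have ab0 : 0 < d c m + d m x by rewrite lt_neqAle eq_sym ab addr_ge0.
apply: mdist_positivity; apply/eqP; rewrite -sqrf_eq0 eq_le sqr_ge0 andbT.
by rewrite -(ler_pM2l ab0) mulr0; lra.
Qed.

Lemma pt_pt c x s t : Delta c -> 0 <= s <= 1 -> 0 <= t <= 1 ->
  pt c (pt c x t) s = pt c x (s * t).
Proof.
move=> Dc s01 t01; have st01 : 0 <= s * t <= 1 by nra.
have G := pt_geo01 Xgeo c x; have H := pt_geo01 Xgeo c (pt c x t).
have e : d c (pt c (pt c x t) s) = s * t * d c x.
  by rewrite (geo01_dist0 H s01) (geo01_dist0 G t01) mulrA.
apply: (unique_geodesic_from (x := x) Dc); last by rewrite e (geo01_dist0 G st01).
  apply/eqP; rewrite eq_le metric_triangle andbT e.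
  have := metric_triangle (pt c (pt c x t) s) (pt c x t) x.
  rewrite (geo01_dist1 H s01) (geo01_dist0 G t01) (geo01_dist1 G t01).
  by lra.
exact: (geo01_btw G st01).
Qed.

Lemma pt0 c x : pt c x 0 = c.
Proof. by have [] := pt_geo01 Xgeo c x. Qed.

Lemma pt1 c x : pt c x 1 = x.
Proof. by have [] := pt_geo01 Xgeo c x. Qed.

(** A point of [Delta] where the sum of the distances to [z] and [p] is least.
    Along a minimizing sequence with convergent distances to [z], midpoints
    would do better unless the sequence is a Cauchy sequence. *)
Lemma exists_nearest_detour z p : exists2 c, Delta c &
  forall v, Delta v -> d z c + d c p <= d z v + d v p.
Proof.
pose F v := d z v + d v p; pose I := inf [set F v | v in Delta].
have F0 v : 0 <= F v by rewrite addr_ge0// mdist_ge0.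
have Ilb v : Delta v -> I <= F v.
  by move=> Dv; apply: ge_inf; [exists 0 => _ [u _ <-]; exact: F0|exists v].
have hI : has_inf [set F v | v in Delta].
  have [c Dc] := Delta_nonempty.
  by split; [exists (F c); exists c|exists 0 => _ [v _ <-]; exact: F0].
pose S n := [set v | Delta v /\ F v < I + n.+1%:R^-1].
have S0 n : exists v, S n v.
  have n0 : 0 < n.+1%:R^-1 :> R by [].
  by have [_ [v Dv <-] vI] := inf_adherent n0 hI; exists v.
pose A n := inf [set d z v | v in S n].
have Alb n v : S n v -> A n <= d z v.
  by move=> Sv; apply: ge_inf; [exists 0 => _ [u _ <-]; exact: mdist_ge0|exists v].
have hA n : has_inf [set d z v | v in S n].
  have [v Sv] := S0 n.
  by split; [exists (d z v); exists v|exists 0 => _ [u _ <-]; exact: mdist_ge0].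
have Smono (m n : nat) v : (m <= n)%N -> S n v -> S m v.
  move=> mn [Dv Fv]; split=> //; apply: (lt_le_trans Fv); rewrite lerD2l.
  by rewrite lef_pV2 ?posrE// ler_nat.
have Amono (m n : nat) : (m <= n)%N -> A m <= A n.
  move=> mn; apply: lb_le_inf; first by have [] := hA n.
  by move=> _ [v Sv <-]; apply/Alb/(Smono _ _ _ mn).
have seq n : exists v, S n v /\ d z v < A n + n.+1%:R^-1.
  have n0 : 0 < n.+1%:R^-1 :> R by [].
  by have [_ [v Sv <-] vA] := inf_adherent n0 (hA n); exists v.
pose u n := projT1 (cid (seq n)).
have Su n : S n (u n) := (projT2 (cid (seq n))).1.
have Au n : d z (u n) < A n + n.+1%:R^-1 := (projT2 (cid (seq n))).2.
have Abnd n : A n <= I + 1.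
  apply: (le_trans (Alb n _ (Su n))); have [_ Fv] := Su n.
  have : n.+1%:R^-1 <= 1 :> R by rewrite invf_le1 ?ler1n.
  have := mdist_ge0 (u n) p; rewrite /F in Fv.
  by move: Fv; move: (n.+1%:R^-1) => k; lra.
pose a := sup (range A).
have hS : has_sup (range A).
  by split; [exists (A 0%N); exists 0%N|exists (I + 1) => _ [n _ <-]; exact: Abnd].
have Aa n : A n <= a by apply: sup_upper_bound => //; exists n.
have I0 : 0 <= I.
  by apply: lb_le_inf; [have [] := hI|move=> _ [v _ <-]; exact: F0].
have uc : cauchy_seq u.
  move=> e e0; pose k := e ^+ 2 / (64 * (I + 3)).
  have k0 : 0 < k by rewrite divr_gt0 ?exprn_gt0// mulr_gt0//; lra.
  have kE : k * (64 * (I + 3)) = e ^+ 2 by rewrite divfK// gt_eqF// mulr_gt0//; lra.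
  pose k' := Num.min 1 (k / 2).
  have k'0 : 0 < k' by rewrite lt_min ltr01 divr_gt0.
  have [k'1 k'k] : k' <= 1 /\ k' <= k / 2 by rewrite !ge_min !lexx orbT.
  have [_ [N1 _ <-] aN1] := sup_adherent k'0 hS; rewrite -/a in aN1.
  have [N2 _ HN2] := near_infty_natSinv_lt (PosNum k'0).
  exists (maxn N1 N2) => m n; rewrite !geq_max => /andP[m1 m2] /andP[n1 n2].
  have bnd j : (N1 <= j)%N -> (N2 <= j)%N ->
      [/\ a - k' < d z (u j), d z (u j) < a + k' & F (u j) < I + k'].
    move=> j1 j2; have hj : j.+1%:R^-1 < k' := HN2 j j2.
    have := Alb j _ (Su j); have := Au j; have := Amono _ _ j1; have := Aa j.
    have [_] := Su j; move: hj; move: (j.+1%:R^-1) => q.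
    by split; lra.
  have [x1 x2 xF] := bnd m m1 m2; have [y1 y2 yF] := bnd n n1 n2.
  have [Dm _] := Su m; have [Dn _] := Su n.
  have h01 : 0 <= (1 / 2 : R) <= 1 by lra.
  have G := pt_geo01 Xgeo (u m) (u n); have B := geo01_btw G h01.
  have Dw := Delta_convex Dm Dn B.
  have := stewart0_geo01 G h01 (Delta_stewart0 (x := z) B (or_intror (or_introl Dm))).
  have := stewart0_geo01 G h01 (Delta_stewart0 (x := p) B (or_intror (or_introl Dm))).
  have := Ilb _ Dw; have := Ilb _ Dm; have := Ilb _ Dn.
  rewrite /F in xF yF *; set w := pt _ _ _.
  rewrite !(metric_sym p); move: x1 x2 y1 y2 xF yF.
  have := mdist_ge0 z w; have := mdist_ge0 w p.
  have := mdist_ge0 z (u m); have := mdist_ge0 z (u n).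
  have := mdist_ge0 (u m) p; have := mdist_ge0 (u n) p; have := mdist_ge0 (u m) (u n).
  set D := d (u m) (u n); set x := d z (u m); set y := d z (u n).
  set x' := d (u m) p; set y' := d (u n) p; set wz := d z w; set wp := d w p.
  move=> D0 y'0 x'0 y0 x0 wp0 wz0 x1 x2 y1 y2 xF yF yI xI wI Hp Hz.
  pose U := a + k'; pose V := I + 2 * k' - a.
  have U0 : 0 <= U by rewrite /U; lra.
  have V0 : 0 <= V by rewrite /V; lra.
  have Ua : U <= I + 3 by rewrite /U; lra.
  have xU : x ^+ 2 <= U ^+ 2 by rewrite lerXn2r ?nnegrE// /U; lra.
  have yU : y ^+ 2 <= U ^+ 2 by rewrite lerXn2r ?nnegrE// /U; lra.
  have x'V : x' ^+ 2 <= V ^+ 2 by rewrite lerXn2r ?nnegrE// /V; lra.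
  have y'V : y' ^+ 2 <= V ^+ 2 by rewrite lerXn2r ?nnegrE// /V; lra.
  have wpV : wp <= V by rewrite -ler_sqr ?nnegrE//; have := sqr_ge0 D; lra.
  have wzU : 8 * U * wz <= 8 * U ^+ 2 - D ^+ 2 by have := sqr_ge0 (U - wz); lra.
  have : U * I <= U * (wz + V) by rewrite ler_wpM2l//; lra.
  have UV : U + V = I + 3 * k' by rewrite /U /V; ring.
  have UVE : U * (U + V) = U * I + 3 * (U * k') by rewrite UV; ring.
  have Uk : U * k' <= (I + 3) * (k / 2).
    by apply: ler_pM => //; exact: ltW.
  move=> h; have D2 : D ^+ 2 < e ^+ 2.
    rewrite -kE; have : 0 < k * I + k by rewrite ltr_wpDl// mulr_ge0// ltW.
    by lra.
  by rewrite ltNge; apply/negP => eD; move: D2; rewrite ltNge lerXn2r// nnegrE ltW.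
have [c uc'] := Xcomplete uc.
have Dc : Delta c.
  apply: contrapT => nDc; have [r r0 rfar] := Delta_closed nDc.
  have [N HN] := uc' r r0; have := rfar (u N) (Su N).1.
  by rewrite metric_sym leNgt HN.
exists c => // v Dv; apply: le_trans (Ilb v Dv); apply/ler_addgt0Pl => e e0.
have e3 : 0 < e / 3 by rewrite divr_gt0.
have [N HN] := uc' _ e3; have [N2 _ HN2] := near_infty_natSinv_lt (PosNum e3).
pose n := maxn N N2; have := HN n (leq_maxl _ _).
have n3 : n.+1%:R^-1 < e / 3 := HN2 n (leq_maxr _ _).
have [_] := Su n; rewrite /F; move: n3; move: (n.+1%:R^-1) => q.
have := metric_triangle z (u n) c; have := metric_triangle c (u n) p.
by rewrite (metric_sym c (u n)); lra.
Qed.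

(** The scale [e] is the same for all parameters, as it can be chosen on a compact
    interval; this allows subdivisions into equal steps. *)
Definition local_geo (L e : R) (g : R -> X) : Prop :=
  0 < e /\ forall s t, 0 <= s <= 1 -> 0 <= t <= 1 -> `|s - t| <= e ->
    d (g s) (g t) = L * `|s - t|.

Lemma local_geo_speed_ge0 L e g : local_geo L e g -> 0 <= L.
Proof.
move=> [e0 ge]; pose h := Num.min e 1.
have h0 : 0 < h by rewrite lt_min e0 ltr01.
have [he h1] : h <= e /\ h <= 1 by rewrite !ge_min !lexx orbT.
have := ge 0 h; rewrite sub0r normrN gtr0_norm// => /(_ _ _ he).
rewrite lexx ler01 (ltW h0) h1 => /(_ isT isT) E.
by rewrite -(pmulr_lge0 _ h0) -E mdist_ge0.
Qed.

Lemma local_geo_lipschitz L e g s t : local_geo L e g -> 0 <= s <= 1 ->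
  0 <= t <= 1 -> d (g s) (g t) <= L * `|s - t|.
Proof.
move=> G; have [e0 ge] := G; have L0 := local_geo_speed_ge0 G.
have main n : forall s t, 0 <= s -> s <= t -> t <= 1 -> t - s <= n%:R * e ->
    d (g s) (g t) <= L * (t - s).
  elim: n => [|n IH] {}s {}t s0 st t1 ts.
    have -> : s = t by rewrite mul0r in ts; lra.
    by rewrite mdistxx subrr mulr0.
  pose u := Num.max s (t - e).
  have [su ut te] : [/\ s <= u, u <= t & t - u <= e].
    have te : t - e <= u by rewrite le_max lexx orbT.
    by rewrite {1 2}/u le_max lexx ge_max st /=; split=> //; lra.
  have us : u - s <= n%:R * e.
    rewrite /u lerBlDr ge_max; apply/andP; split.
      by rewrite lerDr mulr_ge0// ltW.
    by move: ts; rewrite -[in n.+1%:R]addn1 natrD mulrDl; lra.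
  have := IH s u s0 su (le_trans ut t1) us.
  have := ge u t; rewrite distrC ger0_norm ?subr_ge0// => /(_ _ _ te) E.
  have := metric_triangle (g s) (g u) (g t); rewrite E; [|lra..].
  by lra.
move=> /andP[s0 s1] /andP[t0 t1].
have [n Hn] : exists n : nat, e^-1 <= n%:R.
  have [n _ Hn] := near_infty_natSinv_lt (PosNum e0).
  have /ltW Hn' : n.+1%:R^-1 < e := Hn n (leqnn n).
  by exists n.+1; rewrite -[leRHS]invrK lef_pV2 ?posrE ?invr_gt0.
have ne : 1 <= n%:R * e by rewrite -ler_pdivrMr// mul1r.
have [st|ts] := leP s t.
  by rewrite distrC ger0_norm ?subr_ge0//; apply: (main n) => //; lra.
by rewrite metric_sym ger0_norm ?subr_ge0 ?(ltW ts)//; apply: (main n) => //; lra.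
Qed.

(** Comparison with the vertex [c] holds along short pieces, which are geodesics,
    and the maximum principle extends it to the whole path. *)
Lemma local_geo_stewart0 L e g c t : local_geo L e g -> Delta c -> 0 <= t <= 1 ->
  d c (g t) ^+ 2 <= (1 - t) * d c (g 0) ^+ 2 + t * d c (g 1) ^+ 2 -
    t * (1 - t) * L ^+ 2.
Proof.
move=> G Dc t01; have [e0 ge] := G; have L0 := local_geo_speed_ge0 G.
have [L00|L1] := eqVneq L 0.
  have e1 s : 0 <= s <= 1 -> g s = g 0.
    move=> s01; apply/mdist_positivity/eqP; rewrite eq_le mdist_ge0 andbT.
    have z01 : 0 <= (0 : R) <= 1 by rewrite lexx ler01.
    by have := local_geo_lipschitz G s01 z01; rewrite L00 mul0r.
  by rewrite (e1 t)// (e1 1) ?L00; lra.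
have Lp : 0 < L by rewrite lt_neqAle eq_sym L1.
pose f s := md 0 (d c (g (s / L))).
have fc : {within `[0, L], continuous f}.
  have dc : {within `[0, L], continuous (fun s => d c (g (s / L)))}.
    apply: (@lipschitz_within_continuous _ _ _ 1) => // s u sL uL.
    apply: (le_trans (mdist_lipschitz _ _ _)).
    have dv (v : R) : 0 <= v <= L -> 0 <= v / L <= 1.
      by move=> /andP[v0 vL]; rewrite divr_ge0 ?(ltW Lp)// ler_pdivrMr// mul1r.
    apply: (le_trans (local_geo_lipschitz G (dv _ sL) (dv _ uL))).
    by rewrite -mulrBl normrM [`|L^-1|]gtr0_norm ?invr_gt0// mulrCA divff// mulr1 mul1r.
  by move=> x; apply: (cvg_comp _ _ (dc x)); exact: md_continuous.
have := fun kink => @stewart_maximum_principle R 0 (lexx (0 : R)) f L Lp fc kink (t * L).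
rewrite /stewart_defect /f !md_flat !sn_flat mulfK// mul0r divff//.
move=> H; suff H2 : L * (d c (g t) ^+ 2 / 2) + (t * L * ((L - t * L) ^+ 2 / 2) +
    (L - t * L) * ((t * L) ^+ 2 / 2)) <= (L - t * L) * (d c (g 0) ^+ 2 / 2) +
    t * L * (d c (g 1) ^+ 2 / 2).
  by rewrite -(ler_pM2l Lp); lra.
apply: H; last first.
  by case/andP: t01 => t0 t1; rewrite mulr_ge0 ?(ltW Lp)// ger_pMl.
move=> s /andP[s0 sL]; exists (Num.min (e * L / 2) (Num.min s (L - s))).
  by rewrite !lt_min s0 subr_gt0 sL !divr_gt0// mulr_gt0.
move=> h /andP[h0]; rewrite !lt_min => /and3P[he hs hL].
rewrite !md_flat cs_flat; set a := (s - h) / L; set b := s / L; set k := (s + h) / L.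
have [a01 b01 k01] : [/\ 0 <= a <= 1, 0 <= b <= 1 & 0 <= k <= 1].
  by split; rewrite ler_pdivrMr// mul1r divr_ge0 ?(ltW Lp)//=; lra.
have hL0 : 0 < h / L by rewrite divr_gt0.
have heL : 2 * (h / L) <= e.
  by rewrite mulrA ler_pdivrMr//; lra.
have Lh : L * (h / L) = h by rewrite mulrC divfK.
have ab : d (g a) (g b) = h.
  have E : `|a - b| = h / L.
    by rewrite /a /b -mulrBl addrAC subrr add0r mulNr normrN gtr0_norm.
  by rewrite ge// E ?Lh//; lra.
have bk : d (g b) (g k) = h.
  have E : `|b - k| = h / L.
    by rewrite /k /b -mulrBl opprD addNKr mulNr normrN gtr0_norm.
  by rewrite ge// E ?Lh//; lra.
have ak : d (g a) (g k) = 2 * h.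
  have E : `|a - k| = 2 * (h / L).
    rewrite /k /a -mulrBl [X in X / L](_ : _ = - (2 * h)); last by ring.
    by rewrite mulNr normrN gtr0_norm -?mulrA// mulr_gt0.
  by rewrite ge// E // mulrCA Lh.
have B : btw (g a) (g b) (g k) by rewrite /btw ab bk ak; ring.
have := Delta_stewart0 B (or_introl Dc); rewrite /stewart0 ab bk => st.
by rewrite -(ler_pM2l h0); lra.
Qed.

(** A local geodesic that avoids [Delta] is shorter than every detour through
    [Delta]: by the previous lemma a longer one would come closer to [c] than
    distance zero. *)
Lemma local_geo_lt_detour L e g c : local_geo L e g ->
  (forall t, 0 <= t <= 1 -> ~ Delta (g t)) -> Delta c ->
  L < d (g 0) c + d c (g 1).
Proof.
move=> G nD Dc.
have pos t : 0 <= t <= 1 -> 0 < d c (g t).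
  by move=> t01; rewrite mdist_gt0; apply/eqP => ct; apply: (nD t t01); rewrite -ct.
have a0 := pos 0 ltac:(lra); have b0 := pos 1 ltac:(lra).
rewrite (metric_sym (g 0)); set a := d c (g 0) in a0 *; set b := d c (g 1) in b0 *.
pose t := a / (a + b); have ab0 : 0 < a + b by rewrite addr_gt0.
have tE : t * (a + b) = a by rewrite divfK ?gt_eqF.
have t01 : 0 <= t <= 1 by rewrite divr_ge0 ?ler_pdivrMr// ?mul1r ?lerDl; lra.
have := local_geo_stewart0 G Dc t01; have := pos t t01; rewrite -/a -/b.
have := local_geo_speed_ge0 G; set f := d c (g t) => L0 f0 st.
have f2 : 0 < f ^+ 2 by rewrite exprn_gt0.
rewrite ltNge; apply/negP => Lab.
have L2 : (a + b) ^+ 2 <= L ^+ 2 by rewrite lerXn2r ?nnegrE// ltW.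
have t1t : 0 <= t * (1 - t) by apply: mulr_ge0; lra.
have := ler_wpM2l t1t L2.
have -> : t * (1 - t) * (a + b) ^+ 2 = a * b.
  transitivity (t * (a + b) * ((a + b) - t * (a + b))); first by ring.
  by rewrite tE; ring.
have : (a + b) * ((1 - t) * a ^+ 2 + t * b ^+ 2) = (a + b) * (a * b).
  transitivity (((a + b) - t * (a + b)) * a ^+ 2 + t * (a + b) * b ^+ 2); first by ring.
  by rewrite tE; ring.
move=> /(mulfI (lt0r_neq0 ab0)); lra.
Qed.

End convex_set.

Section chain_paths.
Variables (R : realType) (X : metricType R).
Hypothesis Xgeo : geodesic_space X.
Implicit Types (w : nat -> X) (N i j : nat) (l s t : R).
Local Notation d := mdist.
Local Notation pt := (pt Xgeo).

Definition chain_path N w t : X :=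
  let i := Num.truncn (t * N%:R) in pt (w i) (w i.+1) (t * N%:R - i%:R).

Variant chain_path_spec N w t : X -> Prop :=
| ChainPathIn i (tau : R) of (i < N)%N & 0 <= tau < 1 & t * N%:R = i%:R + tau :
    chain_path_spec N w t (pt (w i) (w i.+1) tau)
| ChainPathEnd of t = 1 : chain_path_spec N w t (w N).

Lemma chain_pathP N w t : (0 < N)%N -> 0 <= t <= 1 ->
  chain_path_spec N w t (chain_path N w t).
Proof.
move=> N0 /andP[t0 t1]; have NR : 0 < N%:R :> R by rewrite ltr0n.
have tN0 : 0 <= t * N%:R by rewrite mulr_ge0// ltW.
have /andP[h1 h2] := truncn_itv tN0; rewrite /chain_path.
set i := Num.truncn _ in h1 h2 *.
have [iN|Ni] := ltnP i N.
  apply: ChainPathIn => //; last by ring.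
  by rewrite subr_ge0 h1/=; move: h2; rewrite -[in i.+1%:R]addn1 natrD; lra.
have tE : t = 1.
  apply/eqP; rewrite eq_le t1 /= -(ler_pM2r NR) mul1r (le_trans _ h1)//.
  by rewrite ler_nat.
have -> : t * N%:R - i%:R = 0.
  have : N%:R <= i%:R :> R by rewrite ler_nat.
  by move: h1; rewrite tE mul1r; lra.
have -> : pt (w i) (w i.+1) 0 = w i by have [] := pt_geo01 Xgeo (w i) (w i.+1).
have -> : i = N.
  by apply/eqP; rewrite eqn_leq Ni andbT -(ler_nat R) (le_trans h1)// tE mul1r.
exact: ChainPathEnd.
Qed.

Lemma chain_path_nat N w i : (0 < N)%N -> chain_path N w (i%:R / N%:R) = w i.
Proof.
move=> N0; rewrite /chain_path divfK ?pnatr_eq0 -?lt0n// natrK subrr.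
by have [] := pt_geo01 Xgeo (w i) (w i.+1).
Qed.

Lemma chain_path_local_geo N l w : (0 < N)%N -> discrete_geodesic N l w ->
  local_geo (N%:R * l) N%:R^-1 (chain_path N w).
Proof.
move=> N0 [wl wl2]; have NR : 0 < N%:R :> R by rewrite ltr0n.
split; first by rewrite invr_gt0.
have l0 : 0 <= l by rewrite -(wl 0%N)// mdist_ge0.
have main s t : 0 <= s -> s <= t -> t <= 1 -> t - s <= N%:R^-1 ->
    d (chain_path N w s) (chain_path N w t) = N%:R * l * (t - s).
  move=> s0 st t1 ts.
  have tsN : t * N%:R - s * N%:R <= 1.
    by rewrite -mulrBl; apply: (le_trans (ler_wpM2r (ltW NR) ts)); rewrite mulVf ?gt_eqF.
  have stN : s * N%:R <= t * N%:R by rewrite ler_pM2r.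
  have -> : N%:R * l * (t - s) = l * (t * N%:R - s * N%:R) by ring.
  have [s01 t01] : 0 <= s <= 1 /\ 0 <= t <= 1 by split; lra.
  have [i a iN a01 sE|sE] := chain_pathP w N0 s01; last first.
    have [j b jN b01 tE|tE] := chain_pathP w N0 t01.
      rewrite sE tE mul1r in stN; have : j.+1%:R <= N%:R :> R by rewrite ler_nat.
      by rewrite -[in j.+1%:R]addn1 natrD; lra.
    by rewrite sE tE mdistxx subrr mulr0.
  have a01' : 0 <= a <= 1 by lra.
  have Gi := pt_geo01 Xgeo (w i) (w i.+1).
  have [j b jN b01 tE|tE] := chain_pathP w N0 t01; last first.
    rewrite tE mul1r; rewrite tE mul1r in stN tsN.
    have iE : i.+1 = N.
      apply/eqP; rewrite eqn_leq iN /= -ltnS -(ltr_nat R) -[in i.+2%:R]addn2 natrD.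
      by lra.
    have NE : N%:R = i%:R + 1 :> R by rewrite -iE -addn1 natrD.
    rewrite -[in w N]iE (geo01_dist1 Gi)// wl// sE NE; lra.
  have b01' : 0 <= b <= 1 by lra.
  have [ij|ji] : (j = i \/ j = i.+1)%N.
    have : (i <= j)%N.
      by rewrite -ltnS -(ltr_nat R) -[in j.+1%:R]addn1 natrD; lra.
    have : (j <= i.+1)%N.
      by rewrite -ltnS -(ltr_nat R) -[in i.+2%:R]addn2 natrD; lra.
    by rewrite leq_eqVlt ltnS => /predU1P[->|ji] ij; [right|left; apply/eqP; rewrite eqn_leq ji].
    rewrite ij in tE *; have [_ _ ->//] := Gi; rewrite wl// sE tE distrC.
    by rewrite ger0_norm; [ring|lra].
  rewrite ji in tE jN *; have Gj := pt_geo01 Xgeo (w i.+1) (w i.+2).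
  have h1 := geo01_dist1 Gi a01'; have h2 := geo01_dist0 Gj b01'.
  have h3 := geo01_dist0 Gi a01'; have h4 := geo01_dist1 Gj b01'.
  rewrite wl// in h1 h3; rewrite wl// in h2 h4.
  set P := pt _ _ a in h1 h3 *; set Q := pt _ _ b in h2 h4 *.
  have := metric_triangle P (w i.+1) Q; have := metric_triangle (w i) P (w i.+2).
  have := metric_triangle P Q (w i.+2).
  rewrite wl2// h1 h2 h3 h4 sE tE -[in i.+1%:R]addn1 natrD => k1 k2 k3.
  by apply/eqP; rewrite eq_le; apply/andP; split; lra.
move=> s t s01 t01; have [st|/ltW ts] := leP s t.
  have -> : `|s - t| = t - s by rewrite distrC ger0_norm ?subr_ge0.
  by move=> h; apply: main => //; lra.
have -> : `|s - t| = s - t by rewrite ger0_norm ?subr_ge0.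
by rewrite metric_sym => h; apply: main => //; lra.
Qed.

End chain_paths.

(** * Contraction of local geodesics to a point of the convex set *)

Section descent.
Variables (R : realType) (X : metricType R) (Delta : set X) (lambda : R).
Hypothesis rc : relative_cat0 Delta lambda.
Let Xgeo := rc_geodesic rc.
Implicit Types (w u v : nat -> X) (i j k m n : nat) (l t theta : R).
Local Notation d := mdist.
Local Notation pt := (pt Xgeo).

Lemma chain_dist_le N l w i k : discrete_geodesic N l w -> (i + k <= N)%N ->
  d (w i) (w (i + k)%N) <= k%:R * l.
Proof.
move=> [wl _]; elim: k => [|k IH]; first by rewrite addn0 mdistxx mul0r.
rewrite addnS => ikN; apply: (le_trans (metric_triangle _ (w (i + k)%N) _)).
by rewrite wl// -[in k.+1%:R]addn1 natrD mulrDl mul1r lerD2r; apply/IH/ltnW.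
Qed.

(** The point [c] of [Delta] gives the shortest detour from [z] to [p], chains
    of [N] edges have length at most [L0], less than the detour, and the scale is
    reduced in steps by the factor [shrink]. The inequalities for [N] and
    [shrink] make the edges and the steps small in comparison with the balls
    that satisfy Euclidean comparison. *)
Record contraction_scheme (z p c : X) (L0 : R) (N : nat) (shrink : R) : Prop :=
  ContractionScheme {
  sch_center : Delta c;
  sch_nearest : forall v : X, Delta v -> d z c + d c p <= d z v + d v p;
  sch_L0_ge0 : 0 <= L0;
  sch_L0_lt : L0 < d z c + d c p;
  sch_N_gt0 : (0 < N)%N;
  sch_N_large : 8 * L0 <= lambda * ((d z c + d c p - L0) / 2) / 4 * N%:R;
  sch_shrink_ge : 3 / 4 <= shrink;
  sch_shrink_lt1 : shrink < 1;
  sch_shrink_close :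
    (1 - shrink) * (L0 + d z c) <= lambda * ((d z c + d c p - L0) / 2) / 4 / 8;
  sch_shrink_energy : 4 * L0 * ((1 - shrink) * (L0 + d z c)) <=
    (lambda * ((d z c + d c p - L0) / 2) / 4 / 8) ^+ 2
}.

Variables (z p c : X) (L0 : R) (N : nat) (shrink : R).
Hypothesis sch : contraction_scheme z p c L0 N shrink.
Let Dc := sch_center sch.
Let nearest := sch_nearest sch.
Let L0_ge0 := sch_L0_ge0 sch.
Let L0_lt := sch_L0_lt sch.
Let N_gt0 := sch_N_gt0 sch.
Let shrink_ge := sch_shrink_ge sch.
Let shrink_lt1 := sch_shrink_lt1 sch.

(** Half of the amount by which detours through [Delta] exceed [L0]. *)
Let mu := (d z c + d c p - L0) / 2.
Let eps := lambda * mu / 4.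
Let R0 := L0 + d z c.

Let N_large : 8 * L0 <= eps * N%:R := sch_N_large sch.
Let shrink_close : (1 - shrink) * R0 <= eps / 8 := sch_shrink_close sch.
Let shrink_energy : 4 * L0 * ((1 - shrink) * R0) <= (eps / 8) ^+ 2 :=
  sch_shrink_energy sch.

Lemma mu_gt0 : 0 < mu.
Proof. by rewrite divr_gt0// subr_gt0. Qed.

Lemma eps_gt0 : 0 < eps.
Proof. by rewrite divr_gt0// mulr_gt0 ?mu_gt0// (rc_lambda rc). Qed.

Lemma R0_ge0 : 0 <= R0.
Proof. by rewrite addr_ge0// mdist_ge0. Qed.

Lemma N_gt0R : 0 < N%:R :> R.
Proof. by rewrite ltr0n. Qed.

(** The discrete geodesics that replace, at the scale [theta], those from [z] to
    [p] of length at most [L0]. *)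
Definition level theta l w : Prop :=
  [/\ discrete_geodesic N l w, w 0%N = pt c z theta, w N = pt c p theta &
      N%:R * l <= theta * L0].

(** At all scales the detours through [Delta] are longer than the chains
    considered, by the same proportion: this only takes the triangle inequality
    and the choice of [c]. Hence the distance of the chain to [Delta] is
    proportional to the scale. *)
Lemma level_far theta l w i : 0 < theta <= 1 -> level theta l w -> (i <= N)%N ->
  far Delta (theta * mu) (w i).
Proof.
move=> /andP[th0 th1] [wg w0 wN wL] iN v Dv.
have th01 : 0 <= theta <= 1 by rewrite ltW.
have := nearest Dv; have := metric_triangle z (pt c z theta) v.
have := metric_triangle v (pt c p theta) p.
have := geo01_dist1 (pt_geo01 Xgeo c z) th01.
have := geo01_dist1 (pt_geo01 Xgeo c p) th01.
rewrite -w0 -wN (metric_sym (w 0%N) z) => -> ->.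
have h1 := chain_dist_le (i := 0%N) wg iN; rewrite add0n in h1.
have h2 := chain_dist_le (i := i) (k := N - i) wg.
rewrite subnKC// in h2; have {}h2 := h2 (leqnn N).
have h3 := metric_triangle (w 0%N) (w i) v; have h4 := metric_triangle v (w i) (w N).
have h5 : i%:R * l + (N - i)%:R * l = N%:R * l :> R.
  by rewrite -mulrDl -natrD subnKC.
rewrite (metric_sym v (w i)) in h4; rewrite (metric_sym c z) /mu; lra.
Qed.

Lemma level_ball theta l w i : 0 < theta <= 1 -> level theta l w -> (i <= N)%N ->
  cat0_ball (w i) (2 * (2 * (eps * theta))).
Proof.
move=> th lw iN; have := rc_ball rc _ (level_far th lw iN).
have -> : lambda * (theta * mu) = 2 * (2 * (eps * theta)) by rewrite /eps; field.
by apply; rewrite mulr_gt0 ?mu_gt0//; case/andP: th.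
Qed.

Lemma level_center theta l w i : 0 < theta <= 1 -> level theta l w -> (i <= N)%N ->
  d c (w i) <= theta * R0.
Proof.
move=> /andP[th0 th1] [wg w0 wN wL] iN.
have th01 : 0 <= theta <= 1 by rewrite ltW.
have h1 := chain_dist_le (i := 0%N) wg iN; rewrite add0n in h1.
have := metric_triangle c (w 0%N) (w i).
rewrite {1}w0 (geo01_dist0 (pt_geo01 Xgeo c z) th01) /R0 (metric_sym z).
have l0 : 0 <= l by have [wl _] := wg; rewrite -(wl 0%N)// mdist_ge0.
have : i%:R * l <= N%:R * l by rewrite ler_wpM2r// ler_nat.
lra.
Qed.

Lemma level_edge theta l w : level theta l w -> 0 <= l /\ (0 <= theta -> 8 * l <= eps * theta).
Proof.
move=> [wg _ _ wL]; have l0 : 0 <= l by have [wl _] := wg; rewrite -(wl 0%N)// mdist_ge0.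
split=> // th0; rewrite -(ler_pM2r N_gt0R).
have := ler_wpM2l th0 N_large; lra.
Qed.

Lemma level_energy_gap theta l w u : 0 < theta <= 1 -> level theta l w ->
  u 0%N = w 0%N -> u N = w N ->
  (forall i, (i <= N)%N -> d (u i) (w i) <= eps * theta) ->
  forall i, (i <= N)%N ->
    d (u i) (w i) ^+ 2 <= N%:R * (energy N u - N%:R * l ^+ 2).
Proof.
move=> th lw u0 uN uw i iN; have [l0 le] := level_edge lw.
have th0 : 0 < theta by case/andP: th.
have e0 : 0 < eps * theta by rewrite mulr_gt0 ?eps_gt0.
have {}le := le (ltW th0); have [wg _ _ _] := lw.
have l2 : 2 * l <= 2 * (eps * theta) by lra.
have ul j : (j <= N)%N -> d (u j) (w j) + l <= 2 * (eps * theta).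
  by move=> jN; have := uw j jN; lra.
have := energy_lower_bound Xgeo N_gt0 wg (fun i => level_ball th lw (i := i)) l2 ul.
have := sqr_sum_bound_le (fun i => d (u i) (w i)) iN.
rewrite /= u0 uN !mdistxx !addr0 mulr0 addr0 subr0 => h1 h2.
by apply: (le_trans h1); rewrite ler_pM2l ?N_gt0R//; lra.
Qed.

(** Otherwise either one would have less energy than the other. *)
Lemma level_unique theta l w l' w' : 0 < theta <= 1 ->
  level theta l w -> level theta l' w' ->
  (forall i, (i <= N)%N -> d (w i) (w' i) <= eps * theta) ->
  forall i, (i <= N)%N -> w i = w' i.
Proof.
move=> th lw lw' ww i iN; have [wg w0 wN _] := lw; have [wg' w0' wN' _] := lw'.
have w'w j : (j <= N)%N -> d (w' j) (w j) <= eps * theta.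
  by move=> jN; rewrite metric_sym ww.
have h1 := level_energy_gap th lw' (etrans w0 (esym w0')) (etrans wN (esym wN')) ww iN.
have h2 := level_energy_gap th lw (etrans w0' (esym w0)) (etrans wN' (esym wN)) w'w iN.
rewrite (energy_discrete_geodesic wg) in h1.
rewrite (energy_discrete_geodesic wg') (metric_sym (w' i)) in h2.
apply: mdist_positivity; apply/eqP; rewrite -sqrf_eq0 eq_le sqr_ge0 andbT.
by lra.
Qed.

Lemma energy_contraction r u : 0 <= r <= 1 ->
  energy N (fun i => pt c (u i) r) <= r ^+ 2 * energy N u.
Proof.
move=> r01; rewrite /energy mulr_sumr; apply: ler_sum_nat => i _.
rewrite -exprMn lerXn2r ?nnegrE ?mdist_ge0//.
  by rewrite mulr_ge0 ?mdist_ge0//; case/andP: r01.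
exact: (contraction_le rc).
Qed.

(** The contraction of a discrete geodesic is a chain of lower energy; it is
    close to a discrete geodesic because the contraction factor is close to
    [1]. *)
Lemma level_step theta l w : 0 < theta <= 1 -> level theta l w ->
  exists w' l', [/\ level (shrink * theta) l' w', l' <= shrink * l &
    forall i, (i <= N)%N -> d (w' i) (w i) <= eps * theta / 4].
Proof.
move=> th lw; have [l0 le] := level_edge lw; have /andP[th0 th1] := th.
have {}le := le (ltW th0); have [wg w0 wN wL] := lw.
have s01 : 0 <= shrink <= 1 by have := shrink_ge; have := shrink_lt1; lra.
have e0 : 0 < eps * theta by rewrite mulr_gt0 ?eps_gt0.
pose u i := pt c (w i) shrink; pose s := (1 - shrink) * (theta * R0).
have sE : s = theta * ((1 - shrink) * R0) by rewrite /s; ring.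
have se : s <= eps * theta / 8.
  by rewrite sE; have := ler_wpM2l (ltW th0) shrink_close; lra.
have us i : (i <= N)%N -> d (u i) (w i) <= s.
  move=> iN; rewrite (geo01_dist1 (pt_geo01 Xgeo c (w i)) s01) /s.
  by rewrite ler_wpM2l ?(level_center th lw)// subr_ge0 ltW.
have Eu : energy N u <= shrink ^+ 2 * (N%:R * l ^+ 2).
  by rewrite -(energy_discrete_geodesic wg); exact: energy_contraction.
have NR := N_gt0R.
have s_ge0 : 0 <= s by rewrite mulr_ge0 ?subr_ge0 ?(ltW shrink_lt1)// mulr_ge0 ?R0_ge0// ltW.
have ue i : (i <= N)%N -> d (u i) (w i) <= eps * theta.
  by move=> iN; have := us i iN; lra.
have NE : N%:R * (0 + 4 * l * s) <= (eps * theta / 8) ^+ 2.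
  have : N%:R * l * s <= theta * L0 * s by rewrite ler_wpM2r.
  have : theta * L0 * s = theta ^+ 2 * (L0 * ((1 - shrink) * R0)).
    by rewrite sE; ring.
  by have := ler_wpM2l (sqr_ge0 theta) shrink_energy; lra.
have shr2 : shrink ^+ 2 <= 1 by rewrite expr_le1//; case/andP: s01.
have Eu' : energy N u <= N%:R * l ^+ 2 + 0.
  rewrite addr0; apply: (le_trans Eu); apply: ler_piMl => //.
  by rewrite mulr_ge0 ?sqr_ge0// ltW.
have [w' [l' [w'g w'0 w'N w'w El']]] := @exists_discrete_geodesic R X Xgeo
  (rc_complete rc) N l (eps * theta) s 0 w u N_gt0 wg e0
  (fun i => level_ball th lw (i := i)) le ue (us _ (leq0n N)) (us _ (leqnn N)) se Eu' NE.
have l'0 : 0 <= l' by have [wl' _] := w'g; rewrite -(wl' 0%N)// mdist_ge0.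
have l'l : l' <= shrink * l.
  have s0 : 0 <= shrink by case/andP: s01.
  rewrite -ler_sqr ?nnegrE ?mulr_ge0// exprMn -(ler_pM2l NR).
  by apply: (le_trans El'); rewrite mulrCA.
exists w', l'; split=> //; split=> //.
- by rewrite w'0 /u w0 pt_pt// ltW.
- by rewrite w'N /u wN pt_pt// ltW.
have s0 : 0 <= shrink by case/andP: s01.
have := ler_wpM2l s0 wL; have := ler_wpM2l (ltW NR) l'l; lra.
Qed.

Lemma shrink01 : 0 < shrink <= 1.
Proof. by have := shrink_ge; have := shrink_lt1; lra. Qed.

Lemma scale01 k : 0 < shrink ^+ k <= 1.
Proof.
have /andP[s0 s1] := shrink01.
by rewrite exprn_gt0//= exprn_ile1// ltW.
Qed.

Lemma levels_exist l w : level 1 l w -> exists (W : nat -> nat -> X) (ll : nat -> R),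
  [/\ W 0%N = w, ll 0%N = l, forall k, level (shrink ^+ k) (ll k) (W k),
    forall k, ll k.+1 <= shrink * ll k &
    forall k i, (i <= N)%N -> d (W k.+1 i) (W k i) <= eps * shrink ^+ k / 4].
Proof.
move=> lw.
pose S := {x : nat * R * (nat -> X) | level (shrink ^+ x.1.1) x.1.2 x.2}.
pose next (x y : S) := [/\ (projT1 y).1.1 = (projT1 x).1.1.+1,
  (projT1 y).1.2 <= shrink * (projT1 x).1.2 &
  forall i, (i <= N)%N -> d ((projT1 y).2 i) ((projT1 x).2 i) <=
     eps * shrink ^+ (projT1 x).1.1 / 4].
pose x0 : S := exist (fun x => level (shrink ^+ x.1.1) x.1.2 x.2) (0%N, l, w) lw.
have step x : {y | next x y}.
  apply: cid; case: x => [[[k lk] wk] /= lev].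
  have [w' [l' [lev' l'l w'w]]] := level_step (scale01 k) lev.
  rewrite -exprS in lev'.
  by exists (exist (fun x => level (shrink ^+ x.1.1) x.1.2 x.2) (k.+1, l', w') lev').
have [f [f0 fS]] := dependent_choice step x0.
have fk k : (projT1 (f k)).1.1 = k.
  by elim: k => [|k IH]; [rewrite f0|have [-> _ _] := fS k; rewrite IH].
exists (fun k => (projT1 (f k)).2), (fun k => (projT1 (f k)).1.2).
split; [by rewrite f0|by rewrite f0| | |].
- by move=> k; have := projT2 (f k); rewrite fk.
- by move=> k; have [] := fS k.
- by move=> k; have [_ _] := fS k; rewrite fk.
Qed.

End descent.

Section shadows.
Variables (R : realType) (X : metricType R) (Delta : set X) (lambda : R).
Hypothesis rc : relative_cat0 Delta lambda.
Let Xgeo := rc_geodesic rc.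
Implicit Types (i j k m n : nat) (t : R).
Local Notation d := mdist.
Local Notation pt := (pt Xgeo).
Variables (z p c : X) (L0 : R) (N : nat) (shrink : R).
Hypothesis sch : contraction_scheme Delta lambda z p c L0 N shrink.
Let Dc := sch_center sch.
Let N_gt0 := sch_N_gt0 sch.
Let mu := (d z c + d c p - L0) / 2.
Let eps := lambda * mu / 4.
Let R0 := L0 + d z c.
Local Notation scale k := (shrink ^+ k).

Definition descending (W : nat -> nat -> X) (l : nat -> R) : Prop :=
  [/\ forall k, level rc z p c L0 N (scale k) (l k) (W k),
      forall k, l k.+1 <= shrink * l k &
      forall k i, (i <= N)%N -> d (W k.+1 i) (W k i) <= eps * scale k / 4].

Variables (W : nat -> nat -> X) (l : nat -> R).
Hypothesis desc : descending W l.

Let scale_gt0 k : 0 < scale k.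
Proof. by have /andP[] := scale01 sch k. Qed.

(** Edge lengths relative to the scale decrease, hence converge. *)
Definition rel_edge k : R := l k / scale k.

Lemma rel_edgeE k : l k = rel_edge k * scale k.
Proof. by rewrite divfK// gt_eqF. Qed.

Lemma rel_edge_ge0 k : 0 <= rel_edge k.
Proof.
have [lev _ _] := desc; have [l0 _] := level_edge sch (lev k).
by rewrite divr_ge0// ltW.
Qed.

Lemma rel_edge_le k m : (k <= m)%N -> rel_edge m <= rel_edge k.
Proof.
move=> /subnKC <-; elim: (m - k)%N => [|n IH]; first by rewrite addn0.
apply: le_trans IH; rewrite addnS; have [_ step _] := desc.
rewrite ler_pdivrMr// (le_trans (step _))// exprS mulrCA.
by rewrite -rel_edgeE.
Qed.

Lemma rel_edge_small k : 8 * rel_edge k <= eps.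
Proof.
have [lev _ _] := desc; have [_ le] := level_edge sch (lev k).
rewrite -(ler_pM2r (scale_gt0 k)) -mulrA -rel_edgeE.
by apply: le; exact: ltW.
Qed.

Lemma rel_edge_gap a : 0 < a -> exists K, forall k m, (K <= k)%N -> (k <= m)%N ->
  rel_edge k ^+ 2 - rel_edge m ^+ 2 <= a.
Proof.
move=> a0; pose S := range (fun k => rel_edge k ^+ 2).
have hS : has_inf S.
  by split; [exists (rel_edge 0%N ^+ 2); exists 0%N|exists 0 => _ [k _ <-]; exact: sqr_ge0].
have [_ [K _ <-] KS] := inf_adherent a0 hS; exists K => k m Kk km.
have : inf S <= rel_edge m ^+ 2 by apply: ge_inf; [case: hS|exists m].
have : rel_edge k ^+ 2 <= rel_edge K ^+ 2.
  by rewrite lerXn2r ?nnegrE ?rel_edge_ge0// rel_edge_le.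
by move: KS; lra.
Qed.

(** Contracting the chain of a late level all the way to a later level changes
    the energy little, so that the contracted chain stays close to the chain of
    the later level, at its scale. *)
Lemma chain_shadow a : 0 < a -> exists K, forall k m, (K <= k)%N -> (k <= m)%N ->
  forall i, (i <= N)%N -> d (pt c (W k i) (scale (m - k))) (W m i) <= a * scale m.
Proof.
move=> a0; have e0 := eps_gt0 rc sch; rewrite -/mu -/eps in e0.
have NR : 0 < N%:R :> R by rewrite ltr0n.
pose b := Num.min a (eps / 4).
have b0 : 0 < b by rewrite lt_min a0 divr_gt0.
have [ba be] : b <= a /\ b <= eps / 4 by rewrite !ge_min !lexx orbT.
have g0 : 0 < b ^+ 2 / N%:R ^+ 2 by rewrite divr_gt0// exprn_gt0.
have [K HK] := rel_edge_gap g0; exists K => k m Kk km i iN.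
apply: (@le_trans _ _ (b * scale m)); last by rewrite ler_pM2r.
have [lev step near] := desc.
have s01 := shrink01 sch; have /andP[s_gt0 s_le1] := s01.
have s01' : 0 <= shrink <= 1 by rewrite ltW.
rewrite -(subnKC km) addKn; move: (m - k)%N i iN => {km}{}m.
elim: m => [|n IH] i iN.
  by rewrite addn0 expr0 pt1 mdistxx mulr_ge0// ltW.
have sn01 : 0 <= scale n <= 1.
  by have /andP[h ->] := scale01 sch n; rewrite ltW.
have sn01' : 0 <= scale n.+1 <= 1.
  by have /andP[h ->] := scale01 sch n.+1; rewrite ltW.
pose u j := pt c (W k j) (scale n.+1).
have uE j : u j = pt c (pt c (W k j) (scale n)) shrink.
  by rewrite pt_pt// -exprS.
have [w_0 w_N] : W (k + n.+1)%N 0%N = pt c z (scale (k + n.+1)) /\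
    W (k + n.+1)%N N = pt c p (scale (k + n.+1)) by have [] := lev (k + n.+1)%N.
have sk01 : 0 <= scale k <= 1.
  by have /andP[h ->] := scale01 sch k; rewrite ltW.
have u0 : u 0%N = W (k + n.+1)%N 0%N.
  have [_ W0 _ _] := lev k.
  by rewrite w_0 /u W0 pt_pt// -exprD addnC.
have uN : u N = W (k + n.+1)%N N.
  have [_ _ WN _] := lev k.
  by rewrite w_N /u WN pt_pt// -exprD addnC.
have uw j : (j <= N)%N -> d (u j) (W (k + n.+1)%N j) <= eps * scale (k + n.+1).
  move=> jN; have h1 := contraction_le rc (pt c (W k j) (scale n)) (W (k + n)%N j) Dc s01'.
  have h2 := IH j jN; have h3 := near (k + n)%N j jN.
  have h4 := geo01_dist1 (pt_geo01 Xgeo c (W (k + n)%N j)) s01'.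
  have h5 := level_center sch (scale01 sch (k + n)) (lev (k + n)%N) jN.
  have h6 := metric_triangle (u j) (pt c (W (k + n)%N j) shrink) (W (k + n.+1)%N j).
  have h7 := metric_triangle (pt c (W (k + n)%N j) shrink) (W (k + n)%N j) (W (k + n.+1)%N j).
  have h8 := sch_shrink_close sch; have h9 := sch_shrink_ge sch.
  have sk := scale_gt0 (k + n); rewrite -/mu -/eps -/R0 in h5 h8 *.
  rewrite addnS exprS; rewrite addnS in h6 h7 *; rewrite -uE in h1.
  rewrite (metric_sym (W (k + n)%N j) (W (k + n).+1 j)) in h7.
  set q := scale (k + n) in h2 h3 h5 sk *.
  have k1 : shrink * d (pt c (W k j) (scale n)) (W (k + n)%N j) <=
      eps / 4 * q.
    apply: (@le_trans _ _ (1 * (b * q))).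
      by apply: ler_pM => //; [exact: ltW|exact: mdist_ge0].
    by rewrite mul1r ler_pM2r.
  have k2 : (1 - shrink) * d c (W (k + n)%N j) <= q * (eps / 8).
    apply: (@le_trans _ _ ((1 - shrink) * (q * R0))).
      by rewrite ler_wpM2l// subr_ge0.
    by rewrite mulrCA ler_pM2l.
  have k3 : (3 / 4) * (eps * q) <= shrink * (eps * q).
    by rewrite ler_pM2r// mulr_gt0.
  have k4 : 0 < eps * q by rewrite mulr_gt0.
  by lra.
have gap := level_energy_gap sch (scale01 sch (k + n.+1)) (lev (k + n.+1)%N) u0 uN uw iN.
have Eu := energy_contraction rc sch (W k) sn01'.
have [wg _ _ _] := lev k; rewrite (energy_discrete_geodesic wg) in Eu.
have eg := HK k (k + n.+1)%N Kk (leq_addr _ _).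
have q0 := scale_gt0 (k + n.+1).
have lE : (scale n.+1 * l k) = rel_edge k * scale (k + n.+1).
  by rewrite rel_edgeE exprD; ring.
have lE' := rel_edgeE (k + n.+1).
rewrite -/(u i) -ler_sqr ?nnegrE ?mdist_ge0 ?(mulr_ge0 (ltW b0) (ltW q0))//.
apply: (le_trans gap).
apply: (@le_trans _ _ (N%:R * (N%:R * ((scale n.+1 * l k) ^+ 2 - l (k + n.+1)%N ^+ 2)))).
  by rewrite ler_pM2l//; rewrite exprMn; lra.
rewrite lE {}lE'; set q := scale (k + n.+1) in q0 *.
have -> : N%:R * (N%:R * ((rel_edge k * q) ^+ 2 - (rel_edge (k + n.+1) * q) ^+ 2)) =
  N%:R ^+ 2 * (rel_edge k ^+ 2 - rel_edge (k + n.+1) ^+ 2) * q ^+ 2 by ring.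
rewrite [(b * q) ^+ 2]exprMn ler_pM2r ?exprn_gt0//.
have N2 : 0 < N%:R ^+ 2 :> R by rewrite exprn_gt0.
by move: eg; rewrite ler_pdivlMr// mulrC.
Qed.

Definition level_path k : R -> X := chain_path Xgeo N (W k).

(** Inside an edge, by comparison in the triangle formed by the contracted point
    and the corresponding edge of the later level. *)
Lemma path_shadow a : 0 < a -> exists K, forall k m, (K <= k)%N -> (k <= m)%N ->
  forall t, 0 <= t <= 1 ->
    d (pt c (level_path k t) (scale (m - k))) (level_path m t) <= a * scale m.
Proof.
move=> a0; have e0 := eps_gt0 rc sch; rewrite -/mu -/eps in e0.
pose e1 := rel_edge 0%N + 1; have e1_gt0 : 0 < e1 by rewrite ltr_wpDl// rel_edge_ge0.
pose b := Num.min (Num.min (a / 2) eps) (a ^+ 2 / (6 * e1)).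
have b0 : 0 < b.
  rewrite !lt_min; apply/andP; split; first by rewrite e0 andbT divr_gt0.
  by rewrite divr_gt0 ?exprn_gt0// mulr_gt0.
have [ba be b6] : [/\ b <= a / 2, b <= eps & b <= a ^+ 2 / (6 * e1)].
  by split; rewrite !ge_min lexx ?orbT.
have a3 : 0 < a ^+ 2 / 3 by rewrite divr_gt0// exprn_gt0.
have [K1 HK1] := rel_edge_gap a3; have [K2 HK2] := chain_shadow b0.
exists (maxn K1 K2) => k m; rewrite geq_max => /andP[k1 k2] km t t01.
have sh := HK2 k m k2 km; have gap := HK1 k m k1 km.
have [lev step near] := desc.
set r := scale (m - k) in sh *; set q := scale m in sh *.
have q0 : 0 < q := scale_gt0 m.
have r01 : 0 <= r <= 1 by have /andP[h ->] := scale01 sch (m - k); rewrite ltW.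
have rk : r * scale k = q by rewrite -exprD subnK.
have [gk _ _ _] := lev k; have [gm _ _ _] := lev m.
have [wk _] := gk; have [wm _] := gm.
rewrite /level_path; have [i tau iN tau01 tE|tE] := chain_pathP Xgeo (W k) N_gt0 t01; last first.
  have -> : chain_path Xgeo N (W m) t = W m N.
    by rewrite tE -(divff (x := N%:R)) ?pnatr_eq0 -?lt0n// chain_path_nat.
  by apply: (le_trans (sh N (leqnn N))); rewrite ler_pM2r//; lra.
have -> : chain_path Xgeo N (W m) t = pt (W m i) (W m i.+1) tau.
  have [j tau' jN tau'01 tE'|tE'] := chain_pathP Xgeo (W m) N_gt0 t01; last first.
    exfalso; move: tE; rewrite tE' mul1r => tE.
    have : i.+1%:R <= N%:R :> R by rewrite ler_nat.
    by rewrite -[in i.+1%:R]addn1 natrD; lra.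
  have ij : i = j.
    have h : i%:R + tau = j%:R + tau' by rewrite -tE -tE'.
    case: (ltngtP i j) => // ij; exfalso; move: ij; rewrite -(ler_nat R) -addn1 natrD; lra.
  by rewrite ij in tE *; congr (pt _ _ _); lra.
set y := pt c _ r.
have ta01 : 0 <= tau <= 1 by lra.
have Gk := pt_geo01 Xgeo (W k i) (W k i.+1).
have Gm := pt_geo01 Xgeo (W m i) (W m i.+1).
have y0 : d y (W m i) <= tau * rel_edge k * q + b * q.
  apply: (le_trans (metric_triangle _ (pt c (W k i) r) _)).
  rewrite lerD ?sh ?(ltnW iN)//.
  apply: (le_trans (contraction_le rc _ _ Dc r01)).
  rewrite metric_sym (geo01_dist0 Gk)// wk// rel_edgeE -rk.
  by rewrite (_ : r * _ = tau * rel_edge k * (r * scale k))//; ring.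
have y1 : d y (W m i.+1) <= (1 - tau) * rel_edge k * q + b * q.
  apply: (le_trans (metric_triangle _ (pt c (W k i.+1) r) _)).
  rewrite lerD ?sh//.
  apply: (le_trans (contraction_le rc _ _ Dc r01)).
  rewrite (geo01_dist1 Gk)// wk// rel_edgeE -rk.
  by rewrite (_ : r * _ = (1 - tau) * rel_edge k * (r * scale k))//; ring.
have ek0 := rel_edge_ge0 k; have ek8 := rel_edge_small k; have em8 := rel_edge_small m.
have ball := level_ball sch (scale01 sch m) (lev m) (ltnW iN).
rewrite -/mu -/eps -/q in ball.
have lm := wm i iN; rewrite rel_edgeE -/q in lm.
have eq0 : 0 < eps * q by rewrite mulr_gt0.
have emq : 8 * (rel_edge m * q) <= eps * q by rewrite mulrA ler_pM2r.
have ekq : 8 * (rel_edge k * q) <= eps * q by rewrite mulrA ler_pM2r.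
have bq : b * q <= eps * q by rewrite ler_pM2r.
have st : stewart0 y (W m i) (pt (W m i) (W m i.+1) tau) (W m i.+1).
  apply: ball (geo01_btw Gm ta01); rewrite ?mdistxx ?lm; last first.
  - lra.
  - rewrite (geo01_dist0 Gm)// lm; have : tau * (rel_edge m * q) <= 1 * (rel_edge m * q).
      apply: ler_wpM2r; last by lra.
      exact: mulr_ge0 (rel_edge_ge0 m) (ltW q0).
    lra.
  - lra.
  - rewrite metric_sym; have : tau * (rel_edge k * q) <= 1 * (rel_edge k * q).
      apply: ler_wpM2r; last by lra.
      exact: mulr_ge0 (rel_edge_ge0 k) (ltW q0).
    lra.
have := stewart0_geo01 Gm ta01 st; rewrite lm => Y.
set Pm := pt (W m i) _ tau in Y *.
rewrite -ler_sqr ?nnegrE ?mdist_ge0 ?(mulr_ge0 (ltW a0) (ltW q0))//.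
apply: (le_trans Y).
have [ta0 ta1] : 0 <= tau /\ 0 <= 1 - tau by lra.
have bq0 : 0 <= b * q := mulr_ge0 (ltW b0) (ltW q0).
have tq0 : 0 <= tau * rel_edge k * q := mulr_ge0 (mulr_ge0 ta0 ek0) (ltW q0).
have tq1 : 0 <= (1 - tau) * rel_edge k * q := mulr_ge0 (mulr_ge0 ta1 ek0) (ltW q0).
have s0 : d y (W m i) ^+ 2 <= (tau * rel_edge k * q + b * q) ^+ 2.
  rewrite lerXn2r ?nnegrE ?mdist_ge0// addr_ge0//.
have s1 : d y (W m i.+1) ^+ 2 <= ((1 - tau) * rel_edge k * q + b * q) ^+ 2.
  rewrite lerXn2r ?nnegrE ?mdist_ge0// addr_ge0//.
have s2 := ler_wpM2l ta1 s0; have s3 := ler_wpM2l ta0 s1.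
apply: (@le_trans _ _ (q ^+ 2 * (tau * (1 - tau) * (rel_edge k ^+ 2 - rel_edge m ^+ 2) +
    4 * (tau * (1 - tau)) * (b * rel_edge k) + b ^+ 2))); first lra.
rewrite [(a * q) ^+ 2]exprMn [leRHS]mulrC ler_pM2l ?(exprn_gt0 _ q0)//.
have tt0 : 0 <= tau * (1 - tau) by rewrite mulr_ge0.
have tt1 : tau * (1 - tau) <= 1 / 4 by have := sqr_ge0 (tau - 1 / 2); lra.
have u1 : tau * (1 - tau) * (rel_edge k ^+ 2 - rel_edge m ^+ 2) <= 1 / 4 * (a ^+ 2 / 3).
  have [g0|g0] := leP 0 (rel_edge k ^+ 2 - rel_edge m ^+ 2); first exact: ler_pM.
  apply: (@le_trans _ _ 0); first by rewrite mulr_ge0_le0// ltW.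
  by rewrite mulr_ge0// ltW.
have u2 : tau * (1 - tau) * (b * rel_edge k) <= 1 / 4 * (a ^+ 2 / 6).
  apply: ler_pM => //; first by rewrite mulr_ge0// ltW.
  have : b * (6 * e1) <= a ^+ 2 by rewrite -ler_pdivlMr// mulr_gt0.
  have : b * rel_edge k <= b * e1.
    by rewrite ler_pM2l// /e1; have := rel_edge_le (leq0n k); lra.
  lra.
have u3 : b ^+ 2 <= (a / 2) ^+ 2 by rewrite lerXn2r ?nnegrE ?(ltW b0) ?divr_ge0 ?(ltW a0).
have := sqr_ge0 a; lra.
Qed.

End shadows.

(** * The tangent spaces at the points of the convex set *)

Lemma germ_dist_itv (R : realType) (X : metricType R) (x : X)
    (g h : geodesic_from x) (b M : R) :
  (\forall t \near 0^'+, b <= germ_quot g h t <= M) -> b <= germ_dist g h <= M.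
Proof.
move=> bM; rewrite /germ_dist; set L := limf_esup _ _.
have LM : (L <= M%:E)%E.
  apply: (@le_trans _ _ (ereal_sup
      ((EFin \o germ_quot g h) @` [set t | b <= germ_quot g h t <= M]))).
    by apply: ereal_inf_lbound; exists [set t | b <= germ_quot g h t <= M].
  by apply: ge_ereal_sup => _ [t /= /andP[_ tM] <-]; rewrite lee_fin.
have bL : (b%:E <= L)%E.
  apply: le_ereal_inf_tmp => _ [A A0 <-].
  have [t [At /andP[bt _]]] := filter_ex (filterI A0 bM).
  apply: (@le_trans _ _ (germ_quot g h t)%:E); first by rewrite lee_fin.
  by apply: ereal_sup_ubound; exists t.
have Lfin : L \is a fin_num.
  by rewrite fin_numE -ltNye -ltey (lt_le_trans (ltNyr b) bL) (le_lt_trans LM (ltry M)).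
by rewrite -!lee_fin fineK// bL.
Qed.

Section germs.
Variables (R : realType) (X : metricType R) (Delta : set X) (lambda : R).
Hypothesis rc : relative_cat0 Delta lambda.
Let Xgeo := rc_geodesic rc.
Implicit Types (s t theta phi : R) (x y : X).
Local Notation d := mdist.
Local Notation pt := (pt Xgeo).
Variable c : X.
Hypothesis Dc : Delta c.

Definition germ_curve theta (th0 : 0 < theta) x : curve R X :=
  @Curve R X 0 theta (fun s => pt c x (s / theta)) (ltW th0).

Lemma germ_curve_geodesic theta (th0 : 0 < theta) x : geodesic (germ_curve th0 x).
Proof.
have [_ _ G] := pt_geo01 Xgeo c x.
exists (d c x / theta); first by rewrite divr_ge0// ?mdist_ge0// ltW.
move=> u v; rewrite /cdom /= !in_itv /= => /andP[u0 u1] /andP[v0 v1].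
have th01 s : 0 <= s -> s <= theta -> 0 <= s / theta <= 1.
  by move=> s0 s1; rewrite divr_ge0 ?(ltW th0)//= ler_pdivrMr// mul1r.
by rewrite G ?th01// -mulrBl normrM (gtr0_norm (x := theta^-1)) ?invr_gt0//; ring.
Qed.

Lemma germ_curve_source theta (th0 : 0 < theta) x : germ_curve th0 x 0 = c.
Proof. by rewrite /= mul0r (pt0 rc). Qed.

(** The direction of [x], with the length of [[c, x]] divided by [theta]. *)
Definition germ theta (th0 : 0 < theta) x : geodesic_from c :=
  @GeodesicFrom _ _ c (germ_curve th0 x) (germ_curve_geodesic th0 x) erefl th0
    (germ_curve_source th0 x).

Lemma germ_quot_le theta phi (th0 : 0 < theta) (ph0 : 0 < phi) x y s t :
  0 < s -> s <= t -> t <= theta -> t <= phi ->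
  germ_quot (germ th0 x) (germ ph0 y) s <= germ_quot (germ th0 x) (germ ph0 y) t.
Proof.
move=> s0 st tth tph; have t0 : 0 < t := lt_le_trans s0 st.
rewrite /germ_quot /=.
have st01 : 0 <= s / t <= 1 by rewrite divr_ge0 ?(ltW s0) ?(ltW t0)//= ler_pdivrMr// mul1r.
have frac r : 0 < r -> t <= r -> 0 <= t / r <= 1.
  by move=> r0 tr; rewrite divr_ge0 ?(ltW r0) ?(ltW t0)//= ler_pdivrMr// mul1r.
have E r : 0 < r -> s / r = s / t * (t / r) by move=> r0; field; rewrite !gt_eqF.
rewrite (E theta)// (E phi)// -!(pt_pt rc _ Dc st01) ?frac//.
rewrite ler_pdivrMr// (le_trans (contraction_le rc _ _ Dc st01))//.
by rewrite le_eqVlt; apply/orP; left; apply/eqP; ring.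
Qed.

Lemma germ_dist_le_quot theta phi (th0 : 0 < theta) (ph0 : 0 < phi) x y t :
  0 < t -> t <= theta -> t <= phi ->
  germ_dist (germ th0 x) (germ ph0 y) <= germ_quot (germ th0 x) (germ ph0 y) t.
Proof.
move=> t0 tth tph.
suff /andP[] : 0 <= germ_dist (germ th0 x) (germ ph0 y) <=
  germ_quot (germ th0 x) (germ ph0 y) t by [].
apply: germ_dist_itv; near=> s.
have s0 : 0 < s by [].
rewrite divr_ge0 ?mdist_ge0 ?(ltW s0)//=; apply: germ_quot_le => //.
by near: s; exact: nbhs_right_le.
Unshelve. all: by end_near. Qed.

Lemma le_germ_dist theta phi (th0 : 0 < theta) (ph0 : 0 < phi) x y b :
  (forall t, 0 < t -> t <= theta -> t <= phi ->
    b <= germ_quot (germ th0 x) (germ ph0 y) t) ->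
  b <= germ_dist (germ th0 x) (germ ph0 y).
Proof.
move=> bt; pose m := Num.min theta phi.
have m0 : 0 < m by rewrite lt_min th0.
have [mth mph] : m <= theta /\ m <= phi by rewrite !ge_min !lexx orbT.
suff /andP[] : b <= germ_dist (germ th0 x) (germ ph0 y) <=
  germ_quot (germ th0 x) (germ ph0 y) m by [].
apply: germ_dist_itv; near=> s.
have s0 : 0 < s by [].
have sm : s <= m by near: s; exact: nbhs_right_le.
by rewrite bt ?germ_quot_le// (le_trans sm).
Unshelve. all: by end_near. Qed.

Definition tangent_vector theta (th0 : 0 < theta) x : tangent_space c :=
  quotient_class (germ_pseudo_distance c) (germ th0 x).

Lemma tangent_vector_dist theta phi (th0 : 0 < theta) (ph0 : 0 < phi) x y :
  d (tangent_vector th0 x) (tangent_vector ph0 y) =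
  germ_dist (germ th0 x) (germ ph0 y).
Proof. exact: quotient_classE. Qed.

End germs.

(** * Descending families converge to local geodesics of the completed tangent space *)

Section tangent_limits.
Variables (R : realType) (X : metricType R) (Delta : set X) (lambda : R).
Hypothesis rc : relative_cat0 Delta lambda.
Let Xgeo := rc_geodesic rc.
Implicit Types (i j k m n : nat) (s t a : R) (x y : X).
Local Notation d := mdist.
Local Notation pt := (pt Xgeo).
Variables (z p c : X) (L0 : R) (N : nat) (shrink : R).
Hypothesis sch : contraction_scheme Delta lambda z p c L0 N shrink.
Let Dc := sch_center sch.
Let N_gt0 := sch_N_gt0 sch.
Let eps := lambda * ((d z c + d c p - L0) / 2) / 4.
Local Notation scale k := (shrink ^+ k).

Let NR : 0 < N%:R :> R.
Proof. by rewrite ltr0n. Qed.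

Lemma scale_gt0 k : 0 < scale k.
Proof. by have /andP[] := scale01 sch k. Qed.

Lemma scale_le k m : (k <= m)%N -> scale m <= scale k.
Proof.
move=> km; have /andP[_ s1] := scale01 sch (m - k).
by rewrite -(subnK km) exprD ler_piMl// ltW// scale_gt0.
Qed.

Lemma scale_small e : 0 < e -> exists K, forall k, (K <= k)%N -> scale k <= e.
Proof.
move=> e0; have sh : `|shrink| < 1.
  have := sch_shrink_ge sch; have := sch_shrink_lt1 sch => h1 h2.
  by rewrite ger0_norm//; lra.
have /cvgrPdist_lt/(_ e e0)[K _ HK] := cvg_expr sh.
exists K => k Kk; have := HK k Kk; rewrite /= sub0r normrN gtr0_norm ?scale_gt0//.
exact: ltW.
Qed.

Definition vec k x : tangent_space c := tangent_vector rc c (scale_gt0 k) x.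

Lemma vec_dist_le k m x y : (k <= m)%N ->
  d (vec k x) (vec m y) <= d (pt c x (scale (m - k))) y / scale m.
Proof.
move=> km; rewrite tangent_vector_dist.
apply: (le_trans (germ_dist_le_quot rc Dc _ _ _ _ (scale_gt0 m) (scale_le km) (lexx _))).
rewrite /germ_quot /= divff ?gt_eqF ?scale_gt0// (pt1 rc).
by rewrite -{1}(subnK km) exprD mulfK// gt_eqF ?scale_gt0.
Qed.

Lemma vec_quot_le k m x y : (k <= m)%N ->
  germ_quot (germ rc c (scale_gt0 k) x) (germ rc c (scale_gt0 k) y) (scale m) =
  d (pt c x (scale (m - k))) (pt c y (scale (m - k))) / scale m.
Proof.
move=> km; rewrite /germ_quot /=.
by rewrite (_ : scale m / scale k = scale (m - k))// -{1}(subnK km) exprD mulfK// gt_eqF ?scale_gt0.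
Qed.

(** The difference quotients decrease with the parameter, so that the distance
    of two directions is at least any bound that holds at all late scales. *)
Lemma le_vec_dist k K x y b : (forall m, (K <= m)%N -> (k <= m)%N ->
    b * scale m <= d (pt c x (scale (m - k))) (pt c y (scale (m - k)))) ->
  b <= d (vec k x) (vec k y).
Proof.
move=> H; rewrite tangent_vector_dist; apply: (le_germ_dist Dc) => t t0 tk _.
have [K' HK'] := scale_small t0; pose m := maxn (maxn K K') k.
have [Km K'm km] : [/\ (K <= m)%N, (K' <= m)%N & (k <= m)%N].
  by rewrite /m !leq_max !leqnn !orbT.
apply: le_trans (germ_quot_le rc Dc _ _ _ _ (scale_gt0 m) (HK' m K'm) tk tk).
by rewrite vec_quot_le// ler_pdivlMr ?scale_gt0//; exact: H.
Qed.

Section limit_curve.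
Variables (W : nat -> nat -> X) (l : nat -> R).
Hypothesis desc : descending rc z p c L0 N shrink W l.
Local Notation path := (level_path rc N W).
Local Notation rel := (rel_edge shrink l).

Lemma vec_path_shadow a : 0 < a -> exists K, forall k m, (K <= k)%N -> (k <= m)%N ->
  forall t, 0 <= t <= 1 -> d (vec k (path k t)) (vec m (path m t)) <= a.
Proof.
move=> a0; have [K HK] := path_shadow sch desc a0; exists K => k m Kk km t t01.
by rewrite (le_trans (vec_dist_le _ _ km))// ler_pdivrMr ?scale_gt0//; exact: HK.
Qed.

Let clamp t := if 0 <= t <= 1 then t else 0.

Let clamp01 t : 0 <= clamp t <= 1.
Proof. by rewrite /clamp; case: ifP => // _; rewrite lexx ler01. Qed.

Lemma vec_path_cauchy t : cauchy ((fun k => vec k (path k (clamp t))) @ \oo).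
Proof.
apply: cauchy_seq_cauchy => a a0; have a3 : 0 < a / 3 by rewrite divr_gt0.
have [K HK] := vec_path_shadow a3; exists K => m n Km Kn.
have h1 := HK K m (leqnn K) Km _ (clamp01 t); have h2 := HK K n (leqnn K) Kn _ (clamp01 t).
apply: (le_lt_trans (metric_triangle _ (vec K (path K (clamp t))) _)).
by rewrite metric_sym; lra.
Qed.

Definition limit_point t : completion (tangent_space c) :=
  quotient_class (cauchy_pseudo_distance (tangent_space c))
    (CauchySequence (vec_path_cauchy t)).

Definition limit_speed : R := N%:R * limn rel.

Lemma rel_edge_cvg : cvgn rel.
Proof.
apply: nonincreasing_is_cvgn.
  by move=> m n mn; exact: (rel_edge_le sch desc).
by exists 0 => _ [k _ <-]; exact: (rel_edge_ge0 sch desc).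
Qed.

(** At its own scale a level gives the upper bound. The lower bound holds for the
    contractions of the level to all later scales, where they shadow paths of
    almost the same relative speed. *)
Lemma limit_point_dist s t : 0 <= s <= 1 -> 0 <= t <= 1 -> `|s - t| <= N%:R^-1 ->
  d (limit_point s) (limit_point t) = limit_speed * `|s - t|.
Proof.
move=> s01 t01 st; rewrite /limit_point quotient_classE /= /cauchy_dist.
have cs : clamp s = s by rewrite /clamp s01.
have ct : clamp t = t by rewrite /clamp t01.
have cv := @cauchy_dist_cvg _ _ (CauchySequence (vec_path_cauchy s))
  (CauchySequence (vec_path_cauchy t)).
rewrite /= in cv *.
have pathE m : d (path m s) (path m t) = N%:R * rel m * `|s - t| * scale m.
  have [lev _ _] := desc; have [wg _ _ _] := lev m.
  have [_ ->//] := chain_path_local_geo Xgeo N_gt0 wg.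
  rewrite [l m](rel_edgeE sch); ring.
have rc0 : 0 <= `|s - t| := normr_ge0 _.
have cvN : (fun n => N%:R * rel n * `|s - t|) @ \oo --> limit_speed * `|s - t|.
  by apply: cvgMr_tmp; apply: cvgMl_tmp; exact: rel_edge_cvg.
apply/eqP; rewrite eq_le; apply/andP; split.
  rewrite -(cvg_lim _ cvN)//; apply: ler_lim => //; first by apply: cvgP cvN.
  near=> k; rewrite cs ct (le_trans (vec_dist_le _ _ (leqnn k)))//.
  by rewrite subnn expr0 (pt1 rc) pathE mulfK// gt_eqF// scale_gt0.
apply/ler_addgt0Pl => a a0; have a2 : 0 < a / 2 by rewrite divr_gt0.
rewrite -lerBlDl; apply: limr_ge => //.
have [K HK] := path_shadow sch desc a2; near=> k.
have Kk : (K <= k)%N by near: k; exists K.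
rewrite cs ct; apply: (@le_vec_dist k K) => m Km km.
have h1 := HK k m Kk km s s01; have h2 := HK k m Kk km t t01.
have h3 := metric_triangle (path m s) (pt c (path k s) (scale (m - k))) (path m t).
have h4 := metric_triangle (pt c (path k s) (scale (m - k)))
  (pt c (path k t) (scale (m - k))) (path m t).
rewrite pathE (metric_sym (path m s)) in h3.
have h5 : limit_speed * `|s - t| * scale m <= N%:R * rel m * `|s - t| * scale m.
  rewrite ler_pM2r ?scale_gt0// ler_wpM2r// ler_pM2l//.
  apply: nonincreasing_cvgn_ge (rel_edge_cvg) _.
  by move=> i j ij; exact: (rel_edge_le sch desc).
lra.
Unshelve. all: by end_near. Qed.

Lemma limit_point_local_geodesic : local_geodesic (curve01 limit_point).
Proof.
exists limit_speed.
  apply: mulr_ge0; first exact: ltW; apply: limr_ge; first exact: rel_edge_cvg.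
  by near=> k; exact: (rel_edge_ge0 sch desc).
move=> t _; exists (N%:R^-1 / 2) => [|u v]; first by rewrite divr_gt0 ?invr_gt0.
rewrite /cdom /= !in_itv /= => u01 v01 ut vt; apply: limit_point_dist => //.
rewrite (_ : u - v = (u - t) - (v - t)); last by ring.
by rewrite (le_trans (ler_normB _ _))//; move: (N%:R^-1) ut vt => q; lra.
Unshelve. all: by end_near. Qed.

End limit_curve.

End tangent_limits.

(** * Uniqueness of local geodesics outside the convex set *)

Section level_uniqueness.
Variables (R : realType) (X : metricType R) (Delta : set X) (lambda : R).
Hypothesis rc : relative_cat0 Delta lambda.
Let Xgeo := rc_geodesic rc.
Implicit Types (i j k m n : nat) (s t a b : R) (x y : X).
Local Notation d := mdist.
Local Notation pt := (pt Xgeo).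
Variables (z p c : X) (L0 : R) (N : nat) (shrink : R).
Hypothesis sch : contraction_scheme Delta lambda z p c L0 N shrink.
Hypothesis unique : unique_local_geodesics (completion (tangent_space c)).
Let Dc := sch_center sch.
Let N_gt0 := sch_N_gt0 sch.
Let eps := lambda * ((d z c + d c p - L0) / 2) / 4.
Local Notation scale k := (shrink ^+ k).
Local Notation vec := (vec rc sch).

Let eps0 : 0 < eps.
Proof. exact: (eps_gt0 rc sch). Qed.

Lemma vec_dist_lt k x y b : d (vec k x) (vec k y) < b ->
  exists K, forall m, (K <= m)%N -> (k <= m)%N ->
    d (pt c x (scale (m - k))) (pt c y (scale (m - k))) <= b * scale m.
Proof.
rewrite tangent_vector_dist => xyb.
have [[t [t0 tk tb]]|H] := pselect (exists t, [/\ 0 < t, t <= scale k &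
    germ_quot (germ rc c (scale_gt0 sch k) x) (germ rc c (scale_gt0 sch k) y) t <= b]).
  have [K HK] := scale_small sch t0; exists K => m Km km.
  rewrite -ler_pdivrMr ?(scale_gt0 sch)// -(vec_quot_le rc sch)//.
  apply: le_trans tb.
  exact: (germ_quot_le rc Dc _ _ _ _ (scale_gt0 sch m) (HK m Km) tk tk).
suff : b <= germ_dist (germ rc c (scale_gt0 sch k) x) (germ rc c (scale_gt0 sch k) y).
  by rewrite leNgt xyb.
apply: (le_germ_dist Dc) => t t0 tk _; rewrite leNgt; apply/negP => tb.
by apply: H; exists t; split=> //; exact: ltW.
Qed.

Section two_families.
Variables (W V : nat -> nat -> X) (l l' : nat -> R).
Hypothesis descW : descending rc z p c L0 N shrink W l.
Hypothesis descV : descending rc z p c L0 N shrink V l'.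
Local Notation pathW := (level_path rc N W).
Local Notation pathV := (level_path rc N V).

Lemma limit_point_dist_cvg t : 0 <= t <= 1 ->
  (fun k => d (vec k (pathW k t)) (vec k (pathV k t))) @ \oo -->
    d (limit_point sch descW t) (limit_point sch descV t).
Proof.
move=> t01; rewrite quotient_classE /= /cauchy_dist.
have := @cauchy_dist_cvg _ _ (CauchySequence (vec_path_cauchy sch descW t))
  (CauchySequence (vec_path_cauchy sch descV t)).
by rewrite /= t01.
Qed.

(** The limits are local geodesics with common ends, because the ends of the
    chains of all levels are prescribed. *)
Lemma limit_points_eq t : 0 <= t <= 1 -> limit_point sch descW t = limit_point sch descV t.
Proof.
have eq_at s : 0 <= s <= 1 -> (forall k, pathW k s = pathV k s) ->
    limit_point sch descW s = limit_point sch descV s.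
  move=> s01 E; apply: mdist_positivity.
  rewrite -(cvg_lim _ (@limit_point_dist_cvg _ s01))//.
  rewrite (_ : (fun k => _) = cst 0) ?lim_cst//; apply/funext => k.
  by rewrite E mdistxx.
have eq_nat i : (i <= N)%N -> (forall k, W k i = V k i) ->
    limit_point sch descW (i%:R / N%:R) = limit_point sch descV (i%:R / N%:R).
  move=> iN E; apply: eq_at => [|k]; last first.
    by rewrite /level_path !(chain_path_nat _ _ _ N_gt0) E.
  by rewrite divr_ge0//= ler_pdivrMr ?ltr0n// mul1r ler_nat.
have [levW _ _] := descW; have [levV _ _] := descV.
have E0 : limit_point sch descW 0 = limit_point sch descV 0.
  have := eq_nat 0%N (leq0n N); rewrite mul0r; apply => k.
  by have [_ -> _ _] := levW k; have [_ -> _ _] := levV k.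
have E1 : limit_point sch descW 1 = limit_point sch descV 1.
  have := eq_nat N (leqnn N); rewrite divff ?pnatr_eq0 -?lt0n//; apply => k.
  by have [_ _ -> _] := levW k; have [_ _ -> _] := levV k.
move=> t01; rewrite -(cpoint_curve01 (limit_point sch descW)).
rewrite -[RHS](cpoint_curve01 (limit_point sch descV)).
by apply: (unique (limit_point_local_geodesic sch descW) _ (limit_point_local_geodesic sch descV)).
Qed.

(** Both families are shadowed by contractions of the chains of one late level,
    and these contractions approach each other at the rate given by the distance
    of their directions. *)
Lemma families_close b i : 0 < b -> (i <= N)%N ->
  exists K, forall m, (K <= m)%N -> d (W m i) (V m i) <= b * scale m.
Proof.
move=> b0 iN; have b3 : 0 < b / 3 by rewrite divr_gt0.
have iN01 : 0 <= (i%:R / N%:R : R) <= 1.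
  by rewrite divr_ge0//= ler_pdivrMr ?ltr0n// mul1r ler_nat.
have [K1 HK1] := chain_shadow sch descW b3.
have [K2 HK2] := chain_shadow sch descV b3.
have := @limit_point_dist_cvg _ iN01; rewrite (@limit_points_eq _ iN01) mdistxx.
move=> /cvgrPdist_lt/(_ _ b3)[K3 _ HK3]; pose k := maxn K1 (maxn K2 K3).
have [k1 k2 k3] : [/\ (K1 <= k)%N, (K2 <= k)%N & (K3 <= k)%N].
  by rewrite /k !leq_max !leqnn !orbT.
have := HK3 k k3; rewrite /= sub0r normrN ger0_norm ?mdist_ge0//.
rewrite /level_path !(chain_path_nat _ _ _ N_gt0) => /vec_dist_lt[K4 HK4].
exists (maxn k K4) => m; rewrite geq_max => /andP[km k4].
have h1 := HK1 k m k1 km i iN; have h2 := HK2 k m k2 km i iN; have h3 := HK4 m k4 km.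
have h4 := metric_triangle (W m i) (pt c (W k i) (scale (m - k))) (V m i).
have h5 := metric_triangle (pt c (W k i) (scale (m - k)))
  (pt c (V k i) (scale (m - k))) (V m i).
by rewrite (metric_sym (W m i) (pt _ _ _)) in h4; lra.
Qed.

(** Nearby levels coincide, so that the coincidence of late levels propagates to
    the first one. *)
Lemma families_eq i : (i <= N)%N -> W 0%N i = V 0%N i.
Proof.
have [levW _ nearW] := descW; have [levV _ nearV] := descV.
have [M HM] : exists M, forall n, (M <= n)%N -> forall i, (i <= N)%N ->
    d (W n i) (V n i) <= eps * scale n.
  by apply: (@finite_uniform (fun i n => d (W n i) (V n i) <= eps * scale n)) => j jN;
     exact: families_close.
have eqM := level_unique sch (scale01 sch M) (levW M) (levV M) (HM M (leqnn M)).
have down k : (forall i, (i <= N)%N -> W k.+1 i = V k.+1 i) ->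
    forall i, (i <= N)%N -> W k i = V k i.
  move=> E; apply: (level_unique sch (scale01 sch k) (levW k) (levV k)) => j jN.
  have := nearW k j jN; have := nearV k j jN; rewrite E// -/eps.
  have := metric_triangle (W k j) (V k.+1 j) (V k j).
  have := mulr_gt0 eps0 (scale_gt0 sch k).
  by rewrite (metric_sym (W k j) (V k.+1 j)); lra.
move: i; elim: M eqM {HM} => // M IH E; apply/IH/down/E.
Qed.

End two_families.

Lemma level1_unique l l' w w' : level rc z p c L0 N 1 l w ->
  level rc z p c L0 N 1 l' w' -> forall i, (i <= N)%N -> w i = w' i.
Proof.
move=> /(levels_exist sch)[W [ll [<- _ levW stepW nearW]]].
move=> /(levels_exist sch)[V [ll' [<- _ levV stepV nearV]]].
exact: (families_eq (And3 levW stepW nearW) (And3 levV stepV nearV)).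
Qed.

End level_uniqueness.

Section local_geodesics.
Variables (R : realType) (X : metricType R) (Delta : set X) (lambda : R).
Hypothesis rc : relative_cat0 Delta lambda.
Hypothesis unique : forall c, Delta c ->
  unique_local_geodesics (completion (tangent_space c)).
Local Notation d := mdist.

Lemma exists_contraction_scheme z p c (L0 B : R) : Delta c ->
  (forall v, Delta v -> d z c + d c p <= d z v + d v p) -> 0 <= L0 ->
  L0 < d z c + d c p -> exists N shrink,
    B <= N%:R /\ contraction_scheme Delta lambda z p c L0 N shrink.
Proof.
move=> Dc nearest L00 L0lt.
set eps := lambda * ((d z c + d c p - L0) / 2) / 4.
have e0 : 0 < eps by rewrite divr_gt0// mulr_gt0 ?(rc_lambda rc)// divr_gt0// subr_gt0.
pose N := (Num.truncn `|Num.max B (8 * L0 / eps)|).+1.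
have BN : Num.max B (8 * L0 / eps) <= N%:R.
  have /truncn_itv/andP[_ /ltW] := normr_ge0 (Num.max B (8 * L0 / eps)).
  exact: le_trans (ler_norm _).
have {BN} [BN LN] : B <= N%:R /\ 8 * L0 / eps <= N%:R.
  by move: BN; rewrite ge_max => /andP[].
pose R0 := L0 + d z c; have R00 : 0 <= R0 by rewrite addr_ge0// mdist_ge0.
have LR0 : 0 <= 4 * L0 * R0 by rewrite !mulr_ge0.
pose h := Num.min (1 / 4) (Num.min (eps / 8 / (R0 + 1)) ((eps / 8) ^+ 2 / (4 * L0 * R0 + 1))).
have R01 : 0 < R0 + 1 by lra.
have LR1 : 0 < 4 * L0 * R0 + 1 by lra.
have e8 : 0 < eps / 8 by rewrite divr_gt0.
have h0 : 0 < h.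
  rewrite !lt_min; apply/and3P; split; first lra; first exact: divr_gt0.
  by rewrite divr_gt0// exprn_gt0.
have : h <= h by [].
rewrite {2}/h !le_min => /and3P[h1].
rewrite (ler_pdivlMr _ _ R01) (ler_pdivlMr _ _ LR1) => h2 h3.
exists N, (1 - h); split=> //; split=> //; rewrite -/eps ?subKr -/R0.
- by rewrite [eps * _]mulrC -ler_pdivrMr.
- lra.
- lra.
- lra.
- lra.
Qed.

Lemma local_geo_chain_discrete N L e (g : R -> X) : local_geo L e g ->
  2 / e <= N%:R -> (0 < N)%N ->
  discrete_geodesic N (L / N%:R) (fun i => g (i%:R / N%:R)).
Proof.
move=> [e0 ge] eN N0; have NR : 0 < N%:R :> R by rewrite ltr0n.
have N2 : 2 / N%:R <= e by rewrite ler_pdivrMr// mulrC -ler_pdivrMr.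
have q0 : 0 < N%:R^-1 :> R by rewrite invr_gt0.
have iN01 i : (i <= N)%N -> 0 <= (i%:R / N%:R : R) <= 1.
  by move=> iN; rewrite divr_ge0//= ler_pdivrMr// mul1r ler_nat.
have dif i k : `|i%:R / N%:R - (i + k)%:R / N%:R| = k%:R / N%:R :> R.
  by rewrite -mulrBl natrD opprD addNKr mulNr normrN ger0_norm// divr_ge0.
split=> i iN; rewrite ge ?iN01 ?(ltnW iN)//.
- by rewrite -addn1 dif mul1r.
- by rewrite -addn1 dif mul1r; move: (N%:R^-1) N2 q0 => q; lra.
- by rewrite -addn2 dif; move: (N%:R^-1) => q; ring.
- by rewrite ltnW// ltnW.
- by rewrite -addn2 dif.
Qed.

(** Local geodesics outside of [Delta] are shorter than any detour through
    [Delta], so that the contraction to the best detour applies. *)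
Lemma local_geo_unique L e g L' e' h : local_geo L e g -> local_geo L' e' h ->
  (forall t, 0 <= t <= 1 -> ~ Delta (g t)) ->
  (forall t, 0 <= t <= 1 -> ~ Delta (h t)) ->
  g 0 = h 0 -> g 1 = h 1 -> forall t, 0 <= t <= 1 -> g t = h t.
Proof.
move=> G H nG nH gh0 gh1 t t01; have [e0 _] := G; have [e'0 _] := H.
have L_ge0 := local_geo_speed_ge0 G; have L'_ge0 := local_geo_speed_ge0 H.
have [c Dc nearest] := exists_nearest_detour rc (g 0) (g 1).
have Llt := local_geo_lt_detour rc G nG Dc.
have L'lt := local_geo_lt_detour rc H nH Dc; rewrite -gh0 -gh1 in L'lt.
apply/mdist_positivity/eqP; rewrite eq_le mdist_ge0 andbT; apply/ler_addgt0Pl => a a0.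
rewrite addr0; pose L0 := Num.max L L'.
have L0_ge0 : 0 <= L0 by rewrite le_max L_ge0.
have L0lt : L0 < d (g 0) c + d c (g 1) by rewrite gt_max Llt.
have [LL0 L'L0] : L <= L0 /\ L' <= L0 by rewrite !le_max !lexx orbT.
have p1 : 0 <= 2 / e by rewrite divr_ge0// ltW.
have p2 : 0 <= 2 / e' by rewrite divr_ge0// ltW.
have p3 : 0 <= (L + L') / a by rewrite divr_ge0 ?addr_ge0// ltW.
have [N [shrink [BN sch]]] :=
  exists_contraction_scheme (2 / e + 2 / e' + (L + L') / a) Dc nearest L0_ge0 L0lt.
have N0 := sch_N_gt0 sch; have NR : 0 < N%:R :> R by rewrite ltr0n.
have lev M f (b : R) : local_geo M b f -> M <= L0 -> 2 / b <= N%:R ->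
    f 0 = g 0 -> f 1 = g 1 ->
    level rc (g 0) (g 1) c L0 N 1 (M / N%:R) (fun i => f (i%:R / N%:R)).
  move=> F ML0 bN f0 f1; split.
  - exact: local_geo_chain_discrete F bN N0.
  - by rewrite mul0r f0 (pt1 rc).
  - by rewrite divff ?gt_eqF// f1 (pt1 rc).
  - by rewrite mulrC divfK ?gt_eqF// mul1r.
have levg := lev L g e G LL0 ltac:(lra) erefl erefl.
have levh := lev L' h e' H L'L0 ltac:(lra) (esym gh0) (esym gh1).
have E := level1_unique sch (unique Dc) levg levh.
have tN0 : 0 <= t * N%:R by rewrite mulr_ge0 ?(ltW NR)//; case/andP: t01.
have /andP[i1 i2] := truncn_itv tN0; set i := Num.truncn _ in i1 i2.
have iN : (i <= N)%N.
  rewrite -(ler_nat R) (le_trans i1)// -[leRHS]mul1r ler_pM2r//.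
  by case/andP: t01.
have i01 : 0 <= (i%:R / N%:R : R) <= 1.
  by rewrite divr_ge0//= ler_pdivrMr// mul1r ler_nat.
have di : `|t - i%:R / N%:R| <= N%:R^-1.
  rewrite ger0_norm ?subr_ge0 ?ler_pdivrMr// -(ler_pM2r NR) mulrBl divfK ?gt_eqF//.
  by rewrite mulVf ?gt_eqF//; move: i2; rewrite -[in i.+1%:R]addn1 natrD; lra.
have h1 := local_geo_lipschitz G t01 i01; have h2 := local_geo_lipschitz H i01 t01.
rewrite distrC in h2; rewrite -(E i iN) in h2.
have h3 := metric_triangle (g t) (g (i%:R / N%:R)) (h t).
apply: (le_trans h3); apply: (@le_trans _ _ ((L + L') * `|t - i%:R / N%:R|)); first lra.
apply: (@le_trans _ _ ((L + L') / N%:R)); first by rewrite ler_wpM2l// addr_ge0.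
by rewrite ler_pdivrMr// mulrC -ler_pdivrMr//; lra.
Qed.

End local_geodesics.

(** * Geodesics with a common endpoint outside the convex set *)

Lemma sub_geo01 (R : realType) (X : metricType R) (g : R -> X) p q (a b : R) :
  geo01 g p q -> 0 <= a -> a <= b -> b <= 1 ->
  geo01 (fun t => g (a + t * (b - a))) (g a) (g b).
Proof.
move=> [g0 g1 gE] a0 ab b1; split.
- by rewrite mul0r addr0.
- by rewrite mul1r addrC subrK.
move=> s t s01 t01.
have in01 r : 0 <= r <= 1 -> 0 <= a + r * (b - a) <= 1 by move=> r01; nra.
rewrite !gE ?in01//; [|lra..].
have -> : a + s * (b - a) - (a + t * (b - a)) = - ((a - b) * (s - t)) by ring.
by rewrite normrN normrM mulrA.
Qed.

Lemma geo01_local_geo (R : realType) (X : metricType R) (g : R -> X) p q :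
  geo01 g p q -> local_geo (mdist p q) 1 g.
Proof. by move=> [_ _ gE]; split=> // s t s01 t01 _; exact: gE. Qed.

Lemma cat0_ball_le (R : realType) (X : metricType R) (w : X) (r s : R) :
  s <= r -> cat0_ball w r -> cat0_ball w s.
Proof.
by move=> sr H x p m q wx wp wm wq; apply: H => //; apply: le_trans sr.
Qed.

Lemma convex_seq_le (R : realType) (rho : nat -> R) N :
  (forall i, (i.+2 <= N)%N -> rho i.+1 <= (rho i + rho i.+2) / 2) ->
  (forall i, (i <= N)%N -> rho N <= rho i) ->
  forall i, (i <= N)%N -> rho i <= rho 0%N.
Proof.
move=> conv last.
have dec k : forall i, (i + k.+1)%N = N -> rho i.+1 <= rho i.
  elim: k => [|k IH] i iN; first by rewrite -[i.+1]addn1 iN last// -iN leq_addr.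
  have : rho i.+2 <= rho i.+1 by apply: IH; rewrite addSnnS.
  have := conv i; rewrite -iN -[i.+2]addn2 leq_add2l => /(_ isT).
  by rewrite addn2; lra.
elim=> [//|i IH] iN; apply: le_trans (IH (ltnW iN)).
by apply: (dec (N - i.+1)%N); rewrite addnS -addSn subnKC.
Qed.

Section nearby_geodesics.
Variables (R : realType) (X : metricType R) (Delta : set X) (lambda : R).
Hypothesis rc : relative_cat0 Delta lambda.
Hypothesis unique : forall c, Delta c ->
  unique_local_geodesics (completion (tangent_space c)).
Let Xgeo := rc_geodesic rc.
Implicit Types (x y z : X) (g h : R -> X) (i : nat) (t mu : R).
Local Notation d := mdist.

(** The triangle inequality: the detour through a point of [Delta] near the
    geodesic exceeds its length by at most twice the distance. *)
Lemma geodesic_clearance g y z : geo01 g y z ->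
  (forall t, 0 <= t <= 1 -> ~ Delta (g t)) ->
  exists2 mu, 0 < mu & forall t, 0 <= t <= 1 -> far Delta mu (g t).
Proof.
move=> G nD; have [g0 g1 _] := G.
have [c Dc nearest] := exists_nearest_detour rc y z.
have := local_geo_lt_detour rc (geo01_local_geo G) nD Dc; rewrite g0 g1 => lt.
exists ((d y c + d c z - d y z) / 2) => [|t t01 v Dv]; first by rewrite divr_gt0// subr_gt0.
have := nearest v Dv; have := geo01_btw G t01; rewrite /btw.
have := metric_triangle y (g t) v; have := metric_triangle v (g t) z.
by rewrite (metric_sym v (g t)); lra.
Qed.

(** Moving an endpoint of the geodesic [g] slightly, its subdivision can be
    relaxed to a local geodesic nearby. By uniqueness this is the geodesic
    between the new endpoints; its distance from [g] is a convex function. *)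
Lemma geodesic_perturbation (L0 mu : R) : 0 <= L0 -> 0 < mu ->
  exists2 e, 0 < e & forall x y z g h, geo01 g y z -> d y z <= L0 ->
    (forall t, 0 <= t <= 1 -> far Delta mu (g t)) -> d x y <= e -> geo01 h x z ->
    forall t, 0 <= t <= 1 -> d (g t) (h t) <= d x y.
Proof.
move=> L00 mu0; have la0 := rc_lambda rc.
pose e := Num.min (lambda * mu / 4) (mu / 4).
have e0 : 0 < e by rewrite lt_min !divr_gt0// mulr_gt0.
have [e1 e2] : e <= lambda * mu / 4 /\ e <= mu / 4 by rewrite !ge_min !lexx orbT.
pose N := (Num.truncn (8 * L0 / e)).+1.
have N0 : (0 < N)%N by [].
have NR : 0 < N%:R :> R by rewrite ltr0n.
have NL : 8 * L0 <= N%:R * e.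
  rewrite -ler_pdivrMr//; apply: ltW.
  have q0 : 0 <= 8 * L0 / e by rewrite divr_ge0 ?mulr_ge0// ltW.
  by have /truncn_itv/andP[] := q0.
have D0 : 0 < 6 * L0 + N%:R by rewrite ltr_wpDl// mulr_ge0.
pose s := Num.min (Num.min 1 (e / 8)) ((e / 8) ^+ 2 / (6 * L0 + N%:R)).
have s0 : 0 < s.
  have e8 : 0 < e / 8 by rewrite divr_gt0.
  by rewrite !lt_min ltr01 e8 divr_gt0// exprn_gt0.
have [s1 s2 s3] : [/\ s <= 1, s <= e / 8 & s * (6 * L0 + N%:R) <= (e / 8) ^+ 2].
  split; [| |rewrite -ler_pdivlMr//]; rewrite /s !ge_min lexx ?orbT//.
exists s => // x y z g h G yzL gfar xys H.
have [g0 g1 gE] := G; have [h0 h1 hE] := H.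
pose w i := g (i%:R / N%:R); pose l := d y z / N%:R.
have i01 i : (i <= N)%N -> 0 <= (i%:R / N%:R : R) <= 1.
  by move=> iN; rewrite divr_ge0//= ler_pdivrMr// mul1r ler_nat.
have w0 : w 0%N = y by rewrite /w mul0r.
have wN : w N = z by rewrite /w divff ?gt_eqF.
have NlE : N%:R * l = d y z by rewrite /l mulrC divfK ?gt_eqF.
have l0 : 0 <= l by rewrite divr_ge0 ?mdist_ge0.
have le8 : 8 * l <= e.
  by rewrite -(ler_pM2l NR) mulrCA NlE; lra.
have dif i k : `|i%:R / N%:R - (i + k)%:R / N%:R| = k%:R / N%:R :> R.
  by rewrite -mulrBl natrD opprD addNKr mulNr normrN ger0_norm// divr_ge0.
have wd i k : (i + k <= N)%N -> d (w i) (w (i + k)%N) = k%:R * l.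
  move=> ikN; rewrite /w gE ?i01// ?(leq_trans (leq_addr _ _) ikN)// dif /l.
  by rewrite mulrCA mulrA.
have wg : discrete_geodesic N l w.
  by split=> i iN; [rewrite -addn1 wd ?addn1// mul1r|rewrite -addn2 wd ?addn2].
have wb i : (i <= N)%N -> cat0_ball (w i) (2 * (2 * e)).
  move=> iN; apply: (@cat0_ball_le _ _ _ (lambda * mu)); first lra.
  by apply: (rc_ball rc) => //; exact: gfar (i01 i iN).
pose u i := if i is 0%N then x else w i.
have u0 : d (u 0%N) (w 0%N) = d x y by rewrite w0.
have us i : d (u i) (w i) <= s by case: i => [|i]; rewrite ?u0// /u mdistxx ltW.
have ue i : (i <= N)%N -> d (u i) (w i) <= e by move=> _; have := us i; lra.
have uN : d (u N) (w N) <= d x y by rewrite /u mdistxx mdist_ge0.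
have xy0 := mdist_ge0 x y.
pose eta := 2 * l * d x y + d x y ^+ 2.
have Eu : energy N u <= N%:R * l ^+ 2 + eta.
  rewrite -(energy_discrete_geodesic wg) /energy !(big_ltn N0).
  rewrite (eq_big_nat _ _ (F2 := fun i => d (w i) (w i.+1) ^+ 2)); last by case.
  rewrite [u 0%N]/= [u 1%N]/=; set S := \sum_(1 <= i < N) _.
  have -> : d (w 0%N) (w 1%N) = l by case: wg => ->.
  have : d x (w 1%N) <= d x y + l.
    apply: (le_trans (metric_triangle _ y _)); rewrite lerD2l -{1}w0.
    by case: wg => ->.
  have := mdist_ge0 x (w 1%N); rewrite /eta; nra.
have NE : N%:R * (eta + 4 * l * d x y) <= (e / 8) ^+ 2.
  have -> : N%:R * (eta + 4 * l * d x y) = d x y * (6 * (N%:R * l) + N%:R * d x y).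
    by rewrite /eta; ring.
  apply: le_trans s3; rewrite NlE; apply: ler_pM => //.
    by rewrite addr_ge0 ?mulr_ge0 ?mdist_ge0// ltW.
  have : N%:R * d x y <= N%:R * 1 by rewrite ler_pM2l//; lra.
  by lra.
have xye : d x y <= e / 8 by lra.
have [w' [l' [w'g w'0 w'N w'w El']]] := @exists_discrete_geodesic R X Xgeo
  (rc_complete rc) N l e (d x y) eta w u N0 wg e0 wb le8 ue
  ltac:(by rewrite u0) uN xye Eu NE.
have {}w'0 : w' 0%N = x by rewrite w'0.
have {}w'N : w' N = z by rewrite w'N -wN.
have P := chain_path_local_geo Xgeo N0 w'g; set pa := chain_path _ _ _ in P.
have pa_nat i : pa (i%:R / N%:R) = w' i by exact: chain_path_nat.
have pa0 : pa 0 = x by have := pa_nat 0%N; rewrite mul0r => ->.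
have pa1 : pa 1 = z by have := pa_nat N; rewrite divff ?gt_eqF// => ->.
have npa t : 0 <= t <= 1 -> ~ Delta (pa t).
  move=> t01; rewrite /pa; have [i tau iN tau01 _|_] := chain_pathP Xgeo w' N0 t01.
    have G' := pt_geo01 Xgeo (w' i) (w' i.+1); have tau01' : 0 <= tau <= 1 by lra.
    apply: (@far_notin _ _ _ (mu - d (w i) (pt Xgeo (w' i) (w' i.+1) tau))); last first.
      by apply: far_lipschitz; exact: gfar (i01 i (ltnW iN)).
    have := metric_triangle (w i) (w' i) (pt Xgeo (w' i) (w' i.+1) tau).
    rewrite (geo01_dist0 G' tau01') (metric_sym (w i) (w' i)).
    have := w'w i (ltnW iN); have := w'w i.+1 iN.
    have := metric_triangle (w' i) (w i) (w' i.+1).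
    have := metric_triangle (w i) (w i.+1) (w' i.+1).
    rewrite (metric_sym (w i.+1)); case: (wg) => -> // _.
    have : tau * d (w' i) (w' i.+1) <= 1 * d (w' i) (w' i.+1).
      by rewrite ler_wpM2r ?mdist_ge0//; lra.
    lra.
  rewrite w'N -g1; apply: far_notin mu0 _; apply: gfar; lra.
(* The path [pa] is no shorter than [h], but it is shorter than any detour
   through [Delta], so that [h] avoids [Delta] as well. *)
have xzl : d x z <= N%:R * l'.
  by have := chain_dist_le (i := 0%N) (k := N) w'g (leqnn N); rewrite add0n w'0 w'N.
have nh t : 0 <= t <= 1 -> ~ Delta (h t).
  move=> t01 Dh; have := local_geo_lt_detour rc P npa Dh; rewrite pa0 pa1.
  by rewrite (geo01_btw H t01) ltNge xzl.
have hpa : forall t, 0 <= t <= 1 -> h t = pa t.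
  apply: (local_geo_unique rc unique (geo01_local_geo H) P nh npa).
    by rewrite h0 pa0.
  by rewrite h1 pa1.
have hw' i : (i <= N)%N -> h (i%:R / N%:R) = w' i by move=> iN; rewrite hpa ?i01.
pose rho i := d (w i) (w' i).
have fellow i k tau : (0 < k)%N -> (k <= 2)%N -> (i + k <= N)%N -> 0 <= tau <= 1 ->
    d (g (i%:R / N%:R + tau * ((i + k)%:R / N%:R - i%:R / N%:R)))
      (h (i%:R / N%:R + tau * ((i + k)%:R / N%:R - i%:R / N%:R))) <=
    (1 - tau) * rho i + tau * rho (i + k)%N.
  move=> k0 k2 ikN tau01; have iN : (i <= N)%N := leq_trans (leq_addr _ _) ikN.
  have ik : (i%:R / N%:R : R) <= (i + k)%:R / N%:R.
    by rewrite ler_pM2r ?invr_gt0// ler_nat leq_addr.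
  have /andP[ia _] := i01 i iN; have /andP[_ kb] := i01 _ ikN.
  have Gs := sub_geo01 G ia ik kb; have Hs := sub_geo01 H ia ik kb.
  rewrite !hw'// -/(w i) -/(w (i + k)%N) in Gs Hs.
  rewrite [rho (i + k)%N]/rho.
  have kl : k%:R * l <= 2 * l by rewrite ler_wpM2r// ler_nat.
  apply: (cat0_fellow Xgeo (wb i iN) Gs Hs tau01).
  - by rewrite mdistxx; lra.
  - by rewrite metric_sym; have := w'w i iN; lra.
  - have := metric_triangle (w i) (w (i + k)%N) (w' (i + k)%N).
    rewrite (wd i k ikN) (metric_sym (w (i + k)%N)); have := w'w _ ikN; lra.
  - by rewrite (wd i k ikN); lra.
have rho0 : rho 0%N = d x y by rewrite /rho w0 w'0 metric_sym.
have rho_le i : (i <= N)%N -> rho i <= d x y.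
  rewrite -rho0; apply: convex_seq_le => {}i iN.
    have half : 0 <= (1 / 2 : R) <= 1 by lra.
    have := fellow i 2%N (1 / 2) isT isT; rewrite addn2 => /(_ iN half).
    have -> : i%:R / N%:R + 1 / 2 * (i.+2%:R / N%:R - i%:R / N%:R) = i.+1%:R / N%:R :> R.
      rewrite -[in i.+2%:R]addn2 -[in i.+1%:R]addn1 !natrD.
      by move: (N%:R^-1) => q; field.
    by rewrite hw' ?(ltnW iN)// -/(w _) -/(rho _); lra.
  by rewrite {1}/rho wN w'N mdistxx mdist_ge0.
move=> t t01; have tN0 : 0 <= t * N%:R by rewrite mulr_ge0 ?(ltW NR)//; case/andP: t01.
have /andP[i1 i2] := truncn_itv tN0; set i := Num.truncn _ in i1 i2.
have [t1|t1] := eqVneq t 1; first by rewrite t1 g1 h1 mdistxx.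
have iN : (i < N)%N.
  rewrite -(ltr_nat R) (le_lt_trans i1)// -[ltRHS]mul1r ltr_pM2r// lt_neqAle t1.
  by case/andP: t01.
have tau01 : 0 <= t * N%:R - i%:R <= 1.
  by rewrite subr_ge0 i1; move: i2; rewrite -[in i.+1%:R]addn1 natrD; lra.
have := fellow i 1%N _ isT isT; rewrite addn1 => /(_ _ iN tau01).
have -> : i%:R / N%:R + (t * N%:R - i%:R) * (i.+1%:R / N%:R - i%:R / N%:R) = t.
  rewrite -[in i.+1%:R]addn1 natrD; field; exact: lt0r_neq0.
move=> h5; apply: (le_trans h5).
have := rho_le i (ltnW iN); have := rho_le i.+1 iN; nra.
Qed.

End nearby_geodesics.

(** * Gluing comparison triangles along a common side *)

Section glue_arithmetic.
Variables (R : realType) (chi : R).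
Hypothesis chi_le0 : chi <= 0.
Local Notation sn := (sn chi).
Local Notation md := (md chi).
Local Notation cs := (cs chi).
Local Notation K := (stewart_defect chi).

Lemma stewart_defect_sn a b :
  K a b * (sn a + sn b + sn (a + b)) = 2 * sn a * sn b * md (a + b).
Proof.
rewrite /K snD// mdD// /cs; have := sn2 chi_le0 b; have := sn2 chi_le0 a.
move: (sn a) (sn b) (md a) (md b) => sa sb ma mb ea eb.
by ring: ea eb.
Qed.

(** If the modified distance satisfies the comparison inequality, then [sn] of
    the distance satisfies the homogeneous one. *)
Lemma sn_subsolution a b n n0 m : 0 <= a -> 0 <= b -> 0 <= n -> 0 <= n0 -> 0 <= m ->
  `|n0 - m| <= a + b -> sn (a + b) * md n + K a b <= sn b * md n0 + sn a * md m ->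
  sn (a + b) * sn n <= sn b * sn n0 + sn a * sn m.
Proof.
move=> a0 b0 n_ge0 n00 m0 nm E.
have sa := sn_ge0 chi a0; have sb := sn_ge0 chi b0.
have sab : 0 <= sn (a + b) by rewrite sn_ge0// addr_ge0.
have [sn_n sn_n0 sn_m] : [/\ 0 <= sn n, 0 <= sn n0 & 0 <= sn m] by rewrite !sn_ge0.
rewrite -ler_sqr ?nnegrE ?(mulr_ge0 sab sn_n) ?addr_ge0 ?mulr_ge0//.
have : md (n0 - m) <= md (a + b) by rewrite -md_norm ler_md.
rewrite mdB// => le; have {}le := ler_wpM2l (mulr_ge0 sa sb) le.
have KE := stewart_defect_sn a b; have sE := snDE chi_le0 a b.
have := sn2 chi_le0 n; have := sn2 chi_le0 n0; have := sn2 chi_le0 m.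
have mn0 := mulr_ge0 sab (md_ge0 chi n); move: mn0 sab E KE sE le; move: (sn (a + b)) (md (a + b)) (sn a) (sn b) (K a b) => s M s1 s2 k.
move: (sn n) (sn n0) (sn m) (md n) (md n0) (md m) => tn t0 t1 mn m0' m1.
move=> mn0 sab E KE sE le e1 e0 en; set F := s2 * m0' + s1 * m1 - k.
have F1 : s * mn <= F by rewrite /F; lra.
have -> : (s * tn) ^+ 2 = 2 * s * (s * mn) - chi * (s * mn) ^+ 2.
  by rewrite exprMn en; ring.
have -> : (s2 * t0 + s1 * t1) ^+ 2 = s2 ^+ 2 * t0 ^+ 2 + s1 ^+ 2 * t1 ^+ 2 +
    2 * (s1 * s2 * (t0 * t1)) by ring.
rewrite e1 e0.
have KE' : k * (2 * (s1 + s2) - chi * k) = 2 * s1 * s2 * M by rewrite -KE sE; ring.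
apply: (@le_trans _ _ (2 * s * F - chi * F ^+ 2)).
  apply: lerD; first by rewrite ler_wpM2l// mulr_ge0.
  by rewrite -!mulNr ler_wpM2l ?oppr_ge0// lerXn2r ?nnegrE// (le_trans mn0).
rewrite /F sE; move: le KE'; lra.
Qed.

End glue_arithmetic.

Section glue.
Variables (R : realType) (chi : R).
Hypothesis chi_le0 : chi <= 0.
Local Notation sn := (sn chi).
Local Notation md := (md chi).
Local Notation cs := (cs chi).
Local Notation K := (stewart_defect chi).
Local Notation M := (model_surface chi).
Local Notation polar := (polar chi).

(** By the addition theorem, [md] of a distance increased by a constant is a
    combination of [md] and [sn] of the distance, and both satisfy their
    comparison inequalities. *)
Lemma stewart_prolong (X : metricType R) (x y p q z : X) :
  btw x y p -> btw x y z -> btw p q z -> stewart chi y p q z -> stewart chi x p q z.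
Proof.
rewrite /btw => xyp xyz pqz st.
have tri : `|mdist y p - mdist y z| <= mdist p q + mdist q z.
  by rewrite pqz; exact: mdist_lipschitz.
have := sn_subsolution chi_le0 (mdist_ge0 p q) (mdist_ge0 q z) (mdist_ge0 y q)
  (mdist_ge0 y p) (mdist_ge0 y z) tri st.
have xq : md (mdist x q) <= md (mdist x y + mdist y q).
  by rewrite ler_md ?mdist_ge0//; exact: metric_triangle.
have s0 : 0 <= sn (mdist p q + mdist q z) by rewrite sn_ge0// addr_ge0// mdist_ge0.
have := ler_wpM2l s0 xq; move: st; rewrite /stewart -xyp -xyz !mdD//.
have sE := snDE chi_le0 (mdist p q) (mdist q z); rewrite {}sE.
have := cs_ge1 chi_le0 (mdist x y); rewrite /cs => cs1.
have := sn_ge0 chi (mdist_ge0 x y); move: (sn (mdist x y)) (md (mdist x y)) cs1 => r a cs1 r0.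
set k := K _ _.
move: (md (mdist x q)) (md (mdist y q)) (md (mdist y p)) (md (mdist y z)) => X0 N0 N1 N2.
move: (sn (mdist y q)) (sn (mdist y p)) (sn (mdist y z)) => T0 T1 T2.
move: (sn (mdist p q)) (sn (mdist q z)) => s1 s2 st le1 le2.
have {}st := ler_wpM2l (le_trans ler01 cs1) st; have {}le2 := ler_wpM2l r0 le2.
lra.
Qed.

Lemma stewart_concat (X : metricType R) (x p q z : X) :
  btw x p z -> btw p q z -> stewart chi x p q z.
Proof.
move=> xpz pqz; apply: (stewart_prolong (y := p)) => //.
  by rewrite /btw mdistxx addr0.
rewrite /stewart; have := stewart_identity chi_le0 (mdist p q) (mdist q z) (- mdist p q).
rewrite mdN subrr opprK mdistxx md0 (addrC (mdist q z)) -pqz => ->.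
by [].
Qed.

Lemma polar_angle (X : metricType R) (o x y : X) :
  0 < mdist o x -> 0 < mdist o y -> exists u v, [/\ u ^+ 2 + v ^+ 2 = 1, 0 <= v &
    md (mdist x y) = md (mdist o x) + md (mdist o y) -
      chi * md (mdist o x) * md (mdist o y) - sn (mdist o x) * sn (mdist o y) * u].
Proof.
set a := mdist o x; set b := mdist o y => a0 b0.
have ab : 0 < sn a * sn b by rewrite mulr_gt0// sn_gt0.
pose u := (md a + md b - chi * md a * md b - md (mdist x y)) / (sn a * sn b).
have uE : sn a * sn b * u = md a + md b - chi * md a * md b - md (mdist x y).
  by rewrite mulrC divfK// gt_eqF.
have u1 : u <= 1.
  rewrite ler_pdivrMr// mul1r.
  have : md (a - b) <= md (mdist x y).
    by rewrite -md_norm ler_md// mdist_lipschitz.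
  by rewrite mdB//; lra.
have uN1 : -1 <= u.
  rewrite ler_pdivlMr//.
  have : md (mdist x y) <= md (a + b).
    by rewrite ler_md ?mdist_ge0// /a (metric_sym o x) metric_triangle.
  by rewrite mdD//; lra.
have u2 : 0 <= 1 - u ^+ 2 by nra.
exists u, (Num.sqrt (1 - u ^+ 2)); split; [|exact: sqrtr_ge0|by rewrite uE; ring].
by rewrite sqr_sqrtr// subrKC.
Qed.

Lemma mdist_polarE (X : metricType R) (x y : X) a b (u v u' v' : R) :
  0 <= a -> 0 <= b -> u ^+ 2 + v ^+ 2 = 1 -> u' ^+ 2 + v' ^+ 2 = 1 ->
  md (mdist x y) = md a + md b - chi * md a * md b - sn a * sn b * (u * u' + v * v') ->
  mdist (polar a u v) (polar b u' v') = mdist x y.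
Proof.
move=> a0 b0 uv uv' E; apply: (md_inj chi_le0); rewrite ?mdist_ge0// E.
exact: mdist_polar.
Qed.

Lemma mdist_polar_ray a b (u v : R) : 0 <= a -> 0 <= b -> u ^+ 2 + v ^+ 2 = 1 ->
  mdist (polar a u v) (polar b u v) = `|a - b|.
Proof.
move=> a0 b0 uv; apply: (md_inj chi_le0); rewrite ?mdist_ge0// mdist_polar//.
by rewrite md_norm mdB// -!expr2 uv mulr1.
Qed.

(** With [(u1, v1)] and [(u2, - v2)] unit vectors in the upper and the lower half
    plane, an angle of at least the straight angle on the side of [(1, 0)]. *)
Lemma wide_angle (u1 v1 u2 v2 : R) : u1 ^+ 2 + v1 ^+ 2 = 1 -> u2 ^+ 2 + v2 ^+ 2 = 1 ->
  0 <= v1 -> 0 <= v2 -> u2 != 1 -> u1 * v2 + u2 * v1 <= 0 -> u2 <= - u1.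
Proof.
move=> e1 e2 v10 v20 u21 S; rewrite leNgt; apply/negP => lt.
have E : (u1 * v2 + u2 * v1) * (v1 + v2) = (u1 + u2) * (1 - u1 * u2 + v1 * v2).
  have e1' : v1 ^+ 2 = 1 - u1 ^+ 2 by lra.
  have e2' : v2 ^+ 2 = 1 - u2 ^+ 2 by lra.
  by ring: e1' e2'.
have : (u1 * v2 + u2 * v1) * (v1 + v2) <= 0 by rewrite mulr_le0_ge0// addr_ge0.
have u12 : 0 < u1 + u2 by lra.
rewrite E pmulr_rle0// => F.
have v12 := mulr_ge0 v10 v20.
have : (u1 - u2) ^+ 2 + (v1 + v2) ^+ 2 <= 0 by lra.
have := sqr_ge0 (u1 - u2); have := sqr_ge0 (v1 + v2) => h1 h2 h3.
have /eqP : (u1 - u2) ^+ 2 = 0 by lra.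
rewrite sqrf_eq0 subr_eq0 => /eqP uu.
have : u2 ^+ 2 = 1 by move: F; rewrite uu in e1 *; nra.
by move=> /eqP; rewrite sqrf_eq1 (negbTE u21)/= => /eqP; lra.
Qed.

(** Up to a factor, the difference of the two sides is the second coordinate of
    [model_line] between points on different sides of the axis. *)
Lemma exists_crossing (A B l : R) : 0 < A -> 0 <= B -> 0 < l ->
  exists2 t, 0 <= t <= l & sn (l - t) * A = sn t * B.
Proof.
move=> A0 B0 l0; pose f t := sn (l - t) * A - sn t * B.
have cf : {within `[0, l], continuous f}.
  apply: continuous_subspaceT => t; apply: cvgB.
    apply: cvgMr_tmp; apply: (@continuous_comp _ _ _ (fun t => l - t) sn).
      by apply: cvgB; [exact: cvg_cst|exact: cvg_id].
    exact: sn_continuous.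
  by apply: cvgMr_tmp; exact: sn_continuous.
have f0l : f l <= 0 <= f 0.
  rewrite /f subrr subr0 sn0 mul0r sub0r mul0r subr0 oppr_le0.
  by rewrite !mulr_ge0 ?sn_ge0 ?(ltW l0) ?(ltW A0).
have [|t] := IVT (ltW l0) cf (v := 0).
  by case/andP: f0l => h1 h2; rewrite ge_min le_max h1 h2 !orbT.
by rewrite in_itv /= => t01 ft; exists t => //; apply/eqP; rewrite -subr_eq0; apply/eqP.
Qed.

Lemma sn_surjective y e : 0 <= e -> 0 <= y -> y <= sn e -> exists2 a, 0 <= a <= e & sn a = y.
Proof.
move=> e0 y0 ye; have [|a] := @IVT _ sn 0 e y e0 (continuous_subspaceT (@sn_continuous R chi)).
  by rewrite sn0 ge_min le_max y0 ye orbT.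
by rewrite in_itv /=; exists a.
Qed.

Let curvature_radius_gt0 : 0 < (if chi < 0 then curv chi else 1).
Proof. by case: ifP => // h; exact: curv_gt0. Qed.

Lemma polar0 (u v u' v' : R) : polar 0 u v = polar 0 u' v'.
Proof. by rewrite /polar sn0 mulr0 !mul0r. Qed.

(** The sign of [sin (theta1 + theta2) = u1 * v2 + u2 * v1] decides which half of
    the axis the segment crosses; as [t] tends to [0] the crossing point tends to
    the origin, so that its distance from the origin is at most [e]. *)
Lemma polar_crossing b t e (u1 v1 u2 v2 : R) : 0 < b -> 0 < t -> 0 <= e ->
  u1 ^+ 2 + v1 ^+ 2 = 1 -> u2 ^+ 2 + v2 ^+ 2 = 1 -> 0 <= v1 -> 0 < v2 ->
  0 <= u1 * v2 + u2 * v1 -> sn t * (u1 * v2 + u2 * v1) <= sn e * v2 ->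
  exists2 a, 0 <= a <= e &
    mdist (polar b u2 v2) (polar a 1 0) + mdist (polar a 1 0) (polar t u1 (- v1)) =
    mdist (polar b u2 v2) (polar t u1 (- v1)).
Proof.
move=> b0 t0 e0 e1 e2 v10 v20 S0 Se; have kap0 := curvature_radius_gt0.
set x := polar b u2 v2; set q := polar t u1 (- v1); pose l := mdist x q.
have sb := sn_gt0 chi b0; have st := sn_gt0 chi t0.
have xq : x != q.
  apply/eqP => /(congr1 (fun r => r.2)) /= h.
  have : 0 < (if chi < 0 then curv chi else 1) * sn b * v2 by rewrite !mulr_gt0.
  by rewrite h mulrN oppr_gt0 ltNge !mulr_ge0// ltW.
have l0 : 0 < l by rewrite mdist_gt0.
have sl := sn_gt0 chi l0.
have [s sl01 sE] := exists_crossing (mulr_gt0 sb v20) (mulr_ge0 (ltW st) v10) l0.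
have /andP[s0 s_l] := sl01.
pose y := (sn (l - s) * (sn b * u2) + sn s * (sn t * u1)) / sn l.
have yE : y * v2 = sn s / sn l * (sn t * (u1 * v2 + u2 * v1)).
  have -> : y * v2 = (sn (l - s) * (sn b * v2) * u2 + sn s * (sn t * u1) * v2) / sn l.
    by rewrite /y; ring.
  by rewrite sE; ring.
have ss0 : 0 <= sn s / sn l by rewrite divr_ge0 ?sn_ge0// ltW.
have ss1 : sn s / sn l <= 1 by rewrite ler_pdivrMr// mul1r ler_sn.
have tS : 0 <= sn t * (u1 * v2 + u2 * v1) by rewrite mulr_ge0// ltW.
have y0 : 0 <= y by rewrite -(pmulr_lge0 _ v20) yE mulr_ge0.
have ye : y <= sn e.
  by rewrite -(ler_pM2r v20) yE (le_trans _ Se)// ler_piMl.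
have [a ae aE] := sn_surjective e0 y0 ye; exists a => //.
have -> : polar a 1 0 = model_line x q s.
  rewrite /polar aE /model_line -/l /x /q /=; congr (_, _).
    by rewrite mulr1 /y; ring.
  rewrite mulr0; set kap := (if _ then _ else _).
  have -> : sn (l - s) * (kap * sn b * v2) + sn s * (kap * sn t * - v1) =
    kap * (sn (l - s) * (sn b * v2) - sn s * (sn t * v1)) by ring.
  by rewrite sE subrr mulr0 mul0r.
have ll : 0 <= l <= mdist x q by rewrite ltW//=.
have l00 : 0 <= (0 : R) <= mdist x q by rewrite lexx mdist_ge0.
have := mdist_model_line chi_le0 xq l00 sl01.
have := mdist_model_line chi_le0 xq sl01 ll.
rewrite model_line0// model_line1// => -> ->.
by rewrite sub0r normrN (ger0_norm s0) distrC ger0_norm ?subr_ge0// subrKC.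
Qed.

(** Two triangles [x, p, p'] and [z, p, p'] such that [p'] lies between [x] and
    [z]. Comparison triangles are placed on the two sides of the axis. If the
    segment from [x] to a point [q] near [p] crosses the common side, then
    comparison with the points of that side gives the comparison for [q].
    Otherwise [p] lies between [x] and [z], or [p'] between [x] and [p]. *)
Lemma stewart_glue (X : metricType R) (x p p' z : X) (f k : R -> X) (t0 : R) :
  geo01 f p p' -> geo01 k p z -> 0 < mdist p z -> mdist p p' < mdist x p ->
  btw x p' z -> 0 < t0 <= 1 ->
  (forall s, 0 <= s <= 1 -> stewart chi z p (f s) p') ->
  (forall s, 0 <= s <= 1 -> stewart chi x p (f s) p') ->
  (forall s t, 0 <= s <= 1 -> 0 < t <= t0 -> stewart chi (f s) p (k t) z) ->
  exists2 t, 0 < t <= t0 & stewart chi x p (k t) z.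
Proof.
move=> F G c0 eb xpz /andP[t00 t01] H2 H3 H4.
have t0E : 0 < t0 <= t0 by rewrite t00 lexx.
have k01 t : 0 < t <= t0 -> 0 <= t <= 1.
  by move=> /andP[/ltW -> tt]; rewrite (le_trans tt).
have [e0|e0] := eqVneq (mdist p p') 0.
  exists t0 => //; apply: stewart_concat; last exact: geo01_btw G (k01 _ t0E).
  by have -> : p = p' by exact: mdist_positivity.
set e := mdist p p' in e0 eb *; set c := mdist p z in c0 *.
have {}e0 : 0 < e by rewrite lt_neqAle eq_sym e0 mdist_ge0.
have b0 : 0 < mdist p x by rewrite metric_sym (lt_trans e0).
set b := mdist p x in b0; have bE : mdist x p = b by rewrite metric_sym.
have [u1 [v1 [uv1 v10 z1]]] := polar_angle e0 c0.
have [u2 [v2 [uv2 v20 x2]]] := polar_angle e0 b0.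
rewrite -/e -/c -/b in z1 x2 *.
have [u21|u21] := eqVneq u2 1.
  exists t0 => //; have kt := k01 _ t0E.
  apply: (stewart_prolong (y := p')) => //; last 2 first.
  - exact: geo01_btw G kt.
  - by have [_ <- _] := F; apply: H4 => //; rewrite lexx ler01.
  rewrite /btw (metric_sym p' p) -/e bE (metric_sym x).
  suff -> : mdist p' x = b - e by rewrite subrK.
  apply: (md_inj chi_le0); rewrite ?mdist_ge0 ?subr_ge0 -?bE ?(ltW eb)// bE.
  by rewrite x2 u21 mulr1 mdB//; ring.
have [S0|S0] := leP (u1 * v2 + u2 * v1) 0.
  exists t0 => //; apply: stewart_concat; last exact: geo01_btw G (k01 _ t0E).
  have u12 := wide_angle uv1 uv2 v10 v20 u21 S0.
  have xp'b : md (mdist (polar b (- u1) v1) (polar e 1 0)) <= md (mdist x p').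
    rewrite mdist_polar ?(ltW b0) ?(ltW e0) ?sqrrN// ?expr1n ?expr0n ?addr0//.
    rewrite (metric_sym x) x2 mulr0 addr0 mulr1.
    have := sn_gt0 chi b0; have := sn_gt0 chi e0 => h1 h2.
    by have := ler_wpM2l (ltW (mulr_gt0 h1 h2)) u12; lra.
  have {}xp'b := ler_md_inv chi_le0 (mdist_ge0 _ _) xp'b.
  have zp' : mdist (polar e 1 0) (polar c u1 (- v1)) = mdist p' z.
    apply: mdist_polarE; rewrite ?ltW// ?sqrrN// ?expr1n ?expr0n ?addr0//.
    by rewrite mul0r addr0 mul1r.
  have xz : mdist (polar b (- u1) v1) (polar c u1 (- v1)) = b + c.
    apply: (md_inj chi_le0); rewrite ?mdist_ge0 ?addr_ge0 ?ltW//.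
    rewrite mdist_polar// ?ltW// ?sqrrN// mdD//.
    have -> : - u1 * u1 + v1 * - v1 = - 1 by move: uv1; lra.
    by ring.
  have := metric_triangle (polar b (- u1) v1) (polar e 1 0) (polar c u1 (- v1)).
  rewrite zp' xz => tri; have := metric_triangle x p z.
  by move: xpz; rewrite /btw -/c bE; lra.
have {}v20 : 0 < v2.
  rewrite lt_neqAle eq_sym v20 andbT; apply/eqP => v2E.
  move: uv2 S0; rewrite v2E expr0n addr0 mulr0 add0r => /eqP.
  by rewrite sqrf_eq1 (negbTE u21) /= => /eqP ->; lra.
have se := sn_gt0 chi e0.
have [t [tt0 tS]] : exists t, 0 < t <= t0 /\
    sn (t * c) * (u1 * v2 + u2 * v1) <= sn e * v2.
  have cont : continuous (fun s : R => sn (s * c) * (u1 * v2 + u2 * v1)).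
    have cc : continuous (fun s : R => sn (s * c)).
      move=> s; apply: (@continuous_comp R R R (fun s : R => s * c) sn).
        by apply: cvgMr_tmp; exact: cvg_id.
      exact: sn_continuous.
    by move=> s; apply: cvgMr_tmp; exact: cc.
  have lt : sn (0 * c) * (u1 * v2 + u2 * v1) < sn e * v2.
    by rewrite mul0r sn0 mul0r mulr_gt0.
  have [r /= r0 rS] : nbhs (0 : R)
      [set s | sn (s * c) * (u1 * v2 + u2 * v1) < sn e * v2].
    exact: (@cvgr_lt _ _ _ _ (fun s : R => sn (s * c) * (u1 * v2 + u2 * v1)) _ (cont 0)).
  exists (Num.min (r / 2) t0); split.
    by rewrite lt_min t00 divr_gt0//= ge_min lexx orbT.
  apply/ltW/rS; rewrite /= sub0r normrN gtr0_norm ?lt_min ?t00 ?divr_gt0//.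
  by rewrite gt_min; apply/orP; left; lra.
have t_01 := k01 _ tt0; have [tp t1] := andP t_01; have /andP[tgt0 _] := tt0.
exists t => //; set tau := t * c in tS.
have tau0 : 0 < tau by rewrite mulr_gt0.
have tauc : tau <= c by rewrite ler_piMl// ltW.
have [a /andP[a0 ae] cross] := polar_crossing b0 tau0 (ltW e0) uv1 uv2 v10 v20 (ltW S0) tS.
pose s := a / e; have s01 : 0 <= s <= 1.
  by rewrite divr_ge0 ?(ltW e0)//= ler_pdivrMr// mul1r.
have sE : s * e = a by rewrite divfK// gt_eqF.
have uv1' : u1 ^+ 2 + (- v1) ^+ 2 = 1 by rewrite sqrrN.
have ax : (1 : R) ^+ 2 + 0 ^+ 2 = 1 by rewrite expr1n expr0n addr0.
set P0 := polar 0 1 0; set P' := polar e 1 0; set Z := polar c u1 (- v1).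
set x' := polar b u2 v2 in cross *; set Q := polar tau u1 (- v1) in cross *.
set r' := polar a 1 0 in cross *.
have P0r : mdist P0 r' = a by rewrite mdist_polar_ray// sub0r normrN ger0_norm.
have rP' : mdist r' P' = e - a.
  by rewrite mdist_polar_ray ?(ltW e0)// distrC ger0_norm ?subr_ge0.
have P0P' : mdist P0 P' = e by rewrite mdist_polar_ray ?(ltW e0)// sub0r normrN gtr0_norm.
have P0Q : mdist P0 Q = tau.
  by rewrite /P0 (polar0 1 0 u1 (- v1)) mdist_polar_ray ?(ltW tau0)// sub0r normrN gtr0_norm.
have P0Z : mdist P0 Z = c.
  by rewrite /P0 (polar0 1 0 u1 (- v1)) mdist_polar_ray ?(ltW c0)// sub0r normrN gtr0_norm.
have QZ : mdist Q Z = c - tau.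
  by rewrite mdist_polar_ray ?(ltW c0) ?(ltW tau0)// distrC ger0_norm ?subr_ge0.
have P0x : mdist P0 x' = b.
  by rewrite /P0 (polar0 1 0 u2 v2) mdist_polar_ray ?(ltW b0)// sub0r normrN gtr0_norm.
have P'Z : mdist P' Z = mdist p' z.
  by apply: mdist_polarE; rewrite ?(ltW e0) ?(ltW c0)// mul0r addr0 mul1r.
have P'x : mdist P' x' = mdist p' x.
  by apply: mdist_polarE; rewrite ?(ltW e0) ?(ltW b0)// mul0r addr0 mul1r.
have pf : mdist p (f s) = a by rewrite (geo01_dist0 F s01) sE.
have fp' : mdist (f s) p' = e - a by rewrite (geo01_dist1 F s01) mulrBl mul1r sE.
have pk : mdist p (k t) = tau by rewrite (geo01_dist0 G t_01).
have kz : mdist (k t) z = c - tau by rewrite (geo01_dist1 G t_01) mulrBl mul1r.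
have btwr : btw P0 r' P' by rewrite /btw P0r rP' P0P' subrKC.
have btwQ : btw P0 Q Z by rewrite /btw P0Q QZ P0Z subrKC.
have zf : mdist z (f s) <= mdist Z r'.
  apply: (stewart_le_model chi_le0 btwr _ _ _ _ (H2 s s01)); rewrite ?P0r ?rP'//.
    by rewrite (metric_sym Z) P0Z metric_sym.
  by rewrite (metric_sym Z) P'Z metric_sym.
have xf : mdist x (f s) <= mdist x' r'.
  apply: (stewart_le_model chi_le0 btwr _ _ _ _ (H3 s s01)); rewrite ?P0r ?rP'//.
    by rewrite (metric_sym x') P0x bE.
  by rewrite (metric_sym x') P'x metric_sym.
have fk : mdist (f s) (k t) <= mdist r' Q.
  apply: (stewart_le_model chi_le0 btwQ _ _ _ _ (H4 s t s01 tt0)); rewrite ?P0Q ?QZ//.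
    by rewrite (metric_sym r') P0r metric_sym pf.
  by rewrite (metric_sym (f s)) (metric_sym r').
have xk : mdist x (k t) <= mdist x' Q.
  by rewrite -cross; have := metric_triangle x (f s) (k t); lra.
have x'Z : mdist x' Z <= mdist x z.
  rewrite -xpz; have := metric_triangle x' P' Z.
  by rewrite (metric_sym x' P') P'x P'Z (metric_sym p').
have := model_stewart chi_le0 x' btwQ; rewrite /stewart pk kz P0Q QZ.
rewrite (metric_sym x' P0) P0x bE => E.
have h1 : sn (tau + (c - tau)) * md (mdist x (k t)) <=
    sn (tau + (c - tau)) * md (mdist x' Q).
  by rewrite ler_wpM2l ?sn_ge0 ?subrKC ?(ltW c0)// ler_md ?mdist_ge0.
have h2 : sn tau * md (mdist x' Z) <= sn tau * md (mdist x z).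
  by rewrite ler_wpM2l ?sn_ge0 ?(ltW tau0)// ler_md ?mdist_ge0.
lra.
Qed.

End glue.

(** * Comparison for all triangles *)

Section hinges.
Variables (R : realType) (chi : R).
Hypothesis chi_le0 : chi <= 0.
Variable X : metricType R.
Implicit Types (x y z p q m : X) (s t h e : R).
Local Notation d := mdist.
Local Notation sn := (sn chi).
Local Notation md := (md chi).
Local Notation cs := (cs chi).
Local Notation K := (stewart_defect chi).
Local Notation stewart := (stewart chi).

Lemma stewart_overlap_points x y p q z : stewart x y p q -> stewart x p q z ->
  0 < d p q -> btw p q z -> stewart x y p z.
Proof.
rewrite /btw /stewart => h1 h2 pq0 <-; rewrite (addrA (d y p)).
apply: (stewart_overlap chi_le0 (mdist_ge0 _ _) pq0 (mdist_ge0 _ _) h1 h2).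
Qed.

Lemma stewart_nested_points x y q p z : stewart x y q p -> stewart x y p z ->
  0 < d q p -> btw y q p -> btw q p z -> stewart x y q z.
Proof.
rewrite /btw /stewart => h1 h2 qp0 yqp <-; rewrite (addrA (d y q)); rewrite -yqp in h2.
apply: (stewart_nested chi_le0 (mdist_ge0 _ _) qp0 (mdist_ge0 _ _) h1 h2).
Qed.

Lemma kink_stewart x m1 c m2 h : d m1 c = h -> d c m2 = h ->
  2 * (cs h * md (d x c) + md h) <= md (d x m1) + md (d x m2) -> stewart x m1 c m2.
Proof.
move=> e1 e2 kink; rewrite /stewart e1 e2 /K snD//.
have h0 : 0 <= h by rewrite -e1 mdist_ge0.
by have := ler_wpM2l (sn_ge0 chi h0) kink; lra.
Qed.

(** Comparison for narrow hinges at [y]: one side is an initial part of a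
    geodesic to [z] and the other side, of length at most [e], ends in [A]. *)
Definition narrow_hinges (A : set X) y z e : Prop := exists2 s0, 0 < s0 &
  forall s, 0 < s < s0 -> exists q,
    [/\ btw y q z, d y q = s & forall x, A x -> d x y <= e -> stewart x y q z].

Lemma narrow_hinges_kink A (f : R -> X) p q z s h e : geo01 f p q ->
  (forall t, 0 <= t <= 1 -> A (f t)) ->
  0 < h -> 0 <= s - h -> s + h <= 1 -> h * d p q <= e -> 0 < d (f s) z ->
  narrow_hinges A (f s) z e ->
  2 * (cs (h * d p q) * md (d z (f s)) + md (h * d p q)) <=
    md (d z (f (s + h))) + md (d z (f (s - h))).
Proof.
move=> [_ _ fE] fA h0 sh0 sh1 he sz [s0 s00 H].
have [s01 sp01 sm01] : [/\ 0 <= s <= 1, 0 <= s + h <= 1 & 0 <= s - h <= 1] by split; lra.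
have d1 : d (f (s + h)) (f s) = h * d p q.
  by rewrite fE// addrAC subrr add0r gtr0_norm// mulrC.
have d2 : d (f s) (f (s - h)) = h * d p q.
  by rewrite fE// opprB addrC subrK gtr0_norm// mulrC.
have d3 : d (f (s + h)) (f (s - h)) = 2 * (h * d p q).
  rewrite fE// (_ : s + h - (s - h) = 2 * h); last ring.
  by rewrite gtr0_norm ?mulr_gt0//; ring.
apply: (stewart_hinges_kink chi_le0 d1 d2 d3 sz s00) => r r0.
have [q' [b e' st]] := H r r0; exists q'; split=> //; apply: st; rewrite ?d1//; try exact: fA.
by rewrite metric_sym d2.
Qed.

Lemma narrow_hinges_stewart A (f : R -> X) p q z t : geo01 f p q ->
  (forall t, 0 <= t <= 1 -> A (f t)) ->
  (forall s, 0 < s < 1 -> 0 < d (f s) z ->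
    exists2 e, 0 < e & narrow_hinges A (f s) z e) ->
  0 <= t <= 1 -> stewart z p (f t) q.
Proof.
move=> F fA H t01; apply: (kinks_stewart chi_le0 F) => // s s01.
have s01' : 0 <= s <= 1 by lra.
have [z0|z0] := eqVneq (d (f s) z) 0.
  exists 1 => // h /andP[h0 _] sh0 sh1; have <- : f s = z by exact: mdist_positivity.
  have [_ _ fE] := F; rewrite mdistxx md0 mulr0 add0r !fE//; [|lra..].
  have -> : s - (s + h) = - h by ring.
  have -> : s - (s - h) = h by ring.
  by rewrite normrN gtr0_norm// (mulrC h); lra.
have {}z0 : 0 < d (f s) z by rewrite lt_neqAle eq_sym z0 mdist_ge0.
have [e e0 He] := H s s01 z0.
have l0 : 0 < d p q + 1 by rewrite ltr_wpDl ?mdist_ge0.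
exists (e / (d p q + 1)) => [|h /andP[h0 he] sh0 sh1]; first by rewrite divr_gt0.
apply: (narrow_hinges_kink F fA h0 sh0 sh1 _ z0 He).
by move: he; rewrite ltr_pdivlMr//; lra.
Qed.

End hinges.

Section relative_comparison.
Variables (R : realType) (chi : R) (X : metricType R) (Delta : set X) (lambda : R).
Hypothesis chi_le0 : chi <= 0.
Hypothesis rc : relative_cat0 Delta lambda.
Implicit Types (x y z p q m w : X) (s t h e u : R) (n : nat).
Local Notation d := mdist.
Local Notation stewart := (stewart chi).
Hypothesis vertex : forall x p m q, btw p m q ->
  Delta x \/ Delta p \/ Delta q -> stewart x p m q.
Let Xgeo := rc_geodesic rc.

(** The two halves of a side that passes through [c] in [Delta] belong to
    triangles with the vertex [c]; so do the hinges at [c] that give the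
    comparison at [c] itself. *)
Lemma stewart_through (g : R -> X) x y z u s : geo01 g y z -> 0 <= u <= 1 ->
  Delta (g u) -> 0 <= s < u -> stewart x y (g s) z.
Proof.
move=> G u01 Dc /andP[s0 su]; set c := g u in Dc; have [g0 g1 gE] := G.
have s01 : 0 <= s <= 1 by lra.
have B a b a' : 0 <= a -> a <= b -> b <= a' -> a' <= 1 -> btw (g a) (g b) (g a').
  move=> a0 ab ba' a'1; rewrite /btw !gE; [|lra..].
  by rewrite !ler0_norm; [ring|lra..].
have [yz|yz] := eqVneq (d y z) 0.
  have gy a : 0 <= a <= 1 -> g a = y.
    move=> a01; apply: mdist_positivity.
    by rewrite metric_sym (geo01_dist0 G a01) yz mulr0.
  rewrite -g0 -g1; apply: vertex; first by apply: B; lra.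
  by right; left; rewrite gy ?lexx ?ler01// -(gy u u01).
have {}yz : 0 < d y z by rewrite lt_neqAle eq_sym yz mdist_ge0.
have len a b : 0 <= a <= 1 -> 0 <= b <= 1 -> a <= b -> d (g a) (g b) = (b - a) * d y z.
  by move=> a01 b01 ab; rewrite gE// distrC ger0_norm ?subr_ge0// mulrC.
have len0 a b : 0 <= a -> b <= 1 -> a < b -> 0 < d (g a) (g b).
  move=> a0 b1 ab; rewrite len ?(ltW ab)//; [|lra|lra].
  by rewrite mulr_gt0// subr_gt0.
have [u1|u1] := eqVneq u 1.
  rewrite -g0 -g1; apply: vertex; first by apply: B; lra.
  by right; right; rewrite -u1.
have {}u1 : u < 1 by rewrite lt_neqAle u1; case/andP: u01.
have [xc|xc] := eqVneq (d c x) 0.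
  have <- : c = x by exact: mdist_positivity.
  by apply: vertex; [exact: geo01_btw G s01|left].
have {}xc : 0 < d c x by rewrite lt_neqAle eq_sym xc mdist_ge0.
pose v := Num.min u (1 - u); have v0 : 0 < v by rewrite lt_min; apply/andP; split; lra.
have [vu vu1] : v <= u /\ v <= 1 - u by rewrite !ge_min !lexx orbT.
have kink : stewart x (g (u - v)) c (g (u + v)).
  have d1 : d (g (u - v)) c = v * d y z by rewrite len//; [congr (_ * _); ring|lra..].
  have d2 : d c (g (u + v)) = v * d y z by rewrite len//; [congr (_ * _); ring|lra..].
  have d3 : d (g (u - v)) (g (u + v)) = 2 * (v * d y z) by rewrite len//; [ring|lra..].
  apply: (kink_stewart chi_le0 d1 d2).
  apply: (stewart_hinges_kink chi_le0 d1 d2 d3 xc xc) => r /andP[r0 rx].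
  have Gx := pt_geo01 Xgeo c x; have rx01 : 0 <= r / d c x <= 1.
    by rewrite divr_ge0 ?(ltW r0) ?(ltW xc)//= ler_pdivrMr// mul1r ltW.
  have b := geo01_btw Gx rx01.
  exists (pt Xgeo c x (r / d c x)); split=> //.
  - by rewrite (geo01_dist0 Gx)// divfK// gt_eqF.
  - by apply: vertex => //; auto.
  - by apply: vertex => //; auto.
have half1 a : 0 <= a -> a <= u -> stewart x y (g a) c.
  by move=> a0 au; rewrite -g0; apply: vertex; [apply: B => //; lra|auto].
have half2 a : u <= a -> a <= 1 -> stewart x c (g a) z.
  by move=> ua a1; rewrite -g1; apply: vertex; [apply: B => //; lra|auto].
have right_c : stewart x y c (g (u + v)).
  have [uv|uv] := eqVneq u v.
    by have e : u - v = 0; [lra|rewrite e g0 in kink].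
  apply/stewart_sym; apply: (stewart_overlap_points chi_le0 (q := g (u - v))).
  - exact/stewart_sym.
  - by apply/stewart_sym/half1; lra.
  - by rewrite metric_sym len0//; lra.
  - by apply/btw_sym; rewrite -g0; apply: B; lra.
have at_c : stewart x y c z.
  apply: (stewart_overlap_points chi_le0 right_c); first by apply: half2; lra.
  - by rewrite len0//; lra.
  - by rewrite -g1; apply: B; lra.
apply: (stewart_nested_points chi_le0 (half1 s s0 (ltW su)) at_c).
- by rewrite len0//; lra.
- by rewrite -g0; apply: B; lra.
- by rewrite -g1; apply: B; lra.
Qed.

End relative_comparison.

(** A geodesic to a fixed point [z] that avoids [Delta], and the points within
    [e] of it, where the comparison for narrow hinges is extended from short to
    long geodesics towards [z]. *)
Section tube.
Variables (R : realType) (chi : R) (X : metricType R) (Delta : set X) (lambda : R).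
Hypothesis chi_le0 : chi <= 0.
Hypothesis rc : relative_cat0 Delta lambda.
Implicit Types (x y z p q m w : X) (s t h u : R) (n : nat).
Local Notation d := mdist.
Local Notation stewart := (stewart chi).
Hypothesis ball : forall w r, 0 < r -> far Delta r w -> forall x p m q,
  d w x <= lambda * r -> d w p <= lambda * r ->
  d w m <= lambda * r -> d w q <= lambda * r -> btw p m q -> stewart x p m q.
Let Xgeo := rc_geodesic rc.
Variables (y0 z : X) (eta : R -> X) (mu delta e : R).
Hypothesis eta_geo : geo01 eta y0 z.
Hypothesis mu_gt0 : 0 < mu.
Hypothesis eta_far : forall t, 0 <= t <= 1 -> far Delta mu (eta t).
Hypothesis perturbation : forall x y z' (g h : R -> X),
    geo01 g y z' -> d y z' <= d y0 z + 1 ->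
    (forall t, 0 <= t <= 1 -> far Delta (mu / 2) (g t)) -> d x y <= e -> geo01 h x z' ->
    forall t, 0 <= t <= 1 -> d (g t) (h t) <= d x y.
Hypothesis delta_gt0 : 0 < delta.
Hypothesis delta_small : 16 * delta <= lambda * (mu / 2).
Hypothesis e_gt0 : 0 < e.
Hypothesis e_mu : e <= mu / 2.
Hypothesis e_le1 : e <= 1.
Hypothesis e_delta : e <= delta / 2.

Definition tube w : Prop := exists2 u, 0 <= u <= 1 & d w (eta u) <= e.

Lemma tube_far w : tube w -> far Delta (mu / 2) w.
Proof.
move=> [u u01 wu]; apply: (@far_le _ _ _ (mu - d (eta u) w)); last first.
  by apply: far_lipschitz; exact: eta_far.
by have := e_mu; rewrite metric_sym; lra.
Qed.

Let mu2 : 0 < mu / 2.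
Proof. by rewrite divr_gt0. Qed.

Lemma tube_stewart w x p m q : tube w -> d w x <= 16 * delta -> d w p <= 16 * delta ->
  d w m <= 16 * delta -> d w q <= 16 * delta -> btw p m q -> stewart x p m q.
Proof.
by move=> Tw wx wp wm wq; apply: (ball mu2 (tube_far Tw)); apply: le_trans delta_small.
Qed.

Lemma tube_cat0_ball w : tube w -> cat0_ball w (2 * (2 * e)).
Proof.
move=> Tw; apply: cat0_ball_le (rc_ball rc mu2 (tube_far Tw)).
by apply: le_trans delta_small; have := delta_gt0; have := e_delta; lra.
Qed.

Lemma tube_dist w : tube w -> d w z <= d y0 z + 1.
Proof.
move=> [u u01 wu]; have := metric_triangle w (eta u) z.
rewrite (geo01_dist1 eta_geo u01); have := mdist_ge0 y0 z; have := e_le1.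
have : (1 - u) * d y0 z <= 1 * d y0 z by rewrite ler_wpM2r ?mdist_ge0//; lra.
lra.
Qed.

Lemma tube_towards w (h : R -> X) t : tube w -> geo01 h w z -> 0 <= t <= 1 -> tube (h t).
Proof.
move=> [u u01 wu] H t01; have [_ eta1 _] := eta_geo; have /andP[u0 u1] := u01.
have G := sub_geo01 eta_geo u0 u1 (lexx 1); rewrite eta1 in G.
have in01 r : 0 <= r <= 1 -> 0 <= u + r * (1 - u) <= 1 by move=> r01; nra.
exists (u + t * (1 - u)); first exact: in01.
rewrite metric_sym; apply: (le_trans _ wu).
apply: (perturbation G _ _ _ H t01) => // [|r r01].
  rewrite (geo01_dist1 eta_geo u01).
  have : (1 - u) * d y0 z <= 1 * d y0 z by rewrite ler_wpM2r ?mdist_ge0//; lra.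
  lra.
by apply: (far_le _ (eta_far (in01 r r01))); have := mu_gt0; lra.
Qed.

Lemma tube_fellow x y (g h : R -> X) t : tube y -> geo01 g y z -> d x y <= e ->
  geo01 h x z -> 0 <= t <= 1 -> d (g t) (h t) <= d x y.
Proof.
move=> Ty G xy H t01; apply: (perturbation G _ _ xy H t01); first exact: tube_dist.
by move=> r r01; apply: tube_far; exact: (tube_towards Ty G r01).
Qed.

Lemma tube_short p q (f : R -> X) t : tube p -> tube q -> d p q <= e -> geo01 f p q ->
  0 <= t <= 1 -> tube (f t).
Proof.
have main p' q' (f' : R -> X) t' u v : tube p' -> 0 <= u -> u <= v -> v <= 1 ->
    d p' (eta u) <= e -> d q' (eta v) <= e -> d p' q' <= e -> geo01 f' p' q' ->
    0 <= t' <= 1 -> tube (f' t').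
  move=> Tp u0 uv v1 pu qv pq F t01; have e0 := e_gt0.
  exists (u + t' * (v - u)); first nra.
  have := cat0_fellow Xgeo (tube_cat0_ball Tp) F (sub_geo01 eta_geo u0 uv v1) t01.
  rewrite mdistxx => /(_ _ _ _ _)/le_trans; apply; [|lra|by have := metric_triangle p' q' (eta v); lra| |].
  - by rewrite mulr_ge0// ltW.
  - by lra.
  - nra.
move=> Tp Tq pq F t01; have [u u01 pu] := Tp; have [v v01 qv] := Tq.
have [uv|vu] := leP u v.
  by apply: (main p q f t u v) => //; lra.
have -> : f t = f (1 - (1 - t)) by congr f; ring.
apply: (main q p (fun t => f (1 - t)) (1 - t) v u) => //; try lra.
  by rewrite metric_sym.
exact: geo01_rev.
Qed.

(** Induction on the length of the side [y, z], with hinges of the same width.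
    The comparison for the triangle [z, p, p'] spanned by a short segment close
    to [[y, x]] follows from its kinks, which are given by shorter hinges; so
    does the comparison for the triangles [r, p, z] with [r] on that segment.
    Gluing gives the comparison for [x] and the side [p, z], which combines with
    the comparison in a ball around [p]. *)
Lemma tube_hinges n y x q : tube y -> tube x -> d x y <= e -> d y z <= n%:R * delta ->
  btw y q z -> d y q <= delta -> stewart x y q z.
Proof.
have d0 := delta_gt0; have e0 := e_gt0; have ed := e_delta.
elim: n y x q => [|n IH] y x q Ty Tx xy yz yqz yq.
  rewrite mul0r in yz; have qz := mdist_ge0 q z; rewrite /btw in yqz.
  by apply: (tube_stewart Ty) => //; rewrite ?mdistxx 1?(metric_sym y x); lra.
have [yz8|yz8] := leP (d y z) (8 * delta).
  by apply: (tube_stewart Ty) => //; rewrite ?mdistxx 1?(metric_sym y x); lra.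
have [g G [tq tq01 [tqE gq]]] := btw_geo01 Xgeo yqz.
have c0 : 0 < d y z by lra.
pose tp := 2 * delta / d y z.
have tpE : tp * d y z = 2 * delta by rewrite divfK// gt_eqF.
have tp01 : 0 <= tp <= 1.
  by rewrite divr_ge0 ?mulr_ge0 ?(ltW d0) ?(ltW c0)//= ler_pdivrMr//; lra.
have tp1 : tp < 1 by rewrite ltr_pdivrMr//; lra.
pose p := g tp; have [g0 g1 gE] := G.
have yp : d y p = 2 * delta by rewrite (geo01_dist0 G tp01).
have pz : d p z = d y z - 2 * delta by rewrite (geo01_dist1 G tp01) mulrBl mul1r tpE.
(* On [x, z] the point [p'] has the same parameter as [p] on [y, z], hence is
   close to [p]. *)
have H := pt_geo01 Xgeo x z; set h := pt Xgeo x z in H; pose p' := h tp.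
have pp' : d p p' <= e by apply: le_trans (tube_fellow Ty G xy H tp01) xy.
have Tp : tube p := tube_towards Ty G tp01.
have Tp' : tube p' := tube_towards Tx H tp01.
have F := pt_geo01 Xgeo p p'; set f := pt Xgeo p p' in F.
have Tf s : 0 <= s <= 1 -> tube (f s) := tube_short Tp Tp' pp' F.
have yzn : d y z <= n%:R * delta + delta.
  by move: yz; rewrite -[in n.+1%:R]addn1 natrD mulrDl mul1r.
have pf s : 0 <= s <= 1 -> d p (f s) <= e.
  move=> s01; rewrite (geo01_dist0 F s01); apply: le_trans pp'.
  by rewrite ler_piMl ?mdist_ge0//; case/andP: s01.
have px : d p x <= 2 * delta + e.
  by have := metric_triangle p y x; rewrite (metric_sym p y) (metric_sym y x) yp; lra.
have H2 s : 0 <= s <= 1 -> stewart z p (f s) p'.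
  move=> s01; apply: (narrow_hinges_stewart chi_le0 F Tf) s01 => {}s s01 rz.
  have s01' : 0 <= s <= 1 by lra.
  exists e => //; exists delta => // r /andP[r0 r1].
  have lo : d p z <= d p (f s) + d (f s) z by exact: metric_triangle.
  have hi := metric_triangle (f s) p z; rewrite (metric_sym (f s) p) in hi.
  have pfs := pf s s01'; have G' := pt_geo01 Xgeo (f s) z.
  have r01 : 0 <= r / d (f s) z <= 1.
    by rewrite divr_ge0 ?(ltW r0) ?(ltW rz)//= ler_pdivrMr//; lra.
  have rE : d (f s) (pt Xgeo (f s) z (r / d (f s) z)) = r.
    by rewrite (geo01_dist0 G' r01) divfK// gt_eqF.
  have B := geo01_btw G' r01.
  exists (pt Xgeo (f s) z (r / d (f s) z)); split=> // w Tw wf.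
  apply: IH => //; last by rewrite rE ltW.
  - exact: Tf.
  - by lra.
have H3 s : 0 <= s <= 1 -> stewart x p (f s) p'.
  move=> s01; have := pf s s01 => pfs.
  by apply: (tube_stewart Tp) (geo01_btw F s01); rewrite ?mdistxx; lra.
pose k t := g (tp + t * (1 - tp)).
have Kg : geo01 k p z by have := sub_geo01 G (andP tp01).1 (andP tp01).2 (lexx 1); rewrite g1.
have pz0 : 0 < d p z by rewrite pz; lra.
pose t0 := delta / d p z.
have t0E : t0 * d p z = delta by rewrite divfK// gt_eqF.
have t001 : 0 < t0 <= 1 by rewrite divr_gt0//= ler_pdivrMr// pz; lra.
have pk t : 0 < t <= t0 -> d p (k t) <= delta /\ 0 <= t <= 1.
  move=> /andP[tgt0 tt0]; have t01 : 0 <= t <= 1 by lra.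
  by split=> //; rewrite (geo01_dist0 Kg t01) -t0E ler_pM2r.
have H4 s t : 0 <= s <= 1 -> 0 < t <= t0 -> stewart (f s) p (k t) z.
  move=> s01 tt0; have [pkt t01] := pk t tt0.
  apply: IH => //; [exact: Tf|by rewrite metric_sym pf|by rewrite pz; lra|].
  exact: geo01_btw Kg t01.
have xp : d p p' < d x p.
  by have := metric_triangle y x p; rewrite yp (metric_sym y x); lra.
have [t tt0 St] := stewart_glue chi_le0 F Kg pz0 xp (geo01_btw H tp01) t001 H2 H3 H4.
have [pkt t01] := pk t tt0; have tgt0 : 0 < t by case/andP: tt0.
have kz := geo01_btw Kg t01.
have pk0 : 0 < d p (k t) by rewrite (geo01_dist0 Kg t01) mulr_gt0.
have ypz : btw y p z by exact: geo01_btw G tp01.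
have btw_sub a b : 0 <= a -> a <= b -> b <= 1 -> btw y (g a) (g b).
  move=> a0 ab b1; rewrite /btw -g0 !gE; [|lra..].
  by rewrite !ler0_norm; [ring|lra..].
have S1 : stewart x y p (k t).
  apply: (tube_stewart Tp); rewrite ?mdistxx ?(metric_sym p y) ?yp; try lra.
  by apply: btw_sub; nra.
have S2 : stewart x y p z := stewart_overlap_points chi_le0 S1 St pk0 kz.
have qp : tq <= tp.
  by rewrite -(ler_pM2r c0) tpE tqE; lra.
have yqp : btw y q p by rewrite -gq; apply: btw_sub; lra.
have qp0 : 0 < d q p by move: yqp; rewrite /btw yp; lra.
have S3 : stewart x y q p.
  apply: (tube_stewart Tp _ _ _ _ yqp); rewrite ?mdistxx ?(metric_sym p y) ?yp; try lra.
  by rewrite metric_sym; move: yqp; rewrite /btw yp; have := mdist_ge0 y q; lra.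
apply: (stewart_nested_points chi_le0 S3 S2 qp0 yqp).
by move: yqp ypz yqz; rewrite /btw; lra.
Qed.

End tube.

Section all_triangles.
Variables (R : realType) (chi : R) (X : metricType R) (Delta : set X) (lambda : R).
Hypothesis chi_le0 : chi <= 0.
Hypothesis rc : relative_cat0 Delta lambda.
Hypothesis unique : forall c, Delta c ->
  unique_local_geodesics (completion (tangent_space c)).
Implicit Types (x y z p q m w : X) (s t e u : R).
Local Notation d := mdist.
Local Notation stewart := (stewart chi).
Hypothesis vertex : forall x p m q, btw p m q ->
  Delta x \/ Delta p \/ Delta q -> stewart x p m q.
Hypothesis ball : forall w r, 0 < r -> far Delta r w -> forall x p m q,
  d w x <= lambda * r -> d w p <= lambda * r ->
  d w m <= lambda * r -> d w q <= lambda * r -> btw p m q -> stewart x p m q.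
Let Xgeo := rc_geodesic rc.

Lemma exists_narrow_hinges y z : 0 < d y z ->
  exists2 e, 0 < e & narrow_hinges chi setT y z e.
Proof.
move=> yz; have G := pt_geo01 Xgeo y z; set g := pt Xgeo y z in G.
have [g0 g1 _] := G.
have frac s : 0 < s -> s < d y z -> 0 <= s / d y z <= 1.
  by move=> s0 s1; rewrite divr_ge0 ?(ltW s0) ?(ltW yz)//= ler_pdivrMr// mul1r ltW.
have dist s : 0 < s -> s < d y z -> d y (g (s / d y z)) = s.
  by move=> s0 s1; rewrite (geo01_dist0 G (frac s s0 s1)) divfK// gt_eqF.
have [[u u01 Du]|avoid] := pselect (exists2 u, 0 <= u <= 1 & Delta (g u)).
  exists 1 => //; have [u0|u0] := eqVneq u 0.
    exists (d y z) => // s /andP[s0 s1]; exists (g (s / d y z)).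
    have B := geo01_btw G (frac s s0 s1); split=> //; first exact: dist.
    by move=> x _ _; apply: vertex => //; right; left; rewrite -g0 -u0.
  have {}u0 : 0 < u by rewrite lt_neqAle eq_sym u0; case/andP: u01.
  exists (u * d y z) => [|s /andP[s0 s1]]; first exact: mulr_gt0.
  have syz : s < d y z.
    by apply: lt_le_trans s1 _; rewrite ler_piMl// ?(ltW yz)//; case/andP: u01.
  exists (g (s / d y z)); split; [exact: geo01_btw G (frac s s0 syz)|exact: dist|].
  move=> x _ _; apply: (stewart_through chi_le0 rc vertex x G u01 Du).
  by rewrite ltr_pdivrMr// s1 andbT; case/andP: (frac s s0 syz).
have nD t : 0 <= t <= 1 -> ~ Delta (g t) by move=> t01 Dt; apply: avoid; exists t.
have [mu mu0 gfar] := geodesic_clearance rc G nD.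
have L0 : 0 <= d y z + 1 by rewrite addr_ge0// ltW.
have mu2 : 0 < mu / 2 by rewrite divr_gt0.
have [e1 e10 pert] := geodesic_perturbation rc unique L0 mu2.
(* Points of the tube of radius [mu / 2] have distance [mu / 2] from [Delta], and
   the induction works in balls of radius [16 * delta]. *)
pose delta := lambda * (mu / 2) / 16.
have delta0 : 0 < delta by rewrite divr_gt0// mulr_gt0// (rc_lambda rc).
pose e := Num.min (Num.min e1 (mu / 2)) (Num.min 1 (delta / 2)).
have e0 : 0 < e by rewrite !lt_min e10 mu2 ltr01 divr_gt0.
have [ee1 emu e_1 ed] : [/\ e <= e1, e <= mu / 2, e <= 1 & e <= delta / 2].
  by split; rewrite !ge_min lexx ?orbT.
have dE : 16 * delta <= lambda * (mu / 2) by rewrite /delta mulrC divfK.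
have pert' x' y' z' (g' h' : R -> X) : geo01 g' y' z' -> d y' z' <= d y z + 1 ->
    (forall t, 0 <= t <= 1 -> far Delta (mu / 2) (g' t)) -> d x' y' <= e ->
    geo01 h' x' z' -> forall t, 0 <= t <= 1 -> d (g' t) (h' t) <= d x' y'.
  by move=> G' L' f' xe H'; apply: (pert x' y' z') => //; exact: le_trans ee1.
exists e => //; exists (Num.min delta (d y z)) => [|s /andP[s0]]; first by rewrite lt_min delta0.
rewrite lt_min => /andP[sd syz]; exists (g (s / d y z)).
have B := geo01_btw G (frac s s0 syz); split=> //; first exact: dist.
have t0 : 0 <= (0 : R) <= 1 by rewrite lexx ler01.
move=> x _ xy; apply: (@tube_hinges R chi X Delta lambda chi_le0 rc ball y z g mu delta e
  G mu0 gfar pert' delta0 dE e0 emu e_1 ed (Num.truncn (d y z / delta)).+1) => //.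
- by exists 0; rewrite // g0 mdistxx ltW.
- by exists 0; rewrite // g0.
- rewrite -ler_pdivrMr//; have q0 : 0 <= d y z / delta by rewrite divr_ge0// ltW.
  by have /truncn_itv/andP[_ /ltW] := q0.
- by rewrite dist// ltW.
Qed.

Lemma stewart_all x p m q : btw p m q -> stewart x p m q.
Proof.
move=> pmq; have [g G [t t01 [_ <-]]] := btw_geo01 Xgeo pmq.
apply: (narrow_hinges_stewart (A := setT) chi_le0 G) => // s _; exact: exists_narrow_hinges.
Qed.

End all_triangles.

Theorem theorem1p1 (R : realType) (chi : R) (X : metricType R) (Delta : set X)
  (hchi : chi <= 0)
  (hXcomplete : complete_space X)
  (hXgeodesic : geodesic_space X)
  (hDelta0 : Delta !=set0)
  (hDeltaclosed : closed Delta)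
  (hDeltaconvex : geodesically_convex Delta)
  (hA : forall (v : 'I_3 -> X) (e : 'I_3 -> curve R X),
    geodesic_triangle v e -> (exists i : 'I_3, Delta (v i)) ->
    CAT_inequality chi e)
  (hB : forall c : X, Delta c ->
    unique_local_geodesics (completion (tangent_space c)))
  (hC : exists lambda : R, 0 < lambda /\
    forall x : X, ~ Delta x ->
      complete_space (metric_closed_ball x (lambda * dist_to_set x Delta)) /\
      CAT chi (metric_closed_ball x (lambda * dist_to_set x Delta))) :
  CAT chi X.
Proof.
have vertex := hinge_hypothesis_stewart hchi hXgeodesic hA.
have [lambda [lambda0 hball]] := hC.
have ball := ball_hypothesis_stewart hchi lambda0 hDelta0 (fun x nD => (hball x nD).2).
have rc : relative_cat0 Delta lambda.
  split=> //.
  - by move=> u; exact: complete_cauchy_seq.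
  - by move=> x; exact: closed_far.
  - move=> x m y Dx Dy xmy; have [g G [t t01 [_ <-]]] := btw_geo01 hXgeodesic xmy.
    have [gg gxy] := geo01_geodesic G; have [_ /(_ _ gg gxy t)] := hDeltaconvex x y Dx Dy.
    by apply; rewrite /cdom /= in_itv.
  - by move=> x p m q pmq D; apply: (stewart_stewart0 hchi pmq); exact: vertex.
  - move=> w r r0 wr x p m q wx wp wm wq pmq.
    by apply: (stewart_stewart0 hchi pmq); exact: (ball w r).
by apply: (stewart_CAT hchi hXgeodesic) => x p m q; exact: (stewart_all hchi rc hB vertex ball).
Qed.
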